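(* Let $1\leq k\leq l$ be integers and $\delta,\epsilon\in\{0,1\}$. The distinguished triangle in the stable category of $\mathscr{A}(1)$-modules $$\Omega A_{k,\epsilon}\to A_{k,\epsilon}\otimes A_{l,\delta}\to(\Omega\Sigma^{-1})^{l+1}J^{\otimes\delta}\otimes A_{k,\epsilon}\to$$ obtained by applying $A_{k,\epsilon}\otimes-$ to the short exact sequence $0\to A_{l,\delta}\to(\Omega\Sigma^{-1})^{l+1}J^{\otimes\delta}\to\mathbb{F}\to0$ splits, giving a stable isomorphism $$A_{k,\epsilon}\otimes A_{l,\delta}\simeq\Omega A_{k,\epsilon}\oplus(\Omega\Sigma^{-1})^{l+1}J^{\otimes\delta}\otimes A_{k,\epsilon},$$ if and only if $k,l,\delta,\epsilon$ do not satisfy both of the conditions $k=l$ and $\delta+\epsilon\equiv1\bmod2$.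
   Context: $\mathbb{F}=\mathbb{F}_2$; $\mathscr{A}(1)$ is the sub-Hopf algebra of the mod 2 Steenrod algebra generated by $Sq^1,Sq^2$. Modules are $\mathbb{Z}$-graded, $\otimes$ is over $\mathbb{F}$ with the diagonal action, $(\Sigma M)^n=M^{n-1}$. The stable module category has morphisms $\mathrm{Hom}_{\mathscr{A}(1)}(M,N)$ modulo maps factoring through projectives; $\simeq$ is isomorphism in it; it is triangulated with desuspension $\Omega$. A module is reduced if $Sq^2Sq^2Sq^2$ acts trivially; every bounded-below module is free $\oplus\,M^{\mathrm{red}}$ with $M^{\mathrm{red}}$ reduced. $\Omega\mathbb{F}$ is the augmentation ideal of $\mathscr{A}(1)$ and $\Omega^nM=((\Omega\mathbb{F})^{\otimes n}\otimes M)^{\mathrm{red}}$ for $n\geq0$. $J=\Sigma^{-2}\big(\mathscr{A}(1)/\mathscr{A}(1)Sq^1Sq^2\big)$ (the Joker). For $k\geq1$, $\epsilon\in\{0,1\}$, $A_{k,\epsilon}$ is the kernel of the unique non-trivial morphism $(\Omega\Sigma^{-1})^{k+1}J^{\otimes\epsilon}\to\mathbb{F}$. The triangle splits when its connecting morphism $(\Omega\Sigma^{-1})^{l+1}J^{\otimes\delta}\otimes A_{k,\epsilon}\to A_{k,\epsilon}$ is zero in the stable category. *)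

(* Defs.v *)
From HB Require Import structures.
From mathcomp Require Import all_boot all_order all_algebra ssrAC.
From mathcomp Require Import sesquilinear ring_quotient generic_quotient.
From mathcomp Require Import boolp.

Set Implicit Arguments.
Unset Strict Implicit.
Unset Printing Implicit Defensive.

Import GRing.Theory.
Local Open Scope ring_scope.
Local Open Scope quotient_scope.

Section TensorSpace.
Variables (K : fieldType) (U V : lmodType K).

Definition tsum (W : lmodType K) (b : {bilinear U -> V -> W})
    (s : seq (U * V)) : W := \sum_(p <- s) b p.1 p.2.

(* U (x) V: formal sums of pairs, identified when every bilinear map takes the
   same value on them. *)
Definition tens_eq (s t : seq (U * V)) : bool :=
  `[< forall (W : lmodType K) (b : {bilinear U -> V -> W}),
        tsum b s = tsum b t >].

Lemma tens_eq_class : equiv_class_of tens_eq.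
Proof.
split=> [s|s t|t s u].
- exact/asboolP.
- by apply/asboolP/asboolP=> h W b; rewrite h.
- by move=> /asboolP h1 /asboolP h2; apply/asboolP => W b; rewrite h1.
Qed.
Canonical tens_equiv := EquivRelPack tens_eq_class.
Canonical tens_encModRel := defaultEncModRel tens_eq.

Definition tens := {eq_quot tens_eq}.
HB.instance Definition _ := Choice.on tens.

Definition tlift (W : lmodType K) (b : {bilinear U -> V -> W}) (z : tens) : W :=
  tsum b (repr z).

Lemma tlift_pi (W : lmodType K) (b : {bilinear U -> V -> W}) s :
  tlift b (\pi_tens s) = tsum b s.
Proof.
rewrite /tlift; have : tens_eq (repr (\pi_tens s)) s.
  by rewrite -eqmodE reprK.
by move/asboolP; apply.
Qed.

Lemma tens_ext (y z : tens) :
  (forall (W : lmodType K) (b : {bilinear U -> V -> W}),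
     tlift b y = tlift b z) -> y = z.
Proof.
move=> h; rewrite -[y]reprK -[z]reprK; apply/eqmodP/asboolP => W b.
exact: h.
Qed.

Definition tens_zero : tens := \pi_tens [::].
Definition tens_add (y z : tens) : tens := \pi_tens (repr y ++ repr z).
Definition tens_scale (a : K) (z : tens) : tens :=
  \pi_tens [seq (a *: p.1, p.2) | p <- repr z].
Definition tens_opp (z : tens) : tens := tens_scale (-1) z.

Lemma tlift0 (W : lmodType K) (b : {bilinear U -> V -> W}) :
  tlift b tens_zero = 0.
Proof. by rewrite tlift_pi /tsum big_nil. Qed.

Lemma tliftD (W : lmodType K) (b : {bilinear U -> V -> W}) y z :
  tlift b (tens_add y z) = tlift b y + tlift b z.
Proof. by rewrite tlift_pi /tsum big_cat. Qed.

Lemma tliftZ (W : lmodType K) (b : {bilinear U -> V -> W}) a z :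
  tlift b (tens_scale a z) = a *: tlift b z.
Proof.
rewrite tlift_pi /tsum big_map scaler_sumr; apply: eq_bigr => p _.
by rewrite linearZl_LR.
Qed.

Lemma tens_addA : associative tens_add.
Proof. by move=> x y z; apply: tens_ext => W b; rewrite !tliftD addrA. Qed.
Lemma tens_addC : commutative tens_add.
Proof. by move=> x y; apply: tens_ext => W b; rewrite !tliftD addrC. Qed.
Lemma tens_add0 : left_id tens_zero tens_add.
Proof. by move=> x; apply: tens_ext => W b; rewrite tliftD tlift0 add0r. Qed.
Lemma tens_addN : left_inverse tens_zero tens_opp tens_add.
Proof.
move=> x; apply: tens_ext => W b.
by rewrite tliftD tliftZ tlift0 scaleN1r addNr.
Qed.
HB.instance Definition _ :=
  GRing.isZmodule.Build tens tens_addA tens_addC tens_add0 tens_addN.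

Lemma tens_scaleA a b (v : tens) :
  tens_scale a (tens_scale b v) = tens_scale (a * b) v.
Proof. by apply: tens_ext => W f; rewrite !tliftZ scalerA. Qed.
Lemma tens_scale1 : left_id 1 tens_scale.
Proof. by move=> v; apply: tens_ext => W f; rewrite tliftZ scale1r. Qed.
Lemma tens_scaleDr : right_distributive tens_scale +%R.
Proof.
by move=> a u v; apply: tens_ext => W f; rewrite !(tliftD, tliftZ) scalerDr.
Qed.
Lemma tens_scaleDl (v : tens) :
  {morph tens_scale^~ v : a b / a + b}.
Proof.
by move=> a b; apply: tens_ext => W f; rewrite !(tliftD, tliftZ) scalerDl.
Qed.
HB.instance Definition _ := GRing.Zmodule_isLmodule.Build K tens
  tens_scaleA tens_scale1 tens_scaleDr tens_scaleDl.

Lemma tlift_is_linear (W : lmodType K) (b : {bilinear U -> V -> W}) :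
  linear (tlift b).
Proof. by move=> a y z; rewrite tliftD tliftZ. Qed.
HB.instance Definition _ (W : lmodType K) (b : {bilinear U -> V -> W}) :=
  GRing.isLinear.Build K tens W _ (tlift b) (tlift_is_linear b).

Definition tpure (u : U) (v : V) : tens := \pi_tens [:: (u, v)].

Lemma tlift_tpure (W : lmodType K) (b : {bilinear U -> V -> W}) u v :
  tlift b (tpure u v) = b u v.
Proof. by rewrite tlift_pi /tsum big_seq1. Qed.

Lemma tpure_is_bilinear : bilinear_for
  (GRing.Scale.Law.clone _ _ *:%R _) (GRing.Scale.Law.clone _ _ *:%R _) tpure.
Proof.
split=> [v a x y|u a x y]; apply: tens_ext => W b;
  by rewrite linearP /= !tlift_tpure ?linearPl ?linearPr.
Qed.
HB.instance Definition _ :=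
  bilinear_isBilinear.Build K U V tens _ _ tpure tpure_is_bilinear.

End TensorSpace.

Definition mklin (K : fieldType) (U V : lmodType K) (f : U -> V)
  (h : linear f) : {linear U -> V} :=
  HB.pack f (GRing.isLinear.Build K U V _ f h).

Definition mkbil (K : fieldType) (U V W : lmodType K) (f : U -> V -> W)
  (hl : forall v, linear (f^~ v)) (hr : forall u, linear (f u)) :
  {bilinear U -> V -> W} :=
  HB.pack f (bilinear_isBilinear.Build K U V W
    (GRing.Scale.Law.clone _ _ *:%R _) (GRing.Scale.Law.clone _ _ *:%R _) f
    (hl, hr)).

Section TensorTheory.
Variable K : fieldType.

Lemma tens_sum (U V : lmodType K) (z : tens U V) :
  z = \sum_(p <- repr z) tpure p.1 p.2.
Proof.
apply: tens_ext => W b; rewrite linear_sum /= /tlift /tsum.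
by apply: eq_bigr => p _; rewrite -[RHS]/(tlift b _) tlift_tpure.
Qed.

Lemma tens_lin_ext (U V W : lmodType K) (f g : {linear tens U V -> W}) :
  (forall u v, f (tpure u v) = g (tpure u v)) -> f =1 g.
Proof.
by move=> h z; rewrite (tens_sum z) !linear_sum; apply: eq_bigr => p _; apply: h.
Qed.

Lemma tmap_subproofl (U V U' V' : lmodType K) (f : {linear U -> U'})
  (g : {linear V -> V'}) v : linear (fun u => tpure (f u) (g v)).
Proof. by move=> a x y; rewrite linearP linearPl. Qed.
Lemma tmap_subproofr (U V U' V' : lmodType K) (f : {linear U -> U'})
  (g : {linear V -> V'}) u : linear (fun v => tpure (f u) (g v)).
Proof. by move=> a x y; rewrite linearP linearPr. Qed.

Definition tmap (U V U' V' : lmodType K) (f : {linear U -> U'})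
    (g : {linear V -> V'}) : {linear tens U V -> tens U' V'} :=
  tlift (mkbil (tmap_subproofl f g) (tmap_subproofr f g)).

Lemma tmapE (U V U' V' : lmodType K) (f : {linear U -> U'})
  (g : {linear V -> V'}) u v : tmap f g (tpure u v) = tpure (f u) (g v).
Proof. exact: tlift_tpure. Qed.

End TensorTheory.

Lemma char2 (V : lmodType 'F_2) (x : V) : x + x = 0.
Proof.
rewrite -[x]scale1r -scalerDl.
have -> : 1 + 1 = 0 :> 'F_2 by apply/val_inj.
by rewrite scale0r.
Qed.

(* A Z-graded module over
     A(1) = F_2<Sq^1, Sq^2> / (Sq^1 Sq^1, Sq^2 Sq^2 + Sq^1 Sq^2 Sq^1),
   where the two relations are the Adem relations between Sq^1 and Sq^2.
   The carrier is the direct sum of the homogeneous parts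
     M^n = {x | gpr n x = x},
   and gpr n is the projection onto M^n. *)
Record gmod := Gmod {
  gcar :> lmodType 'F_2;
  gpr : int -> {linear gcar -> gcar};
  gsq1 : {linear gcar -> gcar};
  gsq2 : {linear gcar -> gcar};
  gpr_pr : forall m n x, gpr m (gpr n x) = if m == n then gpr n x else 0;
  gpr_sum : forall x, exists2 s : seq int, uniq s & x = \sum_(n <- s) gpr n x;
  gsq1_pr : forall n x, gsq1 (gpr n x) = gpr (n + 1) (gsq1 x);
  gsq2_pr : forall n x, gsq2 (gpr n x) = gpr (n + 2) (gsq2 x);
  gsq1_sq1 : forall x, gsq1 (gsq1 x) = 0;
  gsq2_sq2 : forall x, gsq2 (gsq2 x) = gsq1 (gsq2 (gsq1 x))
}.

Definition homog (M : gmod) (n : int) (x : M) : Prop := gpr M n x = x.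

Record ghom (M N : gmod) := Ghom {
  ghom_lin :> {linear M -> N};
  ghom_pr : forall n x, ghom_lin (gpr M n x) = gpr N n (ghom_lin x);
  ghom_sq1 : forall x, ghom_lin (gsq1 M x) = gsq1 N (ghom_lin x);
  ghom_sq2 : forall x, ghom_lin (gsq2 M x) = gsq2 N (ghom_lin x)
}.

Definition gid (M : gmod) : ghom M M :=
  @Ghom M M idfun (fun _ _ => erefl) (fun _ => erefl) (fun _ => erefl).

Section Comp.
Variables (M N P : gmod) (g : ghom N P) (f : ghom M N).
Lemma gcomp_pr n x : (g \o f) (gpr M n x) = gpr P n ((g \o f) x).
Proof. by rewrite /= !ghom_pr. Qed.
Lemma gcomp_sq1 x : (g \o f) (gsq1 M x) = gsq1 P ((g \o f) x).
Proof. by rewrite /= !ghom_sq1. Qed.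
Lemma gcomp_sq2 x : (g \o f) (gsq2 M x) = gsq2 P ((g \o f) x).
Proof. by rewrite /= !ghom_sq2. Qed.
Definition gcomp : ghom M P :=
  @Ghom M P (g \o f) gcomp_pr gcomp_sq1 gcomp_sq2.
End Comp.

Definition giso (M N : gmod) : Prop := exists f : ghom M N, bijective f.

Section Support.
Variable M : gmod.

Definition gsupp (x : M) : seq int :=
  let: exist2 s _ _ := cid2 (gpr_sum x) in s.

Lemma gsupp_uniq x : uniq (gsupp x).
Proof. by rewrite /gsupp; case: cid2. Qed.

Lemma gpr_out (x : M) (s : seq int) n :
  x = \sum_(i <- s) gpr M i x -> n \notin s -> gpr M n x = 0.
Proof.
move=> -> ns; rewrite linear_sum big_seq big1 // => i si.
by rewrite gpr_pr; case: eqP => // ni; rewrite ni si in ns.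
Qed.

Lemma gpr_out_supp (x : M) n : n \notin gsupp x -> gpr M n x = 0.
Proof. by rewrite /gsupp; case: cid2 => s us xs; apply: gpr_out. Qed.

Lemma big_out (W : nmodType) (s t : seq int) (G : int -> W) :
  uniq s -> uniq t -> (forall i, i \notin s -> G i = 0) ->
  (forall i, i \notin t -> G i = 0) ->
  \sum_(i <- s) G i = \sum_(i <- t) G i.
Proof.
have half (s1 t1 : seq int) : (forall i, i \notin t1 -> G i = 0) ->
    \sum_(i <- s1) G i = \sum_(i <- [seq j <- s1 | j \in t1]) G i.
  move=> ht; rewrite big_filter (bigID (mem t1)) /= [X in _ + X]big1 ?addr0 //.
move=> us ut hs ht; rewrite (half s t) // (half t s) //; apply: perm_big.
apply: uniq_perm; rewrite ?filter_uniq // => i; by rewrite !mem_filter andbC.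
Qed.

Lemma gsuppE (W : nmodType) (x : M) (s : seq int) (G : int -> W) :
  uniq s -> (forall i, i \notin s -> G i = 0) ->
  (forall i, gpr M i x = 0 -> G i = 0) ->
  \sum_(i <- gsupp x) G i = \sum_(i <- s) G i.
Proof.
move=> us hs h; apply: big_out => //; first exact: gsupp_uniq.
by move=> i /gpr_out_supp /h.
Qed.

Lemma gpr_sum_supp (x : M) (s : seq int) : uniq s ->
  (forall i, i \notin s -> gpr M i x = 0) -> x = \sum_(i <- s) gpr M i x.
Proof.
move=> us hs; rewrite -(@gsuppE _ x) //.
by rewrite /gsupp; case: cid2.
Qed.

End Support.

Section TensorModule.
Variables M N : gmod.

Definition gtens_pr_fun (n : int) (u : M) (v : N) : tens M N :=
  \sum_(i <- gsupp u) tpure (gpr M i u) (gpr N (n - i) v).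

Lemma gtens_pr_linr n u : linear (gtens_pr_fun n u).
Proof.
move=> a x y; rewrite /gtens_pr_fun scaler_sumr -big_split /=.
by apply: eq_bigr => i _; rewrite linearP linearPr.
Qed.

Lemma gtens_pr_linl n v : linear ((gtens_pr_fun n)^~ v).
Proof.
move=> a x y; rewrite /gtens_pr_fun.
set s := undup (gsupp x ++ gsupp y).
have us : uniq s by exact: undup_uniq.
have sx i : i \notin s -> gpr M i x = 0.
  by rewrite mem_undup mem_cat negb_or => /andP[/gpr_out_supp].
have sy i : i \notin s -> gpr M i y = 0.
  by rewrite mem_undup mem_cat negb_or => /andP[_ /gpr_out_supp].
rewrite !(@gsuppE M _ _ s) //.
- rewrite scaler_sumr -big_split /=.
  by apply: eq_bigr => i _; rewrite linearP linearPl.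
- by move=> i /sy ->; rewrite linear0l.
- by move=> i ->; rewrite linear0l.
- by move=> i /sx ->; rewrite linear0l.
- by move=> i ->; rewrite linear0l.
- by move=> i si; rewrite linearP sx // sy // scaler0 addr0 linear0l.
- by move=> i ->; rewrite linear0l.
Qed.

Definition gtens_pr (n : int) : {linear tens M N -> tens M N} :=
  tlift (mkbil (gtens_pr_linl n) (gtens_pr_linr n)).

Lemma gtens_prE n i j u v :
  gtens_pr n (tpure (gpr M i u) (gpr N j v)) =
    if n == i + j then tpure (gpr M i u) (gpr N j v) else 0.
Proof.
rewrite [LHS]tlift_tpure /= /gtens_pr_fun (@gsuppE M _ _ [:: i]) //.
- rewrite big_seq1 !gpr_pr eqxx.
  by rewrite [n - i == j]subr_eq [j + i]addrC; case: eqP; rewrite ?linear0r.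
- by move=> k; rewrite inE gpr_pr => /negbTE ->; rewrite linear0l.
- by move=> k ->; rewrite linear0l.
Qed.

Lemma gtens_homog_ext (W : lmodType 'F_2) (f g : {linear tens M N -> W}) :
  (forall i j u v, f (tpure (gpr M i u) (gpr N j v)) =
                   g (tpure (gpr M i u) (gpr N j v))) -> f =1 g.
Proof.
move=> h; apply: tens_lin_ext => u v.
have [s _ ->] := gpr_sum u; have [t _ ->] := gpr_sum v.
rewrite linear_sumlz !linear_sum; apply: eq_bigr => i _.
rewrite linear_sumr !linear_sum; apply: eq_bigr => j _.
exact: h.
Qed.

(* The diagonal action: Sq^1 and Sq^2 act through the coproduct
     Sq^1 |-> Sq^1 (x) 1 + 1 (x) Sq^1,
     Sq^2 |-> Sq^2 (x) 1 + Sq^1 (x) Sq^1 + 1 (x) Sq^2. *)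
Definition gtens_sq1 : {linear tens M N -> tens M N} :=
  tmap (gsq1 M) idfun \+ tmap idfun (gsq1 N).
Definition gtens_sq2 : {linear tens M N -> tens M N} :=
  (tmap (gsq2 M) idfun \+ tmap (gsq1 M) (gsq1 N)) \+ tmap idfun (gsq2 N).

Lemma gtens_sq1E u v :
  gtens_sq1 (tpure u v) = tpure (gsq1 M u) v + tpure u (gsq1 N v).
Proof. by congr (_ + _); apply: tmapE. Qed.
Lemma gtens_sq2E u v : gtens_sq2 (tpure u v) =
  tpure (gsq2 M u) v + tpure (gsq1 M u) (gsq1 N v) + tpure u (gsq2 N v).
Proof. by congr (_ + _ + _); apply: tmapE. Qed.

Lemma gtens_pr_pr m n x :
  gtens_pr m (gtens_pr n x) = if m == n then gtens_pr n x else 0.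
Proof.
pose g : {linear tens M N -> tens M N} := (m == n)%:R \*: gtens_pr n.
have -> : (if m == n then gtens_pr n x else 0) = g x.
  by rewrite /g /=; case: eqP; rewrite ?scale1r ?scale0r.
apply: (gtens_homog_ext (f := gtens_pr m \o gtens_pr n)) => i j u v.
rewrite /= gtens_prE; case: (eqVneq n (i + j)) => [->|ne].
  by rewrite gtens_prE; case: eqP; rewrite ?scale1r ?scale0r.
by rewrite linear0 scaler0.
Qed.

Lemma gtens_pr_sum x :
  exists2 s : seq int, uniq s & x = \sum_(n <- s) gtens_pr n x.
Proof.
pose P (y : tens M N) := exists2 s : seq int, uniq s &
  forall t, uniq t -> {subset s <= t} -> y = \sum_(n <- t) gtens_pr n y.
suff [s us hs] : P x by exists s => //; apply: hs.
have add y z : P y -> P z -> P (y + z).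
  move=> [s us hs] [r ur hr]; exists (undup (s ++ r)); first exact: undup_uniq.
  move=> t ut st; under eq_bigr do rewrite linearD.
  rewrite big_split /= -hs -?hr // => i ii; apply: st;
    by rewrite mem_undup mem_cat ii ?orbT.
have zero : P 0.
  by exists [::] => // t _ _; rewrite big1 // => i _; rewrite linear0.
rewrite (tens_sum x); apply: big_ind => // -[u v] _ /=.
have [s _ ->] := gpr_sum u; have [r _ ->] := gpr_sum v.
rewrite linear_sumlz; apply: big_ind => // i _.
rewrite linear_sumr; apply: big_ind => // j _.
exists [:: i + j] => // t ut st.
rewrite (bigD1_seq (i + j)) ?st ?inE //= gtens_prE eqxx big1 ?addr0 // => n ne.
by rewrite gtens_prE (negbTE ne).
Qed.

Lemma gtens_sq1_pr n x : gtens_sq1 (gtens_pr n x) = gtens_pr (n + 1) (gtens_sq1 x).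
Proof.
apply: (gtens_homog_ext (f := gtens_sq1 \o gtens_pr n)
                        (g := gtens_pr (n + 1) \o gtens_sq1)) => i j u v.
rewrite -[LHS]/(gtens_sq1 (gtens_pr n _)).
rewrite -[RHS]/(gtens_pr _ (gtens_sq1 _)) gtens_sq1E linearD gtens_prE !gsq1_pr !gtens_prE.
have e1 : (n + 1 == i + j + 1) = (n == i + j) by exact: (inj_eq (addIr _)).
rewrite [i + 1 + j]addrAC [i + (j + 1)]addrA e1.
by case: eqP => _; rewrite ?linear0 ?addr0 // gtens_sq1E !gsq1_pr.
Qed.

Lemma gtens_sq2_pr n x : gtens_sq2 (gtens_pr n x) = gtens_pr (n + 2) (gtens_sq2 x).
Proof.
apply: (gtens_homog_ext (f := gtens_sq2 \o gtens_pr n)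
                        (g := gtens_pr (n + 2) \o gtens_sq2)) => i j u v.
rewrite -[LHS]/(gtens_sq2 (gtens_pr n _)).
rewrite -[RHS]/(gtens_pr _ (gtens_sq2 _)) gtens_sq2E !linearD gtens_prE !gsq1_pr !gsq2_pr.
rewrite !gtens_prE.
have -> : i + 1 + (j + 1) = i + j + 2 by rewrite addrACA.
have e2 : (n + 2 == i + j + 2) = (n == i + j) by exact: (inj_eq (addIr _)).
rewrite [i + 2 + j]addrAC [i + (j + 2)]addrA e2.
by case: eqP => _; rewrite ?linear0 ?addr0 // gtens_sq2E !gsq1_pr !gsq2_pr.
Qed.


Lemma gtens_sq1_sq1 x : gtens_sq1 (gtens_sq1 x) = 0.
Proof.
apply: (tens_lin_ext (f := gtens_sq1 \o gtens_sq1) (g := \0)) => u v.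
rewrite -[LHS]/(gtens_sq1 (gtens_sq1 _)) gtens_sq1E linearD !gtens_sq1E !gsq1_sq1.
by rewrite linear0l linear0r add0r addr0 char2.
Qed.

Lemma gtens_sq2_sq2 x :
  gtens_sq2 (gtens_sq2 x) = gtens_sq1 (gtens_sq2 (gtens_sq1 x)).
Proof.
apply: (tens_lin_ext (f := gtens_sq2 \o gtens_sq2)
         (g := gtens_sq1 \o (gtens_sq2 \o gtens_sq1))) => u v.
rewrite -[LHS]/(gtens_sq2 (gtens_sq2 _)).
rewrite -[RHS]/(gtens_sq1 (gtens_sq2 (gtens_sq1 _))).
have D1 y z : gtens_sq1 (y + z) = gtens_sq1 y + gtens_sq1 z by exact: linearD.
have D2 y z : gtens_sq2 (y + z) = gtens_sq2 y + gtens_sq2 z by exact: linearD.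
rewrite gtens_sq1E gtens_sq2E !D2 !gtens_sq2E !D1 !gtens_sq1E.
rewrite !gsq1_sq1 !gsq2_sq2 !(linear0, linear0l, linear0r) !(add0r, addr0).
rewrite [LHS](AC (3*2*3) ((3*6)*(1*4*7*(2*(5*8))))) /=.
by rewrite char2 add0r.
Qed.

Definition gtens : gmod :=
  @Gmod (tens M N) gtens_pr gtens_sq1 gtens_sq2 gtens_pr_pr gtens_pr_sum
    gtens_sq1_pr gtens_sq2_pr gtens_sq1_sq1 gtens_sq2_sq2.
End TensorModule.

Section TensorHom.
Variables (M N M' N' : gmod) (f : ghom M M') (g : ghom N N').

Lemma gtens_hom_pr n x : tmap f g (gtens_pr M N n x) = gtens_pr M' N' n (tmap f g x).
Proof.
apply: (gtens_homog_ext (f := tmap f g \o gtens_pr M N n)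
                        (g := gtens_pr M' N' n \o tmap f g)) => i j u v.
rewrite -[LHS]/(tmap f g (gtens_pr M N n _)).
rewrite -[RHS]/(gtens_pr M' N' n (tmap f g _)) gtens_prE tmapE !ghom_pr gtens_prE.
by case: eqP => _; rewrite ?linear0 // tmapE !ghom_pr.
Qed.

Lemma gtens_hom_sq1 x : tmap f g (gtens_sq1 M N x) = gtens_sq1 M' N' (tmap f g x).
Proof.
apply: (tens_lin_ext (f := tmap f g \o gtens_sq1 M N)
                     (g := gtens_sq1 M' N' \o tmap f g)) => u v.
rewrite -[LHS]/(tmap f g (gtens_sq1 M N _)).
rewrite -[RHS]/(gtens_sq1 M' N' (tmap f g _)) gtens_sq1E tmapE linearD !tmapE.
by rewrite gtens_sq1E !ghom_sq1.
Qed.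

Lemma gtens_hom_sq2 x : tmap f g (gtens_sq2 M N x) = gtens_sq2 M' N' (tmap f g x).
Proof.
apply: (tens_lin_ext (f := tmap f g \o gtens_sq2 M N)
                     (g := gtens_sq2 M' N' \o tmap f g)) => u v.
rewrite -[LHS]/(tmap f g (gtens_sq2 M N _)).
rewrite -[RHS]/(gtens_sq2 M' N' (tmap f g _)) gtens_sq2E tmapE !linearD !tmapE.
by rewrite gtens_sq2E !ghom_sq1 !ghom_sq2.
Qed.

Definition gtens_hom : ghom (gtens M N) (gtens M' N') :=
  @Ghom (gtens M N) (gtens M' N') (tmap f g)
    gtens_hom_pr gtens_hom_sq1 gtens_hom_sq2.
End TensorHom.

Section Ground.
Let V := ('F_2)^o.
Definition gF_pr (n : int) : {linear V -> V} := *:%R ((n == 0)%:R : 'F_2).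

Lemma gF_pr_pr m n x : gF_pr m (gF_pr n x) = if m == n then gF_pr n x else 0.
Proof.
rewrite /= scalerA -natrM mulnb; case: (eqVneq m n) => [->|mn].
  by rewrite andbb.
case: eqP => //= m0; last by rewrite scale0r.
by case: eqP => //= n0; [rewrite m0 n0 eqxx in mn | rewrite scale0r].
Qed.

Lemma gF_pr_sum x : exists2 s : seq int, uniq s & x = \sum_(n <- s) gF_pr n x.
Proof. by exists [:: 0] => //; rewrite big_seq1 /= scale1r. Qed.

Definition gF : gmod :=
  @Gmod V gF_pr \0 \0 gF_pr_pr gF_pr_sum
    (fun n x => esym (linear0 (gF_pr (n + 1))))
    (fun n x => esym (linear0 (gF_pr (n + 2)))) (fun=> erefl) (fun=> erefl).
End Ground.

Section Shift.
Variables (d : int) (M : gmod).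

Lemma gshift_pr_pr m n (x : M) :
  gpr M (m - d) (gpr M (n - d) x) = if m == n then gpr M (n - d) x else 0.
Proof. by rewrite gpr_pr (inj_eq (addIr _)). Qed.

Lemma gshift_pr_sum (x : M) :
  exists2 s : seq int, uniq s & x = \sum_(n <- s) gpr M (n - d) x.
Proof.
have [s us xs] := gpr_sum x; exists [seq n + d | n <- s].
  by rewrite map_inj_uniq //; apply: addIr.
by rewrite big_map [LHS]xs; apply: eq_bigr => n _; rewrite addrK.
Qed.

Lemma gshift_sq1_pr n (x : M) :
  gsq1 M (gpr M (n - d) x) = gpr M (n + 1 - d) (gsq1 M x).
Proof. by rewrite gsq1_pr addrAC. Qed.
Lemma gshift_sq2_pr n (x : M) :
  gsq2 M (gpr M (n - d) x) = gpr M (n + 2 - d) (gsq2 M x).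
Proof. by rewrite gsq2_pr addrAC. Qed.

(* Sigma^d M, with (Sigma^d M)^n = M^(n - d). *)
Definition gshift : gmod :=
  @Gmod M (fun n => gpr M (n - d)) (gsq1 M) (gsq2 M) gshift_pr_pr gshift_pr_sum
    gshift_sq1_pr gshift_sq2_pr (@gsq1_sq1 M) (@gsq2_sq2 M).
End Shift.

Section DirectSum.
Variables M N : gmod.
Let V : lmodType 'F_2 := (M * N)%type.

Lemma pair_linear (f : {linear M -> M}) (g : {linear N -> N}) :
  linear (fun p : V => (f p.1, g p.2) : V).
Proof. by move=> a x y; congr pair; rewrite /= linearP. Qed.
Let plin f g : {linear V -> V} := mklin (pair_linear f g).

Lemma gsum_pr_pr m n (x : V) :
  plin (gpr M m) (gpr N m) (plin (gpr M n) (gpr N n) x) =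
    if m == n then plin (gpr M n) (gpr N n) x else 0.
Proof. by rewrite /= !gpr_pr; case: eqP. Qed.

Lemma gsum_pr_sum (x : V) : exists2 s : seq int,
  uniq s & x = \sum_(n <- s) plin (gpr M n) (gpr N n) x.
Proof.
set s := undup (gsupp x.1 ++ gsupp x.2).
have us : uniq s by exact: undup_uniq.
exists s => //.
have e1 : x.1 = \sum_(n <- s) gpr M n x.1.
  apply: gpr_sum_supp => // i.
  by rewrite mem_undup mem_cat negb_or => /andP[/gpr_out_supp].
have e2 : x.2 = \sum_(n <- s) gpr N n x.2.
  apply: gpr_sum_supp => // i.
  by rewrite mem_undup mem_cat negb_or => /andP[_ /gpr_out_supp].
rewrite [LHS]surjective_pairing {1}e1 {1}e2.
elim: (s) => [|i t IH]; first by rewrite !big_nil.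
by rewrite !big_cons -IH.
Qed.

Lemma gsum_sq1_pr n (x : V) :
  plin (gsq1 M) (gsq1 N) (plin (gpr M n) (gpr N n) x) =
  plin (gpr M (n + 1)) (gpr N (n + 1)) (plin (gsq1 M) (gsq1 N) x).
Proof. by rewrite /= !gsq1_pr. Qed.
Lemma gsum_sq2_pr n (x : V) :
  plin (gsq2 M) (gsq2 N) (plin (gpr M n) (gpr N n) x) =
  plin (gpr M (n + 2)) (gpr N (n + 2)) (plin (gsq2 M) (gsq2 N) x).
Proof. by rewrite /= !gsq2_pr. Qed.
Lemma gsum_sq1_sq1 (x : V) :
  plin (gsq1 M) (gsq1 N) (plin (gsq1 M) (gsq1 N) x) = 0.
Proof. by rewrite /= !gsq1_sq1. Qed.
Lemma gsum_sq2_sq2 (x : V) :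
  plin (gsq2 M) (gsq2 N) (plin (gsq2 M) (gsq2 N) x) =
  plin (gsq1 M) (gsq1 N) (plin (gsq2 M) (gsq2 N) (plin (gsq1 M) (gsq1 N) x)).
Proof. by rewrite /= !gsq2_sq2. Qed.

Definition gsum : gmod :=
  @Gmod V (fun n => plin (gpr M n) (gpr N n)) (plin (gsq1 M) (gsq1 N))
    (plin (gsq2 M) (gsq2 N)) gsum_pr_pr gsum_pr_sum gsum_sq1_pr gsum_sq2_pr
    gsum_sq1_sq1 gsum_sq2_sq2.
End DirectSum.

Record gsub (M : gmod) := Gsub {
  gsub_pred :> {pred M};
  gsub_submod : submod_closed gsub_pred;
  gsub_pr : forall n x, x \in gsub_pred -> gpr M n x \in gsub_pred;
  gsub_sq1 : forall x, x \in gsub_pred -> gsq1 M x \in gsub_pred;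
  gsub_sq2 : forall x, x \in gsub_pred -> gsq2 M x \in gsub_pred
}.

HB.instance Definition _ (M : gmod) (P : gsub M) :=
  GRing.isSubmodClosed.Build 'F_2 M (gsub_pred P) (gsub_submod P).

Section Submodule.
Variables (M : gmod) (P : gsub M).

Record gsub_car := GsubCar { gsub_val : M; gsub_valP : gsub_val \in gsub_pred P }.
HB.instance Definition _ := [isSub for gsub_val].
HB.instance Definition _ := [Choice of gsub_car by <:].
HB.instance Definition _ := [SubChoice_isSubLmodule of gsub_car by <:].

Section Restrict.
Variable f : {linear M -> M}.
Hypothesis fP : forall x, x \in gsub_pred P -> f x \in gsub_pred P.
Definition gsub_res_fun (x : gsub_car) : gsub_car := GsubCar (fP (gsub_valP x)).
Lemma gsub_res_linear : linear gsub_res_fun.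
Proof. by move=> a x y; apply: val_inj; rewrite /= linearP. Qed.
Definition gsub_res : {linear gsub_car -> gsub_car} := mklin gsub_res_linear.
End Restrict.

Let pr n := gsub_res (@gsub_pr M P n).
Let sq1 := gsub_res (@gsub_sq1 M P).
Let sq2 := gsub_res (@gsub_sq2 M P).

Lemma gsubmod_pr_pr m n x : pr m (pr n x) = if m == n then pr n x else 0.
Proof. by apply: val_inj; rewrite /= gpr_pr; case: eqP. Qed.
Lemma gsubmod_pr_sum x : exists2 s : seq int, uniq s & x = \sum_(n <- s) pr n x.
Proof.
have [s us xs] := gpr_sum (val x); exists s => //.
by apply: val_inj; rewrite [LHS]xs raddf_sum.
Qed.
Lemma gsubmod_sq1_pr n x : sq1 (pr n x) = pr (n + 1) (sq1 x).
Proof. by apply: val_inj; rewrite /= gsq1_pr. Qed.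
Lemma gsubmod_sq2_pr n x : sq2 (pr n x) = pr (n + 2) (sq2 x).
Proof. by apply: val_inj; rewrite /= gsq2_pr. Qed.
Lemma gsubmod_sq1_sq1 x : sq1 (sq1 x) = 0.
Proof. by apply: val_inj; rewrite /= gsq1_sq1. Qed.
Lemma gsubmod_sq2_sq2 x : sq2 (sq2 x) = sq1 (sq2 (sq1 x)).
Proof. by apply: val_inj; rewrite /= gsq2_sq2. Qed.

Definition gsubmod : gmod :=
  @Gmod gsub_car pr sq1 sq2 gsubmod_pr_pr gsubmod_pr_sum gsubmod_sq1_pr
    gsubmod_sq2_pr gsubmod_sq1_sq1 gsubmod_sq2_sq2.
End Submodule.

Section QuotientModule.
Variables (M : gmod) (P : gsub M).

Definition gquot_car := Quotient.quot (gsub_pred P : zmodClosed M).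
HB.instance Definition _ := GRing.Zmodule.on gquot_car.

Definition gquot_pi (x : M) : gquot_car := \pi_gquot_car x.

Lemma gquot_piP x y : reflect (gquot_pi x = gquot_pi y) (x - y \in gsub_pred P).
Proof. by rewrite /gquot_pi Quotient.idealrBE; apply: eqP. Qed.

Lemma gquot_piD x y : gquot_pi (x + y) = gquot_pi x + gquot_pi y.
Proof. exact: raddfD. Qed.

Lemma gquot_reprK q : gquot_pi (repr q) = q.
Proof. exact: reprK. Qed.

Definition gquot_scale (a : 'F_2) (q : gquot_car) : gquot_car :=
  gquot_pi (a *: repr q).

Lemma gquot_piZ a x : gquot_scale a (gquot_pi x) = gquot_pi (a *: x).
Proof.
apply/gquot_piP; rewrite -scalerBr rpredZ //; apply/gquot_piP.
exact: gquot_reprK.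
Qed.

Lemma gquot_scaleA a b q :
  gquot_scale a (gquot_scale b q) = gquot_scale (a * b) q.
Proof. by rewrite -[q]gquot_reprK !gquot_piZ scalerA. Qed.
Lemma gquot_scale1 : left_id 1 gquot_scale.
Proof. by move=> q; rewrite -[q]gquot_reprK gquot_piZ scale1r. Qed.
Lemma gquot_scaleDr : right_distributive gquot_scale +%R.
Proof.
move=> a p q; rewrite -[p]gquot_reprK -[q]gquot_reprK.
by rewrite -gquot_piD !gquot_piZ scalerDr gquot_piD.
Qed.
Lemma gquot_scaleDl q : {morph gquot_scale^~ q : a b / a + b}.
Proof.
by move=> a b; rewrite -[q]gquot_reprK !gquot_piZ scalerDl gquot_piD.
Qed.
HB.instance Definition _ := GRing.Zmodule_isLmodule.Build 'F_2 gquot_car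
  gquot_scaleA gquot_scale1 gquot_scaleDr gquot_scaleDl.

Lemma gquot_pi_linear : linear gquot_pi.
Proof. by move=> a x y; rewrite gquot_piD -gquot_piZ. Qed.

Section Induced.
Variable f : {linear M -> M}.
Hypothesis fP : forall x, x \in gsub_pred P -> f x \in gsub_pred P.
Definition gquot_ind_fun (q : gquot_car) : gquot_car := gquot_pi (f (repr q)).
Lemma gquot_ind_pi x : gquot_ind_fun (gquot_pi x) = gquot_pi (f x).
Proof.
by apply/gquot_piP; rewrite -linearB fP //; apply/gquot_piP/gquot_reprK.
Qed.
Lemma gquot_ind_linear : linear gquot_ind_fun.
Proof.
move=> a p q; rewrite -[p]gquot_reprK -[q]gquot_reprK -gquot_pi_linear.
by rewrite !gquot_ind_pi linearP gquot_pi_linear.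
Qed.
Definition gquot_ind : {linear gquot_car -> gquot_car} :=
  mklin gquot_ind_linear.
End Induced.

Let pr n := gquot_ind (@gsub_pr M P n).
Let sq1 := gquot_ind (@gsub_sq1 M P).
Let sq2 := gquot_ind (@gsub_sq2 M P).
Let prE n x : pr n (gquot_pi x) = gquot_pi (gpr M n x).
Proof. exact/gquot_ind_pi/gsub_pr. Qed.
Let sq1E x : sq1 (gquot_pi x) = gquot_pi (gsq1 M x).
Proof. exact/gquot_ind_pi/gsub_sq1. Qed.
Let sq2E x : sq2 (gquot_pi x) = gquot_pi (gsq2 M x).
Proof. exact/gquot_ind_pi/gsub_sq2. Qed.

Lemma gquot_pr_pr m n q : pr m (pr n q) = if m == n then pr n q else 0.
Proof.
rewrite -[q]gquot_reprK !prE gpr_pr; case: eqP => // _.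
exact: (raddf0 (mklin gquot_pi_linear)).
Qed.
Lemma gquot_pr_sum q : exists2 s : seq int, uniq s & q = \sum_(n <- s) pr n q.
Proof.
rewrite -[q]gquot_reprK; have [s us xs] := gpr_sum (repr q); exists s => //.
rewrite [in LHS]xs -[LHS]/(mklin gquot_pi_linear _) linear_sum.
by apply: eq_bigr => n _; rewrite prE.
Qed.
Lemma gquot_sq1_pr n q : sq1 (pr n q) = pr (n + 1) (sq1 q).
Proof. by rewrite -[q]gquot_reprK !(prE, sq1E) gsq1_pr. Qed.
Lemma gquot_sq2_pr n q : sq2 (pr n q) = pr (n + 2) (sq2 q).
Proof. by rewrite -[q]gquot_reprK !(prE, sq2E) gsq2_pr. Qed.
Lemma gquot_sq1_sq1 q : sq1 (sq1 q) = 0.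
Proof.
rewrite -[q]gquot_reprK !sq1E gsq1_sq1.
exact: (raddf0 (mklin gquot_pi_linear)).
Qed.
Lemma gquot_sq2_sq2 q : sq2 (sq2 q) = sq1 (sq2 (sq1 q)).
Proof. by rewrite -[q]gquot_reprK !(sq1E, sq2E) gsq2_sq2. Qed.

Definition gquot : gmod :=
  @Gmod gquot_car pr sq1 sq2 gquot_pr_pr gquot_pr_sum gquot_sq1_pr
    gquot_sq2_pr gquot_sq1_sq1 gquot_sq2_sq2.
End QuotientModule.

Section Kernel.
Variables (M N : gmod) (f : ghom M N).

Let K : {pred M} := [pred x | f x == 0].
Lemma gker_submod : submod_closed K.
Proof.
split=> [|a x y]; rewrite !inE ?linear0 // => /eqP fx /eqP fy.
by rewrite linearP fx fy scaler0 addr0.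
Qed.
Lemma gker_pr n x : x \in K -> gpr M n x \in K.
Proof. by rewrite !inE ghom_pr => /eqP ->; rewrite linear0. Qed.
Lemma gker_sq1 x : x \in K -> gsq1 M x \in K.
Proof. by rewrite !inE ghom_sq1 => /eqP ->; rewrite linear0. Qed.
Lemma gker_sq2 x : x \in K -> gsq2 M x \in K.
Proof. by rewrite !inE ghom_sq2 => /eqP ->; rewrite linear0. Qed.

Definition gker : gmod := gsubmod (Gsub gker_submod gker_pr gker_sq1 gker_sq2).
End Kernel.

Section Span.
Variables (M : gmod) (x : M).

Let S : {pred M} := [pred y |
  `[< forall P : gsub M, x \in gsub_pred P -> y \in gsub_pred P >]].
Lemma gspan_submod : submod_closed S.
Proof.
split=> [|a y z]; rewrite !inE; first by apply/asboolP=> P _; apply: rpred0.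
move=> /asboolP hy /asboolP hz; apply/asboolP=> P xP.
by rewrite rpredD ?rpredZ ?hy ?hz.
Qed.
Lemma gspan_pr n y : y \in S -> gpr M n y \in S.
Proof.
by rewrite !inE => /asboolP hy; apply/asboolP=> P xP; apply/gsub_pr/hy.
Qed.
Lemma gspan_sq1 y : y \in S -> gsq1 M y \in S.
Proof.
by rewrite !inE => /asboolP hy; apply/asboolP=> P xP; apply/gsub_sq1/hy.
Qed.
Lemma gspan_sq2 y : y \in S -> gsq2 M y \in S.
Proof.
by rewrite !inE => /asboolP hy; apply/asboolP=> P xP; apply/gsub_sq2/hy.
Qed.

(* The graded submodule A(1)x generated by x. *)
Definition gspan : gsub M := Gsub gspan_submod gspan_pr gspan_sq1 gspan_sq2.
End Span.

Section A1.
Let V := 'rV['F_2]_8.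

(* Basis of A(1), by index:
     0: 1,           1: Sq^1,            2: Sq^2,            3: Sq^1 Sq^2,
     4: Sq^2 Sq^1,   5: Sq^1 Sq^2 Sq^1,  6: Sq^2 Sq^1 Sq^2,
     7: Sq^1 Sq^2 Sq^1 Sq^2 = Sq^2 Sq^1 Sq^2 Sq^1.
   A1_sq1 and A1_sq2 give left multiplication on basis elements; the
   out-of-range value 8 stands for 0. *)
Definition A1_deg (i : 'I_8) : int := (nth 0%N [:: 0; 1; 2; 3; 3; 4; 5; 6] i)%N.
Definition A1_sq1 : seq nat := [:: 1; 8; 3; 8; 5; 8; 7; 8]%N.
Definition A1_sq2 : seq nat := [:: 2; 4; 5; 6; 8; 7; 8; 8]%N.

Definition A1_op (t : seq nat) : {linear V -> V} :=
  mulmxr (\matrix_(i < 8, j < 8) (nth 8 t i == j)%:R).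
Definition A1_pr (n : int) : {linear V -> V} :=
  mulmxr (diag_mx (\row_i (A1_deg i == n)%:R)).

Lemma A1_prE n x j : A1_pr n x 0 j = (A1_deg j == n)%:R * x 0 j.
Proof. by rewrite /= mul_mx_diag !mxE mulrC. Qed.

Lemma A1_pr_pr m n x : A1_pr m (A1_pr n x) = if m == n then A1_pr n x else 0.
Proof.
apply/rowP=> j; rewrite A1_prE A1_prE.
case: (eqVneq m n) => [->|mn]; rewrite ?A1_prE ?mxE mulrA -natrM mulnb.
  by rewrite andbb.
case: (eqVneq _ m) => [e|]; last by rewrite mul0r.
by rewrite e (negbTE mn) mul0r.
Qed.

Lemma A1_pr_sum x : exists2 s : seq int, uniq s & x = \sum_(n <- s) A1_pr n x.
Proof.
exists [seq Posz n | n <- iota 0 7] => //.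
apply/rowP=> j; rewrite summxE; under eq_bigr do rewrite A1_prE.
rewrite -mulr_suml -[LHS]mul1r; congr (_ * _).
rewrite big_map; case: j; do 8?[case=> [?|]; first by rewrite !big_cons big_nil; apply/val_inj].
by [].
Qed.

Lemma A1_op_pr (t : seq nat) (d : nat) n x :
  (forall i j : 'I_8, nth 8 t i == j -> A1_deg j = A1_deg i + d%:Z) ->
  A1_op t (A1_pr n x) = A1_pr (n + d%:Z) (A1_op t x).
Proof.
move=> h; apply/rowP=> j; rewrite A1_prE !mxE mulr_sumr.
apply: eq_bigr => i _; rewrite A1_prE !mxE; case: (boolP (nth 8 t i == j)) => [e|_].
  by rewrite (h i j e) (inj_eq (addIr _)) mulrA.
by rewrite !mulr0.
Qed.

Lemma A1_sq1_pr n x : A1_op A1_sq1 (A1_pr n x) = A1_pr (n + 1) (A1_op A1_sq1 x).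
Proof.
apply: (@A1_op_pr _ 1) => i j /eqP; case: i j.
by do 8?[case=> [?|]; first by case; do 8?[case=> [?|//]]].
Qed.
Lemma A1_sq2_pr n x : A1_op A1_sq2 (A1_pr n x) = A1_pr (n + 2) (A1_op A1_sq2 x).
Proof.
apply: (@A1_op_pr _ 2) => i j /eqP; case: i j.
by do 8?[case=> [?|]; first by case; do 8?[case=> [?|//]]].
Qed.

Lemma A1_op_comp (s t : seq nat) x : size s = 8%N -> size t = 8%N ->
  A1_op t (A1_op s x) = A1_op [seq nth 8 t i | i <- s] x.
Proof.
move=> s8 t8; rewrite /= -mulmxA; congr (_ *m _); apply/matrixP=> i j.
rewrite !mxE; under eq_bigr do rewrite !mxE -natrM mulnb.
rewrite (nth_map 8%N) ?s8 //; case: (ltnP (nth 8 s i) 8) => [lt8|ge8].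
  rewrite (bigD1 (Ordinal lt8)) //= eqxx big1 ?addr0 // => k.
  by rewrite -val_eqE /= eq_sym => /negbTE ->.
rewrite [nth 8 t _]nth_default ?t8 // big1 => [|k _].
  by rewrite gtn_eqF.
by rewrite gtn_eqF // (leq_trans (ltn_ord k)).
Qed.

Lemma A1_sq1_sq1 x : A1_op A1_sq1 (A1_op A1_sq1 x) = 0.
Proof.
rewrite A1_op_comp //; apply/rowP=> j; rewrite !mxE big1 // => i _.
rewrite mxE (_ : map _ _ = nseq 8 8%N) // nth_nseq if_same.
by rewrite gtn_eqF // mulr0.
Qed.

Lemma A1_sq2_sq2 x : A1_op A1_sq2 (A1_op A1_sq2 x) =
  A1_op A1_sq1 (A1_op A1_sq2 (A1_op A1_sq1 x)).
Proof. by rewrite !A1_op_comp. Qed.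

Definition A1 : gmod :=
  @Gmod V A1_pr (A1_op A1_sq1) (A1_op A1_sq2) A1_pr_pr A1_pr_sum
    A1_sq1_pr A1_sq2_pr A1_sq1_sq1 A1_sq2_sq2.
End A1.

Definition A1_one : A1 := delta_mx 0 0.

Section Augmentation.
Lemma A1_aug_linear : linear (fun x : A1 => (x : 'rV_8) 0 0 : gF).
Proof. by move=> a x y; rewrite !mxE. Qed.
Let aug : {linear A1 -> gF} := mklin A1_aug_linear.

Lemma A1_aug_pr n x : aug (gpr A1 n x) = gpr gF n (aug x).
Proof. by rewrite -[LHS]/(A1_pr n x 0 0) A1_prE [0 == n]eq_sym. Qed.
Lemma A1_aug_sq1 x : aug (gsq1 A1 x) = gsq1 gF (aug x).
Proof.
rewrite /= mxE big1 // => i _; rewrite mxE.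
by case: i; do 8?[case=> [?|]; first by rewrite mulr0].
Qed.
Lemma A1_aug_sq2 x : aug (gsq2 A1 x) = gsq2 gF (aug x).
Proof.
rewrite /= mxE big1 // => i _; rewrite mxE.
by case: i; do 8?[case=> [?|]; first by rewrite mulr0].
Qed.

Definition A1_aug : ghom A1 gF := Ghom A1_aug_pr A1_aug_sq1 A1_aug_sq2.
End Augmentation.

(* Omega F: the augmentation ideal of A(1). *)
Definition OmegaF : gmod := gker A1_aug.

(* The Joker Sigma^{-2} (A(1) / A(1) Sq^1 Sq^2). *)
Definition Joker : gmod :=
  gshift (- 2) (gquot (gspan (gsq1 A1 (gsq2 A1 A1_one)))).

Fixpoint gtpow (M : gmod) (n : nat) : gmod :=
  if n is n'.+1 then gtens M (gtpow M n') else gF.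

Section Unit.
Variable M : gmod.

Lemma gunit_linl (v : M) : linear (fun a : gF => (a : 'F_2) *: v).
Proof. by move=> a x y; rewrite scalerDl scalerA. Qed.
Lemma gunit_linr (a : gF) : linear (fun v : M => (a : 'F_2) *: v).
Proof. by move=> b x y; rewrite scalerDr !scalerA mulrC. Qed.
Let unit_lin : {linear tens gF M -> M} := tlift (mkbil gunit_linl gunit_linr).
Let unitE (a : gF) (v : M) : unit_lin (tpure a v) = (a : 'F_2) *: v.
Proof. exact: tlift_tpure. Qed.

Lemma gunit_pr n x : unit_lin (gtens_pr gF M n x) = gpr M n (unit_lin x).
Proof.
apply: (gtens_homog_ext (f := unit_lin \o gtens_pr gF M n)
                        (g := gpr M n \o unit_lin)) => i j a v.
rewrite -[LHS]/(unit_lin (gtens_pr gF M n _)).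
rewrite -[RHS]/(gpr M n (unit_lin _)) gtens_prE unitE linearZ /= gpr_pr.
case: (eqVneq i 0) => [->|_]; last first.
  by rewrite scale0r linear0l if_same linear0 scale0r.
by rewrite add0r scale1r; case: eqP => _; rewrite ?linear0 ?scaler0 ?unitE.
Qed.

Lemma gunit_sq1 x : unit_lin (gtens_sq1 gF M x) = gsq1 M (unit_lin x).
Proof.
apply: (tens_lin_ext (f := unit_lin \o gtens_sq1 gF M)
                     (g := gsq1 M \o unit_lin)) => a v.
rewrite -[LHS]/(unit_lin (gtens_sq1 gF M _)).
rewrite -[RHS]/(gsq1 M (unit_lin _)) gtens_sq1E linearD !unitE linearZ.
by rewrite /= scale0r add0r.
Qed.

Lemma gunit_sq2 x : unit_lin (gtens_sq2 gF M x) = gsq2 M (unit_lin x).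
Proof.
apply: (tens_lin_ext (f := unit_lin \o gtens_sq2 gF M)
                     (g := gsq2 M \o unit_lin)) => a v.
rewrite -[LHS]/(unit_lin (gtens_sq2 gF M _)).
rewrite -[RHS]/(gsq2 M (unit_lin _)) gtens_sq2E !linearD !unitE linearZ.
by rewrite /= !scale0r !add0r.
Qed.

Definition gunit : ghom (gtens gF M) M :=
  @Ghom (gtens gF M) M unit_lin gunit_pr gunit_sq1 gunit_sq2.
End Unit.

Definition gfree (M : gmod) : Prop :=
  exists (I : Type) (d : I -> int) (b : I -> M),
    (forall i, homog (d i) (b i)) /\
    forall (N : gmod) (c : I -> N), (forall i, homog (d i) (c i)) ->
      (exists f : ghom M N, forall i, f (b i) = c i) /\
      (forall f g : ghom M N, (forall i, f (b i) = g (b i)) -> f =1 g).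


Section A1Free.
Variables (M : gmod) (c : M).

Definition A1_word (i : nat) : M :=
  let s1 := gsq1 M in let s2 := gsq2 M in
  nth 0 [:: c; s1 c; s2 c; s1 (s2 c); s2 (s1 c); s1 (s2 (s1 c));
            s2 (s1 (s2 c)); s1 (s2 (s1 (s2 c)))] i.

Lemma A1_word_sq1 (i : 'I_8) : gsq1 M (A1_word i) = A1_word (nth 8 A1_sq1 i).
Proof.
by case: i; do 8?[case=> [?|]; first by rewrite /A1_word /= ?gsq1_sq1].
Qed.

Lemma A1_word_sq2 (i : 'I_8) : gsq2 M (A1_word i) = A1_word (nth 8 A1_sq2 i).
Proof.
case: i; do 8?[case=> [?|]; first by
  rewrite /A1_word /= ?gsq2_sq2 ?gsq1_sq1 ?linear0 -?gsq2_sq2 ?gsq1_sq1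
          ?linear0 // ?gsq2_sq2 ?gsq1_sq1 ?linear0].
by [].
Qed.

Definition A1_ext (x : A1) : M := \sum_(i < 8) (x : 'rV_8) 0 i *: A1_word i.

Lemma A1_ext_linear : linear A1_ext.
Proof.
move=> a x y; rewrite scaler_sumr -big_split; apply: eq_bigr => i _.
by rewrite !mxE scalerDl scalerA.
Qed.

Lemma A1_ext_op (t : seq nat) (f : {linear M -> M}) : size t = 8%N ->
  (forall i : 'I_8, f (A1_word i) = A1_word (nth 8 t i)) ->
  forall x, A1_ext (A1_op t x) = f (A1_ext x).
Proof.
move=> t8 h x; rewrite linear_sum /A1_ext.
under eq_bigr do rewrite mxE scaler_suml.
rewrite exchange_big; apply: eq_bigr => i _; rewrite linearZ /= h.
under eq_bigr do rewrite mxE.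
case: (ltnP (nth 8 t i) 8) => [lt8|ge8].
  rewrite (bigD1 (Ordinal lt8)) //= eqxx mulr1 big1 ?addr0 // => k.
  by rewrite -val_eqE /= eq_sym => /negbTE ->; rewrite mulr0 scale0r.
rewrite [A1_word (nth _ _ _)]nth_default // scaler0 big1 // => k _.
by rewrite gtn_eqF ?mulr0 ?scale0r // (leq_trans (ltn_ord k)).
Qed.

Hypothesis c0 : homog 0 c.

Lemma A1_word_pr n (i : 'I_8) :
  gpr M n (A1_word i) = (A1_deg i == n)%:R *: A1_word i.
Proof.
suff h : gpr M (A1_deg i) (A1_word i) = A1_word i.
  by rewrite -h gpr_pr eq_sym; case: eqP => [->|_]; rewrite ?scale1r ?scale0r.
have s1 m y : gpr M m y = y -> gpr M (m + 1) (gsq1 M y) = gsq1 M y.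
  by move=> e; rewrite -gsq1_pr e.
have s2 m y : gpr M m y = y -> gpr M (m + 2) (gsq2 M y) = gsq2 M y.
  by move=> e; rewrite -gsq2_pr e.
have h1 := s1 _ _ c0; have h2 := s2 _ _ c0; have h3 := s1 _ _ h2.
have h4 := s2 _ _ h1; have h5 := s1 _ _ h4; have h6 := s2 _ _ h3.
have h7 := s1 _ _ h6.
by case: i; do 8?[case=> [?|]; first by []].
Qed.

Lemma A1_ext_pr n x : A1_ext (gpr A1 n x) = gpr M n (A1_ext x).
Proof.
rewrite linear_sum; apply: eq_bigr => i _.
by rewrite linearZ /= A1_word_pr -[in LHS]/(A1_pr n x) A1_prE mulrC scalerA.
Qed.

Definition A1_ext_hom : ghom A1 M :=
  @Ghom A1 M (mklin A1_ext_linear) A1_ext_pr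
    (@A1_ext_op A1_sq1 _ erefl A1_word_sq1)
    (@A1_ext_op A1_sq2 _ erefl A1_word_sq2).

Lemma A1_ext_one : A1_ext_hom A1_one = c.
Proof.
rewrite /= /A1_ext (bigD1 ord0) //= !mxE scale1r big1 ?addr0 // => i ne.
by rewrite mxE (negbTE ne) scale0r.
Qed.
End A1Free.

Lemma ghom_word (M N : gmod) (f : ghom M N) (c : M) i :
  f (A1_word c i) = A1_word (f c) i.
Proof.
rewrite /A1_word; do 8?[case: i => [|i] /=; first by rewrite ?(ghom_sq1, ghom_sq2)].
by rewrite ?nth_nil ?linear0.
Qed.

Lemma A1_op_delta (t : seq nat) (i : 'I_8) (lt : (nth 8 t i < 8)%N) :
  A1_op t (delta_mx 0 i) = delta_mx 0 (Ordinal lt).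
Proof.
apply/rowP=> j; rewrite /= -rowE !mxE eqxx /=; congr (_%:R).
by rewrite eq_sym.
Qed.

Lemma A1_word_one (i : 'I_8) : A1_word A1_one i = delta_mx 0 i.
Proof.
have e (j : 'I_8) (k : nat) (lt : (k < 8)%N) : k = j -> delta_mx 0 (Ordinal lt) = delta_mx 0 j :> 'rV['F_2]_8.
  by move=> kj; congr delta_mx; apply: val_inj.
have s1 (k : 'I_8) (j : 'I_8) : nth 8 A1_sq1 k = j ->
    gsq1 A1 (delta_mx 0 k) = delta_mx 0 j.
  move=> kj; have lt : (nth 8 A1_sq1 k < 8)%N by rewrite kj.
  by rewrite -(e _ _ lt kj) -A1_op_delta.
have s2 (k : 'I_8) (j : 'I_8) : nth 8 A1_sq2 k = j ->
    gsq2 A1 (delta_mx 0 k) = delta_mx 0 j.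
  move=> kj; have lt : (nth 8 A1_sq2 k < 8)%N by rewrite kj.
  by rewrite -(e _ _ lt kj) -A1_op_delta.
pose d k : 'rV['F_2]_8 := delta_mx 0 (inord k).
have sd1 k j : (k < 8)%N -> (j < 8)%N -> nth 8 A1_sq1 k = j -> gsq1 A1 (d k) = d j.
  by move=> k8 j8 kj; apply: s1; rewrite !inordK.
have sd2 k j : (k < 8)%N -> (j < 8)%N -> nth 8 A1_sq2 k = j -> gsq2 A1 (d k) = d j.
  by move=> k8 j8 kj; apply: s2; rewrite !inordK.
have -> : A1_one = d 0%N by congr delta_mx; apply: val_inj; rewrite /= inordK.
have -> : delta_mx 0 i = d i by rewrite /d inord_val.
rewrite /A1_word (sd1 0 1)%N // (sd2 0 2)%N // (sd1 2 3)%N // (sd2 1 4)%N //.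
rewrite (sd1 4 5)%N // (sd2 3 6)%N // (sd1 6 7)%N //.
by case: i; do 8?[case=> [?|]; first by []].
Qed.

Lemma A1_free : gfree A1.
Proof.
exists unit, (fun=> 0), (fun=> A1_one); split=> [_|N c hc].
  by apply/rowP=> j; rewrite -[LHS]/(A1_pr 0 A1_one 0 j) A1_prE !mxE; case: j; case=> [?|j ?];
    rewrite ?mul1r // andbF mulr0.
split=> [|f g fg x].
  by exists (A1_ext_hom (hc tt)) => -[]; apply: A1_ext_one.
rewrite [x]row_sum_delta !linear_sum; apply: eq_bigr => i _.
by rewrite !linearZ /= -A1_word_one !ghom_word fg.
Qed.

Definition gprojective (P : gmod) : Prop :=
  forall (M N : gmod) (p : ghom M N) (f : ghom P N),
    (forall y, exists x, p x = y) -> exists g : ghom P M, p \o g =1 f.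

Definition reduced (M : gmod) : Prop :=
  forall x : M, gsq2 M (gsq2 M (gsq2 M x)) = 0.

(* N is a reduced part of M. It is determined by M up to isomorphism only, so
   M^red and Omega^n M are rendered as relations. *)
Definition is_red (M N : gmod) : Prop :=
  reduced N /\ exists P : gmod, gfree P /\ giso M (gsum P N).

Definition is_Omega (n : nat) (M N : gmod) : Prop :=
  is_red (gtens (gtpow OmegaF n) M) N.

(* (Omega Sigma^{-1})^n M = Omega^n Sigma^{-n} M, as a relation. *)
Definition is_OmegaDesusp (n : nat) (M N : gmod) : Prop :=
  is_Omega n (gshift (- n%:Z) M) N.

Definition stably_eq (M N : gmod) (f g : ghom M N) : Prop :=
  exists (P : gmod) (u : ghom M P) (v : ghom P N),
    gprojective P /\ forall x, f x - g x = v (u x).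

Definition stably_zero (M N : gmod) (f : ghom M N) : Prop :=
  exists (P : gmod) (u : ghom M P) (v : ghom P N),
    gprojective P /\ forall x, f x = v (u x).

Definition stably_iso (M N : gmod) : Prop :=
  exists (f : ghom M N) (g : ghom N M),
    stably_eq (gcomp g f) (gid M) /\ stably_eq (gcomp f g) (gid N).

(* The connecting morphism L (x) A -> F (x) A = A of the triangle obtained by
   tensoring 0 -> ker phi -> L -> F -> 0 with A. *)
Definition connecting (L A : gmod) (phi : ghom L gF) : ghom (gtens L A) A :=
  gcomp (gunit A) (gtens_hom phi (gid A)).

Definition triangle_splits (L A : gmod) (phi : ghom L gF) : Prop :=
  stably_zero (connecting A phi).

(* Main.v *)
(* Write y : L -> F and y' : L' -> F for the defining maps of A = ker y and
   A' = ker y'.  The map L (x) L -> A, l (x) m |-> y(l) m + y(m) l, restricts to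
   multiplication by y on L (x) A.  It is stably zero as a map to L, since L is
   invertible, and it is stably zero as a map to A because the obstruction lies
   in Ext^(2k+1, 2k+2)(F, F) = 0.  Hence y, and every multiple of y, acts as
   zero on A.  Unless k = l and delta + epsilon = 1, y' is a multiple of y by
   powers of h_0 : Omega Sigma^{-1} F -> F and by maps
   Omega Sigma^{-1} J -> F and (Omega Sigma^{-1})^2 F -> Omega Sigma^{-1} J.
   Conversely, if y' acts as zero on A then y' = y r for some r : L' -> L; for
   k = l this r desuspends to a map between Omega Sigma^{-1} F and
   Omega Sigma^{-1} J that is non-trivial in degree 0, and there is none.

   By Higman's criterion for the Frobenius algebra A(1), a map is stably zero
   iff it is a trace Sq^2 Sq^2 Sq^2 . h of a linear map h of degree -6.  This
   makes tensor products of stably zero maps, lifts and extensions explicit.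

   (Omega Sigma^{-1})^n J^epsilon is modelled by tensor products of
   Omega Sigma^{-1} F and Omega Sigma^{-1} J; Schanuel's lemma compares the
   latter with Omega Sigma^{-1} F (x) J. *)
Require Import Defs.
From HB Require Import structures.
From mathcomp Require Import all_boot all_order all_algebra ssrAC.
From mathcomp Require Import sesquilinear boolp classical_sets zify.

Set Implicit Arguments.
Unset Strict Implicit.
Unset Printing Implicit Defensive.

Import Order.TTheory GRing.Theory Num.Theory.
Local Open Scope ring_scope.

(** * Linear algebra over F_2 *)

(** The modules (Omega Sigma^{-1})^n J^epsilon are given only up to isomorphism, as reduced parts,
    while A is an honest kernel. Reducedness bridges the gap: a reduced module that is a stable
    retract of a model is an honest retract of it, and an honest retraction compatible with the maps
    to F restricts to the kernels, with no argument about triangles. A retraction in one direction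
    suffices, because stable vanishing passes to retracts. Invertibility of L enters through its
    consequence that symmetrized multiplication by y is stably zero. This is verified by hand on the
    two factors Omega Sigma^{-1} F and Omega Sigma^{-1} J, and a Leibniz formula carries it to
    tensor products. The bound k >= 1 comes from the obstruction group. For k = 0 it would be
    Ext^(1,2)(F, F), which contains the class h_1 dual to Sq^2. In the models this means that the
    first factor can be split off only if another one remains. *)

Lemma F2_cases (a : 'F_2) : a = 0 \/ a = 1.
Proof. by case: a => [[|[|//]] ?]; [left|right]; apply: val_inj. Qed.

Lemma opp2 (V : lmodType 'F_2) (x : V) : - x = x.
Proof. by apply/esym/eqP; rewrite -addr_eq0 char2. Qed.

Lemma linear_F2 (U V : lmodType 'F_2) (f : U -> V) :
  (forall x y, f (x + y) = f x + f y) -> linear f.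
Proof.
move=> fD a x y; have [->|->] := F2_cases a; rewrite fD ?scale1r //.
rewrite !scale0r; congr (_ + _).
by apply: (addrI (f 0)); rewrite -fD !addr0.
Qed.

(** A maximal additive subset that meets the kernel of [p] only in 0 is a complement of the kernel,
    and inverting [p] on it gives the section. Over F_2 additive subsets are subspaces, so scalars
    never appear. *)
Lemma linear_section (U V : lmodType 'F_2) (p : {linear U -> V}) :
  (forall y, exists x, p x = y) -> exists s : {linear V -> U}, forall y, p (s y) = y.
Proof.
move=> psurj.
pose P (A : set U) := (forall x y, A x -> A y -> A (x + y)) /\
  (forall x, A x -> p x = 0 -> x = 0).
have [F FP Ftot|A [[AD A0] Amax]] := @Zorn_bigcup U P.
  split=> [x y [X FX Xx] [Y FY Yy]|x [X FX Xx]]; last by have [_] := FP X FX; apply.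
  have [XY|YX] := Ftot X Y FX FY.
    by exists Y => //; have [h _] := FP Y FY; apply: h => //; apply: XY.
  by exists X => //; have [h _] := FP X FX; apply: h => //; apply: YX.
(* [P] also holds for the empty set, the union of the empty chain, so 0 has to be shown to lie in
   the maximal set. *)
have Az : A 0.
  apply: contrapT => nA; apply: (Amax (fun x => A x \/ x = 0)).
    by split=> [x|h]; [left | apply: nA; apply: h; right].
  split=> [x y [Ax|->] [Ay|->]|x [|->] //]; rewrite ?addr0 ?add0r; auto.
have Asurj y : exists x, A x /\ p x = y.
  have [x0 <-] := psurj y.
  suff [k [a [pk Aa ->]]] : exists k a, [/\ p k = 0, A a & x0 = k + a].
    by exists a; split=> //; rewrite linearD pk add0r.
  apply: contrapT => nx; apply: (Amax (fun x => A x \/ A (x + x0))).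
    split=> [x|h]; first by left.
    apply: nx; exists 0, x0; rewrite linear0 add0r; split=> //.
    by apply: h; right; rewrite char2.
  split=> [x z|x].
    have e : x + z = (x + x0) + (z + x0) by rewrite addrACA char2 addr0.
    move=> [Ax|Ax] [Az'|Az'].
    - by left; apply: AD.
    - by right; rewrite -addrA; apply: AD.
    - by right; rewrite addrAC; apply: AD.
    - by left; rewrite e; apply: AD.
  move=> [|Ax px0]; first exact: A0.
  case: nx; exists x, (x + x0); split=> //.
  by rewrite addrA char2 add0r.
have [s hs] := choice Asurj.
have sD x y : s (x + y) = s x + s y.
  have [Ax px] := hs x; have [Ay py] := hs y; have [Axy pxy] := hs (x + y).
  apply/eqP; rewrite -subr_eq0 opp2; apply/eqP; apply: A0.
    by apply: (AD _ _ Axy); apply: AD.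
  by rewrite !linearD pxy px py char2.
by exists (mklin (linear_F2 sD)) => y; have [] := hs y.
Qed.

Definition hdeg (M N : gmod) (d : int) (h : M -> N) : Prop :=
  forall n x, h (gpr M n x) = gpr N (n + d) (h x).

Lemma hdeg_compl (M N P : gmod) (d : int) (g : ghom N P) (f : M -> N) :
  hdeg d f -> hdeg d (g \o f).
Proof. by move=> hf n x; rewrite /= hf ghom_pr. Qed.

Lemma hdeg_compr (M N P : gmod) (d : int) (g : ghom M N) (f : N -> P) :
  hdeg d f -> hdeg d (f \o g).
Proof. by move=> hf n x; rewrite /= ghom_pr hf. Qed.

Lemma hdeg_comp (M N P : gmod) (d : int) (g : N -> P) (f : M -> N) :
  hdeg 0 g -> hdeg d f -> hdeg d (g \o f).
Proof. by move=> hg hf n x; rewrite /= hf hg addr0. Qed.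

Lemma hdeg_add (M N : gmod) (d : int) (g f : {linear M -> N}) :
  hdeg d g -> hdeg d f -> hdeg d (g \+ f).
Proof. by move=> hg hf n x; rewrite /= hf hg linearD. Qed.

Section GradedPart.
Variables (M N : gmod) (h : {linear M -> N}).

(** The degree-preserving component of [h]. It is needed because sections obtained from Zorn's lemma
    ignore the grading. *)
Definition gpart_fun (x : M) : N := \sum_(n <- gsupp x) gpr N n (h (gpr M n x)).

Lemma gpart_linear : linear gpart_fun.
Proof.
apply: linear_F2 => x y; rewrite /gpart_fun.
set s := undup (gsupp x ++ gsupp y).
have us : uniq s by exact: undup_uniq.
have sx i : i \notin s -> gpr M i x = 0.
  by rewrite mem_undup mem_cat negb_or => /andP[/gpr_out_supp].
have sy i : i \notin s -> gpr M i y = 0.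
  by rewrite mem_undup mem_cat negb_or => /andP[_ /gpr_out_supp].
have z i : h (0 : M) = 0 -> gpr N i (h 0) = 0 by move=> ->; rewrite linear0.
rewrite !(@gsuppE M _ _ s) //; try by move=> i ->; rewrite !linear0.
- by rewrite -big_split /=; apply: eq_bigr => i _; rewrite !linearD.
- by move=> i /sy ->; rewrite !linear0.
- by move=> i /sx ->; rewrite !linear0.
- by move=> i si; rewrite linearD sx // sy // addr0 !linear0.
Qed.
Definition gpart : {linear M -> N} := mklin gpart_linear.

Lemma gpartE n x : gpart (gpr M n x) = gpr N n (h (gpr M n x)).
Proof.
rewrite /= /gpart_fun (@gsuppE M _ _ [:: n]) //.
- by rewrite big_seq1 gpr_pr eqxx.
- by move=> k; rewrite inE gpr_pr => /negbTE ->; rewrite !linear0.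
- by move=> k ->; rewrite !linear0.
Qed.

Lemma gpart_deg : hdeg 0 gpart.
Proof.
move=> n x; rewrite gpartE addr0.
have [s us xs] := gpr_sum x.
have -> : gpart x = \sum_(i <- s) gpr N i (h (gpr M i x)).
  by rewrite {1}xs linear_sum; apply: eq_bigr => i _; apply: gpartE.
rewrite linear_sum; under eq_bigr do rewrite gpr_pr.
case: (boolP (n \in s)) => ns.
  rewrite (bigD1_seq n) //= eqxx big1 ?addr0 // => i ni.
  by rewrite eq_sym (negbTE ni).
rewrite big_seq big1 => [|i si]; last first.
  by case: eqP => // e; rewrite e si in ns.
by rewrite (gpr_out xs ns) !linear0.
Qed.
End GradedPart.

(** * Stably zero maps as traces *)

Section Trace.
Variables M N : gmod.
Implicit Types h k : {linear M -> N}.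

(* The action of Sq^1 and Sq^2 on Hom(M, N); the antipode is trivial on both. *)
Definition d1 h : {linear M -> N} := (gsq1 N \o h) \+ (h \o gsq1 M).
Definition d2 h : {linear M -> N} :=
  ((gsq2 N \o h) \+ (gsq1 N \o (h \o gsq1 M))) \+ (h \o gsq2 M).
Definition trace h : {linear M -> N} := d2 (d2 (d2 h)).

Lemma d1E h x : d1 h x = gsq1 N (h x) + h (gsq1 M x).
Proof. by []. Qed.
Lemma d2E h x : d2 h x = gsq2 N (h x) + gsq1 N (h (gsq1 M x)) + h (gsq2 M x).
Proof. by []. Qed.

Lemma eq_d1 h k : h =1 k -> d1 h =1 d1 k.
Proof. by move=> e x; rewrite !d1E !e. Qed.
Lemma eq_d2 h k : h =1 k -> d2 h =1 d2 k.
Proof. by move=> e x; rewrite !d2E !e. Qed.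

Lemma eq_trace h k : h =1 k -> trace h =1 trace k.
Proof. by move=> e; do 3!apply: eq_d2. Qed.

Lemma d1_d1 h x : d1 (d1 h) x = 0.
Proof.
by rewrite !d1E linearD !gsq1_sq1 linear0 add0r addr0 char2.
Qed.

Lemma d2_d2 h x : d2 (d2 h) x = d1 (d2 (d1 h)) x.
Proof.
rewrite d1E !d2E !d1E !linearD /= !(gsq1_sq1, gsq2_sq2, linear0, add0r, addr0).
rewrite [LHS](AC (3*2*3) ((3*6)*(1*4*7*(2*(5*8))))) /=.
by rewrite char2 add0r.
Qed.

Lemma d1_0 h : h =1 (fun=> 0) -> d1 h =1 (fun=> 0).
Proof. by move=> e x; rewrite d1E !e linear0 addr0. Qed.
Lemma d2_0 h : h =1 (fun=> 0) -> d2 h =1 (fun=> 0).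
Proof. by move=> e x; rewrite d2E !e !linear0 !addr0. Qed.

(** The socle is annihilated by Sq^1 and Sq^2: d1 d2^2 = d1 d1 d2 d1 = 0, and d2^4 = d1 d2 d1 d1 d2
    d1 = 0. Since the invariants of Hom(M, N) are the module maps, traces are module maps. *)
Lemma d1_trace h x : d1 (trace h) x = 0.
Proof. by rewrite (eq_d1 (@d2_d2 (d2 h))) d1_d1. Qed.

Lemma d2_trace h x : d2 (trace h) x = 0.
Proof.
rewrite /trace d2_d2 (d1_0 (d2_0 _)) // => y.
by rewrite (eq_d1 (@d2_d2 h)) d1_d1.
Qed.

Lemma trace_sq1 h x : trace h (gsq1 M x) = gsq1 N (trace h x).
Proof.
by apply/eqP; rewrite eq_sym -subr_eq0 opp2 -d1E d1_trace.
Qed.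

Lemma trace_sq2 h x : trace h (gsq2 M x) = gsq2 N (trace h x).
Proof.
apply/eqP; rewrite eq_sym -subr_eq0 opp2.
by have := d2_trace h x; rewrite d2E trace_sq1 gsq1_sq1 addr0 => ->.
Qed.

Lemma hdeg_d2 d h : hdeg d h -> hdeg (d + 2) (d2 h).
Proof.
move=> hd n x; rewrite !d2E !linearD gsq1_pr gsq2_pr !hd gsq1_pr gsq2_pr.
have e1 : n + 1 + d + 1 = n + (d + 2) by rewrite -!addrA [1 + _]addrCA.
have e2 : n + 2 + d = n + (d + 2) by rewrite -addrA [2 + d]addrC.
by rewrite e1 e2 [n + (d + 2)]addrA.
Qed.

Lemma hdeg_trace h : hdeg (-6) h -> hdeg 0 (trace h).
Proof. by move=> hd; apply: (hdeg_d2 (hdeg_d2 (hdeg_d2 hd))). Qed.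

Lemma trace_pr h (hd : hdeg (-6) h) n x :
  trace h (gpr M n x) = gpr N n (trace h x).
Proof. by rewrite (hdeg_trace hd) addr0. Qed.

Definition trace_hom h (hd : hdeg (-6) h) : ghom M N :=
  @Ghom M N (trace h) (trace_pr hd) (trace_sq1 h) (trace_sq2 h).

(* [null f] means that [f] is stably zero (see [stably_zeroP]): by Higman's
   criterion this amounts to being in the image of the socle element
   Sq^2 Sq^2 Sq^2 acting on Hom(M, N). *)
Definition null (f : M -> N) : Prop :=
  exists h : {linear M -> N}, hdeg (-6) h /\ trace h =1 f.

Lemma eq_null (f g : M -> N) : f =1 g -> null f -> null g.
Proof. by move=> e [h [hd hf]]; exists h; split=> // x; rewrite hf e. Qed.

Lemma null_add (f g : M -> N) : null f -> null g -> null (fun x => f x + g x).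
Proof.
move=> [h [hd hf]] [k [kd kf]]; exists (h \+ k); split; first exact: hdeg_add.
have d2D (u v w : {linear M -> N}) : w =1 u \+ v -> d2 w =1 d2 u \+ d2 v.
  move=> wE x; rewrite /= !wE /= !linearD.
  by rewrite [LHS](AC (2*2*2) ((1*3*5)*(2*4*6))).
by move=> x; rewrite -hf -kf; do 3!apply: (d2D).
Qed.

End Trace.

Section NullComp.
Variables M N P : gmod.

Lemma d2_compl (g : ghom N P) (h : {linear M -> N}) :
  d2 (g \o h) =1 g \o d2 h.
Proof. by move=> x; rewrite /= !linearD !ghom_sq1 !ghom_sq2. Qed.

Lemma d2_compr (g : ghom M N) (h : {linear N -> P}) :
  d2 (h \o g) =1 d2 h \o g.
Proof. by move=> x; rewrite /= !ghom_sq1 !ghom_sq2. Qed.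

Lemma trace_compl (g : ghom N P) (h : {linear M -> N}) :
  trace (g \o h) =1 g \o trace h.
Proof.
move=> x; rewrite -[RHS]d2_compl.
apply: eq_d2 => y; rewrite -[RHS]d2_compl.
by apply: eq_d2 => z; rewrite -[RHS]d2_compl.
Qed.

Lemma trace_compr (g : ghom M N) (h : {linear N -> P}) :
  trace (h \o g) =1 trace h \o g.
Proof.
move=> x; rewrite -[RHS]d2_compr.
apply: eq_d2 => y; rewrite -[RHS]d2_compr.
by apply: eq_d2 => z; rewrite -[RHS]d2_compr.
Qed.

Lemma null_compl (g : ghom N P) (f : M -> N) : null f -> null (g \o f).
Proof.
move=> [h [hd hf]]; exists (g \o h); split; first exact: hdeg_compl.
by move=> x; rewrite trace_compl -[RHS]/(g (f x)) -hf.
Qed.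

Lemma null_compr (g : ghom M N) (f : N -> P) : null f -> null (f \o g).
Proof.
move=> [h [hd hf]]; exists (h \o g); split; first exact: hdeg_compr.
by move=> x; rewrite trace_compr -[RHS]/(f (g x)) -hf.
Qed.
End NullComp.

Section NullTensor.
Variables M N X : gmod.

Definition tensl (h : {linear M -> N}) : {linear gtens M X -> gtens N X} :=
  tmap h idfun.

Lemma tenslE h x y : tensl h (tpure x y) = tpure (h x) y.
Proof. exact: tmapE. Qed.

Lemma gtens_sq1p (A B : gmod) (u : A) (v : B) :
  gsq1 (gtens A B) (tpure u v) = tpure (gsq1 A u) v + tpure u (gsq1 B v).
Proof. exact: gtens_sq1E. Qed.
Lemma gtens_sq2p (A B : gmod) (u : A) (v : B) : gsq2 (gtens A B) (tpure u v) =
  tpure (gsq2 A u) v + tpure (gsq1 A u) (gsq1 B v) + tpure u (gsq2 B v).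
Proof. exact: gtens_sq2E. Qed.

(** In the action on h (x) 1 every term in which an operation hits X occurs twice. Hence trace
    commutes with - (x) X, and tensoring preserves stably zero maps. *)
Lemma d2_tensl (h : {linear M -> N}) : d2 (tensl h) =1 tensl (d2 h).
Proof.
apply: tens_lin_ext => x y; rewrite d2E gtens_sq1p gtens_sq2p.
rewrite !linearD !tenslE !gtens_sq1p gtens_sq2p gsq1_sq1 linear0r addr0.
rewrite d2E !linearDl [LHS](AC (3*3*3) ((1*4*7)*(2*6)*(3*9)*(5*8))).
by rewrite /= !char2 !addr0.
Qed.

Lemma hdeg_tensl d (h : {linear M -> N}) : hdeg d h -> hdeg d (tensl h).
Proof.
move=> hd n.
apply: (gtens_homog_ext (f := tensl h \o gpr (gtens M X) n)
                        (g := gpr (gtens N X) (n + d) \o tensl h)) => i j u v.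
rewrite -[LHS]/(tensl h (gtens_pr M X n _)).
rewrite -[RHS]/(gtens_pr N X (n + d) (tensl h _)) gtens_prE !tenslE hd gtens_prE.
rewrite [i + d + j]addrAC (inj_eq (addIr _)).
by case: eqP => _; rewrite ?linear0 // tenslE hd.
Qed.

Lemma null_tensl (f : ghom M N) : null f -> null (gtens_hom f (gid X)).
Proof.
move=> [h [hd hf]]; exists (tensl h); split; first exact: hdeg_tensl.
move=> z; transitivity (tensl (trace h) z).
  rewrite -[RHS]d2_tensl; apply: eq_d2 => {}z; rewrite -[RHS]d2_tensl.
  by apply: eq_d2 => {}z; rewrite -[RHS]d2_tensl.
apply: (tens_lin_ext (f := tensl (trace h)) (g := gtens_hom f (gid X))) => x y.
by rewrite tenslE hf [RHS]tmapE.
Qed.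

End NullTensor.

Definition gproj (P : gmod) : Prop := null (@idfun P).

Lemma gproj_tensl P X : gproj P -> gproj (gtens P X).
Proof.
move=> hP; have hid : null (gid P) by [].
apply: eq_null (null_tensl X hid).
apply: (tens_lin_ext (f := gtens_hom (gid P) (gid X)) (g := idfun)) => x y.
exact: tmapE.
Qed.

Lemma null_proj_dom P N (f : ghom P N) : gproj P -> null f.
Proof. by move=> hP; apply: eq_null (null_compl f hP). Qed.

Lemma null_proj_cod M P (f : ghom M P) : gproj P -> null f.
Proof. by move=> hP; apply: eq_null (null_compr f hP). Qed.

(** If the identity is trace h and s is a graded linear section of p, then trace (s f h) is a module
    map, and p trace (s f h) = trace (p s f h) = f trace h = f. *)
Lemma gproj_gprojective P : gproj P -> gprojective P.
Proof.
move=> [h [hd hid]] M N p f psurj.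
have [s ps] := linear_section psurj.
have ps' y : p (gpart s y) = y.
  have [t _ ->] := gpr_sum y; rewrite [gpart s _]linear_sum linear_sum; apply: eq_bigr => n _.
  by rewrite gpartE ghom_pr ps gpr_pr eqxx.
have kd : hdeg (-6) (gpart s \o (f \o h)).
  by apply: hdeg_comp; [apply: gpart_deg | apply: hdeg_compl].
exists (trace_hom kd) => x.
have e : p \o (gpart s \o (f \o h)) =1 f \o h by move=> y; apply: ps'.
have := eq_trace e x; rewrite (trace_compl p) (trace_compl f) => h1.
by rewrite -[RHS]/(f (idfun x)) -hid; exact: h1.
Qed.

(** * The algebra A(1) *)

(* [E i] is the basis element of A(1) with index [i] (see [A1_deg]), of degree
   [edeg i], and [co i] is the corresponding coordinate. *)
HB.lock Definition E (i : nat) : A1 := A1_word A1_one i.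

Section A1Basis.

Lemma co_linear j : linear (fun x : A1 => (x : 'rV_8) 0 (inord j) : gF).
Proof. by move=> a x y; rewrite !mxE. Qed.
Definition co (j : nat) : {linear A1 -> gF} := mklin (co_linear j).

Lemma E_delta (i : 'I_8) : E i = delta_mx 0 i.
Proof. by rewrite E.unlock; apply: A1_word_one. Qed.

Lemma coE (i j : nat) : (i < 8)%N -> (j < 8)%N -> co j (E i) = (i == j)%:R.
Proof.
move=> i8 j8; rewrite -[i]/(nat_of_ord (Ordinal i8)) E_delta /= mxE eqxx /=.
by rewrite -val_eqE /= inordK // eq_sym.
Qed.

Lemma A1_lin_ext (W : lmodType 'F_2) (f g : {linear A1 -> W}) :
  (forall i, (i < 8)%N -> f (E i) = g (E i)) -> f =1 g.
Proof.
move=> fg x; rewrite [x]row_sum_delta !linear_sum; apply: eq_bigr => i _.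
by rewrite !linearZ /= -E_delta fg.
Qed.

Lemma sq1_E : (gsq1 A1 (E 0) = E 1) * (gsq1 A1 (E 1) = 0) *
  (gsq1 A1 (E 2) = E 3) * (gsq1 A1 (E 3) = 0) * (gsq1 A1 (E 4) = E 5) *
  (gsq1 A1 (E 5) = 0) * (gsq1 A1 (E 6) = E 7) * (gsq1 A1 (E 7) = 0).
Proof.
have h i (i8 : (i < 8)%N) : gsq1 A1 (E i) = E (nth 8 A1_sq1 i) :> A1.
  by rewrite E.unlock; apply: (@A1_word_sq1 A1 A1_one (Ordinal i8)).
by do 7?split; rewrite h //= E.unlock.
Qed.

Lemma sq2_E : (gsq2 A1 (E 0) = E 2) * (gsq2 A1 (E 1) = E 4) *
  (gsq2 A1 (E 2) = E 5) * (gsq2 A1 (E 3) = E 6) * (gsq2 A1 (E 4) = 0) *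
  (gsq2 A1 (E 5) = E 7) * (gsq2 A1 (E 6) = 0) * (gsq2 A1 (E 7) = 0).
Proof.
have h i (i8 : (i < 8)%N) : gsq2 A1 (E i) = E (nth 8 A1_sq2 i) :> A1.
  by rewrite E.unlock; apply: (@A1_word_sq2 A1 A1_one (Ordinal i8)).
by do 7?split; rewrite h //= E.unlock.
Qed.

Lemma forall8 (P : nat -> Prop) : P 0%N -> P 1%N -> P 2%N -> P 3%N -> P 4%N ->
  P 5%N -> P 6%N -> P 7%N -> forall i, (i < 8)%N -> P i.
Proof. by do 8!move=> ?; do 8?[case=> [//|]]. Qed.

Lemma co_sq1 x : (co 0 (gsq1 A1 x) = 0) * (co 1 (gsq1 A1 x) = co 0 x) *
  (co 2 (gsq1 A1 x) = 0) * (co 3 (gsq1 A1 x) = co 2 x) *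
  (co 4 (gsq1 A1 x) = 0) * (co 5 (gsq1 A1 x) = co 4 x) *
  (co 6 (gsq1 A1 x) = 0) * (co 7 (gsq1 A1 x) = co 6 x).
Proof.
have h j k : (j < 8)%N -> (k < 8)%N ->
    (forall i, (i < 8)%N -> co j (gsq1 A1 (E i)) = co k (E i)) ->
    co j (gsq1 A1 x) = co k x.
  by move=> _ _ hi; apply: (A1_lin_ext (f := co j \o gsq1 A1)).
have h0 j : (forall i, (i < 8)%N -> co j (gsq1 A1 (E i)) = 0) ->
    co j (gsq1 A1 x) = 0.
  by move=> hi; apply: (A1_lin_ext (f := co j \o gsq1 A1) (g := \0)).
do 7?split; (apply: h || apply: h0) => //; apply: forall8;
  by rewrite sq1_E ?coE ?linear0.
Qed.

Lemma co_sq2 x : (co 0 (gsq2 A1 x) = 0) * (co 1 (gsq2 A1 x) = 0) *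
  (co 2 (gsq2 A1 x) = co 0 x) * (co 3 (gsq2 A1 x) = 0) *
  (co 4 (gsq2 A1 x) = co 1 x) * (co 5 (gsq2 A1 x) = co 2 x) *
  (co 6 (gsq2 A1 x) = co 3 x) * (co 7 (gsq2 A1 x) = co 5 x).
Proof.
have h j k : (j < 8)%N -> (k < 8)%N ->
    (forall i, (i < 8)%N -> co j (gsq2 A1 (E i)) = co k (E i)) ->
    co j (gsq2 A1 x) = co k x.
  by move=> _ _ hi; apply: (A1_lin_ext (f := co j \o gsq2 A1)).
have h0 j : (forall i, (i < 8)%N -> co j (gsq2 A1 (E i)) = 0) ->
    co j (gsq2 A1 x) = 0.
  by move=> hi; apply: (A1_lin_ext (f := co j \o gsq2 A1) (g := \0)).
do 7?split; (apply: h || apply: h0) => //; apply: forall8;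
  by rewrite sq2_E ?coE ?linear0.
Qed.

Definition edeg (i : nat) : nat := nth 0%N [:: 0; 1; 2; 3; 3; 4; 5; 6]%N i.

Lemma co_pr j n x : (j < 8)%N ->
  co j (gpr A1 n x) = (n == edeg j)%:R * co j x.
Proof.
move=> j8; rewrite -[LHS]/(A1_pr n x 0 (inord j)) A1_prE /A1_deg inordK //.
by rewrite eq_sym.
Qed.

Lemma A1_coP (x y : A1) : (forall j, (j < 8)%N -> co j x = co j y) -> x = y.
Proof.
by move=> h; apply/rowP => j; have := h j (ltn_ord j); rewrite /= inord_val.
Qed.

Lemma E_pr i n : (i < 8)%N -> gpr A1 n (E i) = (n == edeg i)%:R *: E i.
Proof.
move=> i8; apply: A1_coP => j j8; rewrite co_pr // linearZ /= -[_ 0 _]/(co j _).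
by rewrite coE //; case: (eqVneq i j) => [->//|_]; rewrite mulr0 scaler0.
Qed.

End A1Basis.

(** [h] sends the top basis element to the bottom one and kills the others. Each application of [d2]
    raises its degree by 2, and after three of them the identity appears. An arbitrary family [e]
    keeps the calculation a rewriting with the two tables. *)
Lemma trace_table (M : gmod) (e : nat -> M) (h : {linear M -> M}) :
  (gsq1 M (e 0) = e 1) * (gsq1 M (e 1) = 0) * (gsq1 M (e 2) = e 3) *
  (gsq1 M (e 3) = 0) * (gsq1 M (e 4) = e 5) * (gsq1 M (e 5) = 0) *
  (gsq1 M (e 6) = e 7) * (gsq1 M (e 7) = 0) ->
  (gsq2 M (e 0) = e 2) * (gsq2 M (e 1) = e 4) * (gsq2 M (e 2) = e 5) *
  (gsq2 M (e 3) = e 6) * (gsq2 M (e 4) = 0) * (gsq2 M (e 5) = e 7) *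
  (gsq2 M (e 6) = 0) * (gsq2 M (e 7) = 0) ->
  (h (e 0) = 0) * (h (e 1) = 0) * (h (e 2) = 0) * (h (e 3) = 0) *
  (h (e 4) = 0) * (h (e 5) = 0) * (h (e 6) = 0) * (h (e 7) = e 0) ->
  forall i, (i < 8)%N -> trace h (e i) = e i.
Proof.
move=> s1 s2 hE.
have k1E : (d2 h (e 0) = 0) * (d2 h (e 1) = 0) * (d2 h (e 2) = 0) *
    (d2 h (e 3) = 0) * (d2 h (e 4) = 0) * (d2 h (e 5) = e 0) *
    (d2 h (e 6) = e 1) * (d2 h (e 7) = e 2).
  by do 7?split; rewrite d2E !(s1, s2, hE, linear0, addr0, add0r).
rewrite /trace; move: (d2 h) k1E => {hE}k1 k1E.
have k2E : (d2 k1 (e 0) = 0) * (d2 k1 (e 1) = 0) * (d2 k1 (e 2) = e 0) *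
    (d2 k1 (e 3) = e 1) * (d2 k1 (e 4) = e 1) * (d2 k1 (e 5) = 0) *
    (d2 k1 (e 6) = e 4 + e 3) * (d2 k1 (e 7) = e 5).
  by do 7?split; rewrite d2E !(s1, s2, k1E, linear0, addr0, add0r) ?char2.
move: (d2 k1) k2E => {k1E}k2 k2E.
apply: forall8; rewrite d2E !(s1, s2, k2E, linear0, linearD, addr0, add0r) //.
all: by rewrite addrA char2 add0r.
Qed.

Section A1Trace.

Lemma A1_t_linear : linear (fun x : A1 => (co 7 x : 'F_2) *: E 0).
Proof. by move=> a x y; rewrite linearP scalerDl -scalerA. Qed.
(** The Frobenius form of A(1), that is the coordinate of the socle, times the unit. *)
Definition A1_t : {linear A1 -> A1} := mklin A1_t_linear.

Lemma A1_tE x : A1_t x = (co 7 x : 'F_2) *: E 0.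
Proof. by []. Qed.

Lemma A1_t_deg : hdeg (-6) A1_t.
Proof.
move=> n x; rewrite !A1_tE linearZ [gpr _ _ (E 0)]E_pr // co_pr //= scalerA mulrC.
by rewrite subr_eq0.
Qed.

Lemma A1_trace x : trace A1_t x = x.
Proof.
have tE : (A1_t (E 0) = 0) * (A1_t (E 1) = 0) * (A1_t (E 2) = 0) *
    (A1_t (E 3) = 0) * (A1_t (E 4) = 0) * (A1_t (E 5) = 0) *
    (A1_t (E 6) = 0) * (A1_t (E 7) = E 0).
  by do 7?split; rewrite A1_tE coE //= ?scale0r ?scale1r.
apply: (A1_lin_ext (f := trace A1_t) (g := idfun)).
exact: (trace_table sq1_E sq2_E tE).
Qed.
End A1Trace.

(** * Tensor products *)

Definition tpl (K : fieldType) (U V : lmodType K) (v : V) : {linear U -> tens U V} :=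
  mklin (fun a x y => linearPl (@tpure K U V) v a x y).
Definition tpr (K : fieldType) (U V : lmodType K) (u : U) : {linear V -> tens U V} :=
  mklin (fun a x y => linearPr (@tpure K U V) u a x y).

Section Glift.
Variables (M N X : gmod) (F : {linear tens M N -> X}).
Hypothesis F_deg : forall i j u v, homog (i + j) (F (tpure (gpr M i u) (gpr N j v))).
Hypothesis F_sq1 : forall u v,
  gsq1 X (F (tpure u v)) = F (tpure (gsq1 M u) v) + F (tpure u (gsq1 N v)).
Hypothesis F_sq2 : forall u v, gsq2 X (F (tpure u v)) =
  F (tpure (gsq2 M u) v) + F (tpure (gsq1 M u) (gsq1 N v)) + F (tpure u (gsq2 N v)).

Lemma glift_pr n z : F (gpr (gtens M N) n z) = gpr X n (F z).
Proof.
apply: (gtens_homog_ext (f := F \o gpr (gtens M N) n) (g := gpr X n \o F)).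
move=> i j u v; rewrite -[LHS]/(F (gtens_pr M N n _)) gtens_prE.
rewrite -[RHS]/(gpr X n (F _)) -F_deg gpr_pr.
by case: eqP => // _; rewrite ?linear0 // F_deg.
Qed.
Lemma glift_sq1 z : F (gsq1 (gtens M N) z) = gsq1 X (F z).
Proof.
apply: (tens_lin_ext (f := F \o gsq1 (gtens M N)) (g := gsq1 X \o F)) => u v.
by rewrite -[LHS]/(F (gsq1 (gtens M N) _)) gtens_sq1p linearD -F_sq1.
Qed.
Lemma glift_sq2 z : F (gsq2 (gtens M N) z) = gsq2 X (F z).
Proof.
apply: (tens_lin_ext (f := F \o gsq2 (gtens M N)) (g := gsq2 X \o F)) => u v.
by rewrite -[LHS]/(F (gsq2 (gtens M N) _)) gtens_sq2p !linearD -F_sq2.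
Qed.
Definition glift : ghom (gtens M N) X :=
  @Ghom (gtens M N) X F glift_pr glift_sq1 glift_sq2.
End Glift.

Lemma homog_tpure (M N : gmod) i j (u : M) (v : N) :
  homog (i + j) (tpure (gpr M i u) (gpr N j v) : gtens M N).
Proof. by rewrite /homog [LHS]gtens_prE eqxx. Qed.

Lemma gpr_tpurel (M N : gmod) n i (u : M) (v : N) : homog i u ->
  gpr (gtens M N) n (tpure u v) = tpure u (gpr N (n - i) v).
Proof.
move=> iu; have [s us xs] := gpr_sum v.
rewrite {1}xs linear_sumr [LHS]linear_sum {2}xs linear_sum linear_sumr.
apply: eq_bigr => j _; rewrite -iu [LHS]gtens_prE gpr_pr.
rewrite subr_eq [j + i]addrC; case: eqP => // _; by rewrite linear0r.
Qed.

Section Swap.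
Variables M N : gmod.
Let b_l (v : N) : linear (fun u : M => tpure v u).
Proof. by move=> a x y; rewrite linearPr. Qed.
Let b_r (u : M) : linear (fun v : N => tpure v u).
Proof. by move=> a x y; rewrite linearPl. Qed.
Let F : {linear tens M N -> gtens N M} := tlift (mkbil b_l b_r).
Let FE u v : F (tpure u v) = tpure v u.
Proof. exact: tlift_tpure. Qed.
Let F_deg i j u v : homog (i + j) (F (tpure (gpr M i u) (gpr N j v))).
Proof. by rewrite FE addrC; apply: homog_tpure. Qed.
Let F_sq1 u v :
  gsq1 (gtens N M) (F (tpure u v)) = F (tpure (gsq1 M u) v) + F (tpure u (gsq1 N v)).
Proof. by rewrite !FE gtens_sq1p addrC. Qed.
Let F_sq2 u v : gsq2 (gtens N M) (F (tpure u v)) =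
  F (tpure (gsq2 M u) v) + F (tpure (gsq1 M u) (gsq1 N v)) + F (tpure u (gsq2 N v)).
Proof. by rewrite !FE gtens_sq2p [LHS](AC 3 (3*2*1)). Qed.
Definition gswap : ghom (gtens M N) (gtens N M) := glift F_deg F_sq1 F_sq2.
Lemma gswapE u v : gswap (tpure u v) = tpure v u.
Proof. exact: FE. Qed.
End Swap.

Section Assoc.
Variables M N P : gmod.
Let b_l (w : P) : linear (tmap (@idfun M) (tpl N w)).
Proof. exact: linearP. Qed.
Let b_r (z : tens M N) : linear (fun w : P => tmap (@idfun M) (tpl N w) z).
Proof.
apply: linear_F2 => x y.
apply: (tens_lin_ext (g := tmap idfun (tpl N x) \+ tmap idfun (tpl N y))) => u v.
transitivity (tmap idfun (tpl N x) (tpure u v) + tmap idfun (tpl N y) (tpure u v)) => //.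
by rewrite !tmapE /= !linearDr.
Qed.
Let F : {linear tens (gtens M N) P -> gtens M (gtens N P)} := tlift (mkbil b_l b_r).
Let FE u v w : F (tpure (tpure u v) w) = tpure u (tpure v w).
Proof. by rewrite [LHS]tlift_tpure [LHS]tmapE. Qed.
Let F_deg i j z w : homog (i + j) (F (tpure (gpr (gtens M N) i z) (gpr P j w))).
Proof.
apply: (gtens_homog_ext (f := gpr (gtens M (gtens N P)) (i + j) \o
    (F \o (tpl (gtens M N) (gpr P j w) \o gpr (gtens M N) i)))
  (g := F \o (tpl (gtens M N) (gpr P j w) \o gpr (gtens M N) i))) => k l u v.
rewrite -[LHS]/(gpr (gtens M (gtens N P)) (i + j) (F (tpl _ _ (gtens_pr M N i _)))).
rewrite -[RHS]/(F (tpl _ _ (gtens_pr M N i _))) gtens_prE.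
case: eqP => [->|_]; last by rewrite !linear0.
rewrite /= FE; have := @homog_tpure M (gtens N P) k (l + j) u (tpure (gpr N l v) (gpr P j w)).
by rewrite [gpr (gtens N P) _ _]homog_tpure addrA.
Qed.
Let F_sq1 z w : gsq1 (gtens M (gtens N P)) (F (tpure z w)) =
  F (tpure (gsq1 (gtens M N) z) w) + F (tpure z (gsq1 P w)).
Proof.
apply: (tens_lin_ext (f := gsq1 (gtens M (gtens N P)) \o (F \o tpl (gtens M N) w))
  (g := (F \o (tpl (gtens M N) w \o gsq1 (gtens M N))) \+
        (F \o tpl (gtens M N) (gsq1 P w)))) => u v.
rewrite -[LHS]/(gsq1 (gtens M (gtens N P)) (F (tpure (tpure u v) w))).
rewrite -[RHS]/(F (tpure (gsq1 (gtens M N) (tpure u v)) w) + F (tpure (tpure u v) (gsq1 P w))).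
by rewrite gtens_sq1p linearDl linearD !FE !gtens_sq1p linearDr addrA.
Qed.
Let F_sq2 z w : gsq2 (gtens M (gtens N P)) (F (tpure z w)) =
  F (tpure (gsq2 (gtens M N) z) w) + F (tpure (gsq1 (gtens M N) z) (gsq1 P w))
  + F (tpure z (gsq2 P w)).
Proof.
apply: (tens_lin_ext (f := gsq2 (gtens M (gtens N P)) \o (F \o tpl (gtens M N) w))
  (g := ((F \o (tpl (gtens M N) w \o gsq2 (gtens M N))) \+
        (F \o (tpl (gtens M N) (gsq1 P w) \o gsq1 (gtens M N)))) \+
        (F \o tpl (gtens M N) (gsq2 P w)))) => u v.
rewrite -[LHS]/(gsq2 (gtens M (gtens N P)) (F (tpure (tpure u v) w))).
rewrite -[RHS]/(F (tpure (gsq2 (gtens M N) (tpure u v)) w) +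
  F (tpure (gsq1 (gtens M N) (tpure u v)) (gsq1 P w)) + F (tpure (tpure u v) (gsq2 P w))).
rewrite gtens_sq1p gtens_sq2p !linearDl !linearD !FE !(gtens_sq1p, gtens_sq2p) !linearDr.
by rewrite [LHS](AC (1*2*3) (1*2*4*(3*5)*6)).
Qed.
Definition gassoc : ghom (gtens (gtens M N) P) (gtens M (gtens N P)) :=
  glift F_deg F_sq1 F_sq2.
Lemma gassocE u v w : gassoc (tpure (tpure u v) w) = tpure u (tpure v w).
Proof. exact: FE. Qed.
End Assoc.

Lemma ghom_tens_ext (M N X : gmod) (f g : ghom (gtens M N) X) :
  (forall u v, f (tpure u v) = g (tpure u v)) -> f =1 g.
Proof. exact: tens_lin_ext. Qed.

Lemma gcompE (M N P : gmod) (g : ghom N P) (f : ghom M N) x : gcomp g f x = g (f x).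
Proof. by []. Qed.
Lemma tprE (M N : gmod) u v : @tpr _ M N u v = tpure u v.
Proof. by []. Qed.

Section GassocInv.
Variables M N P : gmod.
(** The inverse of [gassoc] as a composite of swaps and instances of [gassoc], which are already
    known to be module maps. *)
Definition gassocV : ghom (gtens M (gtens N P)) (gtens (gtens M N) P) :=
  locked (gcomp (gswap P (gtens M N)) (gcomp (gassoc P M N)
    (gcomp (gswap N (gtens P M)) (gcomp (gassoc N P M) (gswap M (gtens N P)))))).
Lemma gassocVE u v w : gassocV (tpure u (tpure v w)) = tpure (tpure u v) w.
Proof. by rewrite /gassocV -lock !gcompE !(gswapE, gassocE). Qed.

Lemma gassocVK : cancel gassocV (gassoc M N P).
Proof.
move=> z; rewrite -[RHS]/(gid _ z) -[LHS]/(gcomp (gassoc M N P) gassocV z).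
apply: ghom_tens_ext => u {}z.
apply: (tens_lin_ext (f := gcomp (gassoc M N P) gassocV \o tpr (gtens N P) u)
  (g := tpr (gtens N P) u)) => v w.
rewrite -[LHS]/(gassoc M N P (gassocV (tpure u (tpure v w)))).
by rewrite gassocVE gassocE.
Qed.

Lemma gassocK : cancel (gassoc M N P) gassocV.
Proof.
move=> z; rewrite -[RHS]/(gid _ z) -[LHS]/(gcomp gassocV (gassoc M N P) z).
apply: ghom_tens_ext => {}z w.
apply: (tens_lin_ext (f := gcomp gassocV (gassoc M N P) \o tpl (gtens M N) w)
  (g := tpl (gtens M N) w)) => u v.
rewrite -[LHS]/(gassocV (gassoc M N P (tpure (tpure u v) w))).
by rewrite gassocE gassocVE.
Qed.
End GassocInv.

Lemma gswapK M N : cancel (gswap M N) (gswap N M).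
Proof.
move=> z; rewrite -[RHS]/(gid _ z) -[LHS]/(gcomp (gswap N M) (gswap M N) z).
by apply: ghom_tens_ext => u v; rewrite gcompE !gswapE.
Qed.

Lemma gunitE (M : gmod) (a : gF) (v : M) : gunit M (tpure a v) = (a : 'F_2) *: v.
Proof. exact: tlift_tpure. Qed.

Lemma connectingE (L A : gmod) (phi : ghom L gF) l a :
  connecting A phi (tpure l a) = (phi l : 'F_2) *: a.
Proof.
rewrite -[LHS]/(gunit A (gtens_hom phi (gid A) (tpure l a))).
by rewrite [gtens_hom _ _ _]tmapE gunitE.
Qed.

Section UnitInv.
Variable M : gmod.
Let o : gF := (1 : 'F_2).
Let pr n v : tpr M o (gpr M n v) = gpr (gtens gF M) n (tpr M o v).
Proof. by rewrite !tprE (@gpr_tpurel _ _ _ 0) ?subr0 // /homog /= scale1r. Qed.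
Let sq1 v : tpr M o (gsq1 M v) = gsq1 (gtens gF M) (tpr M o v).
Proof. by rewrite !tprE gtens_sq1p linear0l add0r. Qed.
Let sq2 v : tpr M o (gsq2 M v) = gsq2 (gtens gF M) (tpr M o v).
Proof. by rewrite !tprE gtens_sq2p !linear0l !add0r. Qed.
Definition gunitV : ghom M (gtens gF M) := @Ghom M (gtens gF M) (tpr M o) pr sq1 sq2.
Lemma gunitVK : cancel gunitV (gunit M).
Proof. by move=> v; rewrite [LHS]gunitE scale1r. Qed.
Lemma gunitK : cancel (gunit M) gunitV.
Proof.
move=> z; rewrite -[RHS]/(gid _ z) -[LHS]/(gcomp gunitV (gunit M) z).
apply: ghom_tens_ext => a v; rewrite gcompE gunitE -[LHS]/(tpure o _).
by rewrite linearZr_LR -linearZl_LR -[_ *: o]/((a : 'F_2) * 1) mulr1.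
Qed.
End UnitInv.

Section AddHom.
Variables (M N : gmod) (f g : ghom M N).
Let pr n x : (f \+ g) (gpr M n x) = gpr N n ((f \+ g) x).
Proof. by rewrite /= !ghom_pr linearD. Qed.
Let sq1 x : (f \+ g) (gsq1 M x) = gsq1 N ((f \+ g) x).
Proof. by rewrite /= !ghom_sq1 linearD. Qed.
Let sq2 x : (f \+ g) (gsq2 M x) = gsq2 N ((f \+ g) x).
Proof. by rewrite /= !ghom_sq2 linearD. Qed.
Definition gadd : ghom M N := @Ghom M N (f \+ g) pr sq1 sq2.
End AddHom.

Section Factor.
Variables (M N K : gmod) (i : ghom K N) (f : M -> K).
Hypothesis i_inj : injective i.
Variable g : ghom M N.
Hypothesis fE : forall x, i (f x) = g x.
Let f_lin : linear f.
Proof. by apply: linear_F2 => x y; apply: i_inj; rewrite linearD !fE linearD. Qed.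
Let F := mklin f_lin.
Let pr n x : F (gpr M n x) = gpr K n (F x).
Proof. by apply: i_inj; rewrite ghom_pr /= !fE ghom_pr. Qed.
Let sq1 x : F (gsq1 M x) = gsq1 K (F x).
Proof. by apply: i_inj; rewrite ghom_sq1 /= !fE ghom_sq1. Qed.
Let sq2 x : F (gsq2 M x) = gsq2 K (F x).
Proof. by apply: i_inj; rewrite ghom_sq2 /= !fE ghom_sq2. Qed.
(** [f] is a bare function, typically produced by choice; injectivity of [i] forces it to be a
    module map. *)
Definition gfactor : ghom M K := @Ghom M K F pr sq1 sq2.
End Factor.

Lemma ghom_factor (M N K : gmod) (i : ghom K N) (g : ghom M N) :
  injective i -> (forall x, exists k, i k = g x) ->
  exists f : ghom M K, forall x, i (f x) = g x.
Proof.
move=> i_inj h; have [f fE] := choice h.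
by exists (gfactor i_inj fE) => x; apply: fE.
Qed.

Lemma ghom_inv (M N : gmod) (f : ghom M N) : bijective f ->
  exists g : ghom N M, cancel f g /\ cancel g f.
Proof.
move=> [g fK gK]; exists (gfactor (can_inj fK) (g := gid N) gK).
by split=> x; [apply: fK | apply: gK].
Qed.

Section KerIncl.
Variables (M N : gmod) (f : ghom M N).
Let i_lin : linear (fun x : gker f => val x).
Proof. by []. Qed.
Definition gker_incl : ghom (gker f) M :=
  @Ghom (gker f) M (mklin i_lin) (fun _ _ => erefl) (fun=> erefl) (fun=> erefl).
Lemma gker_incl_inj : injective gker_incl.
Proof. exact: val_inj. Qed.
Lemma gker_inclP x : f (gker_incl x) = 0.
Proof. by apply/eqP; case: x. Qed.
Lemma gker_inclE x : f x = 0 -> exists k, gker_incl k = x.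
Proof.
move/eqP => fx.
have fx' : x \in gsub_pred (Gsub (gker_submod f) (@gker_pr _ _ f)
  (@gker_sq1 _ _ f) (@gker_sq2 _ _ f)) by exact: fx.
by exists (GsubCar fx').
Qed.
Lemma gker_factor (X : gmod) (g : ghom X M) : (forall x, f (g x) = 0) ->
  exists h : ghom X (gker f), forall x, gker_incl (h x) = g x.
Proof. by move=> h; apply: (ghom_factor gker_incl_inj) => x; apply: gker_inclE. Qed.
End KerIncl.

Section ShiftHom.
Variables (d : int) (M N : gmod).
Definition gshift_hom (f : ghom M N) : ghom (gshift d M) (gshift d N) :=
  @Ghom (gshift d M) (gshift d N) f (fun n => @ghom_pr _ _ f (n - d))
    (@ghom_sq1 _ _ f) (@ghom_sq2 _ _ f).

Lemma gtens_shiftl_pr n z :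
  gpr (gtens (gshift d M) N) n z = gpr (gtens M N) (n - d) z.
Proof.
apply: (gtens_homog_ext (M := gshift d M) (f := gpr (gtens (gshift d M) N) n)
  (g := gpr (gtens M N) (n - d))) => i j u v.
rewrite [LHS]gtens_prE [RHS]gtens_prE.
by rewrite subr_eq [i - d + j]addrAC subrK.
Qed.
Lemma gtens_shiftr_pr n z :
  gpr (gtens M (gshift d N)) n z = gpr (gtens M N) (n - d) z.
Proof.
apply: (gtens_homog_ext (N := gshift d N) (f := gpr (gtens M (gshift d N)) n)
  (g := gpr (gtens M N) (n - d))) => i j u v.
rewrite [LHS]gtens_prE [RHS]gtens_prE.
by rewrite subr_eq addrA subrK.
Qed.
End ShiftHom.

(** * Projectives and stable retracts *)

Lemma gproj_A1 : gproj A1.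
Proof. by exists A1_t; split; [apply: A1_t_deg | apply: A1_trace]. Qed.

Lemma gproj_shift d P : gproj P -> gproj (gshift d P).
Proof.
move=> [h [hd hid]]; exists (h : {linear gshift d P -> gshift d P}).
by split=> [n x|]; [rewrite /= hd addrAC | apply: hid].
Qed.

Section Counit.
Variable N : gmod.
Lemma A1_aug_one : A1_aug A1_one = 1 :> 'F_2.
Proof. by rewrite /= mxE. Qed.

Lemma homog_one : homog 0 A1_one.
Proof.
have -> : A1_one = E 0 by rewrite E.unlock.
by rewrite /homog E_pr // eqxx scale1r.
Qed.

Lemma connecting_aug_one (x : N) : connecting N A1_aug (tpure A1_one x) = x.
Proof. by rewrite connectingE A1_aug_one scale1r. Qed.

Lemma hdeg_tpr_one : @hdeg N (gtens A1 N) 0 (tpr N A1_one).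
Proof.
by move=> n x; rewrite !tprE addr0 (gpr_tpurel _ _ homog_one) subr0.
Qed.
End Counit.

(** A projective P is a retract of A(1) (x) P through the augmentation, and A(1) (x) P inherits its
    trace from A(1). *)
Lemma gprojective_gproj P : gprojective P -> gproj P.
Proof.
move=> hP.
have [s hs] := hP _ _ (connecting P A1_aug) (gid P)
  (fun y => ex_intro _ _ (connecting_aug_one y)).
apply: eq_null (null_compl (connecting P A1_aug)
  (null_compr s (gproj_tensl P gproj_A1))) => x.
exact: hs.
Qed.

(** If f = trace h then f factors through A(1) (x) N: the trace of x |-> 1 (x) h x is a module map,
    and the augmentation sends it to trace h. *)
Lemma stably_zeroP M N (f : ghom M N) : stably_zero f <-> null f.
Proof.
split=> [[P [u [v [hP fE]]]]|[h [hd hf]]].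
  apply: eq_null (null_compl v (null_compr u (gprojective_gproj hP))) => x.
  by rewrite fE.
pose k : {linear M -> gtens A1 N} := tpr N A1_one \o h.
have kd : hdeg (-6) k by apply: hdeg_comp hd; apply: hdeg_tpr_one.
exists (gtens A1 N), (trace_hom kd), (connecting N A1_aug); split.
  exact/gproj_gprojective/gproj_tensl/gproj_A1.
have e : connecting N A1_aug \o k =1 h by move=> y; apply: connecting_aug_one.
by move=> x; rewrite -hf -(eq_trace e) trace_compl.
Qed.

Lemma stably_eqP M N (f g : ghom M N) :
  stably_eq f g <-> null (fun x => f x + g x).
Proof.
have e : stably_eq f g <-> stably_zero (gadd f g).
  by split=> -[P [u [v [hP fE]]]]; exists P, u, v; split=> // x;
    rewrite -fE /= opp2.
by rewrite e stably_zeroP.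
Qed.

Lemma null_tensr X M N (f : ghom M N) : null f -> null (gtens_hom (gid X) f).
Proof.
move=> hf; apply: eq_null (null_compl (gswap N X)
  (null_compr (gswap X M) (null_tensl X hf))).
apply: (ghom_tens_ext (f := gcomp (gswap N X) (gcomp (gtens_hom f (gid X)) (gswap X M)))).
by move=> u v; rewrite !gcompE gswapE [gtens_hom f _ _]tmapE gswapE [RHS]tmapE.
Qed.

(* [M] is a stable retract of [N]: in characteristic 2 the function below is
   the difference of [g \o f] and the identity. *)
Definition sret (M N : gmod) : Prop :=
  exists (f : ghom M N) (g : ghom N M), null (fun x => g (f x) + x).

Lemma null0 (M N : gmod) : null (fun _ : M => 0 : N).
Proof.
exists \0; split=> [n x|x]; first by rewrite /= linear0.
by apply: d2_0; apply: d2_0; apply: d2_0.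
Qed.

Lemma ret_sret M N (f : ghom M N) (g : ghom N M) : cancel f g -> sret M N.
Proof.
move=> fK; exists f, g; apply: eq_null (null0 M M) => x.
by rewrite fK char2.
Qed.

Lemma sret_trans M N P : sret M N -> sret N P -> sret M P.
Proof.
move=> [f [g h]] [f' [g' h']]; exists (gcomp f' f), (gcomp g g').
apply: eq_null (null_add (null_compl g (null_compr f h')) h) => x.
by rewrite !gcompE /= linearD -addrA [X in _ + X]addrA char2 add0r.
Qed.

Lemma sret_tensr X M N : sret M N -> sret (gtens X M) (gtens X N).
Proof.
move=> [f [g h]]; exists (gtens_hom (gid X) f), (gtens_hom (gid X) g).
have {}h : null (gadd (gcomp g f) (gid M)) by exact: h.
apply: eq_null (null_tensr X h).
apply: (ghom_tens_ext (g := gadd (gcomp (gtens_hom (gid X) g) (gtens_hom (gid X) f)) (gid _))).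
move=> u v; rewrite [LHS]tmapE -[RHS]/(gtens_hom (gid X) g (gtens_hom (gid X) f (tpure u v)) + _).
by rewrite [gtens_hom _ f _]tmapE [gtens_hom _ g _]tmapE linearDr.
Qed.

Lemma sret_tensl X M N : sret M N -> sret (gtens M X) (gtens N X).
Proof.
move=> h; apply: sret_trans (ret_sret (@gswapK M X)) _.
by apply: sret_trans (sret_tensr X h) (ret_sret (@gswapK X N)).
Qed.

(** Meant for modules with the same carrier whose gradings agree only up to integer arithmetic, such
    as iterated shifts. *)
Lemma sret_same (M N : gmod) (u : {linear M -> N}) (v : {linear N -> M}) :
  cancel u v -> cancel v u -> (forall n x, u (gpr M n x) = gpr N n (u x)) ->
  (forall x, u (gsq1 M x) = gsq1 N (u x)) ->
  (forall x, u (gsq2 M x) = gsq2 N (u x)) -> sret M N.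
Proof.
move=> uK vK hpr h1 h2; pose f := @Ghom M N u hpr h1 h2.
apply: (@ret_sret M N f (gfactor (can_inj uK : injective f) (g := gid N) vK)).
exact: uK.
Qed.

Lemma sret_shift0 d M : d = 0 -> sret (gshift d M) M.
Proof.
move=> ->; apply: (@sret_same (gshift 0 M) M idfun idfun) => // n x.
by rewrite /= subr0.
Qed.

Lemma sret_shiftD d e d' M : d = e + d' -> sret (gshift d M) (gshift e (gshift d' M)).
Proof.
move=> ->; apply: (@sret_same (gshift (e + d') M) (gshift e (gshift d' M)) idfun idfun) => // n x.
by rewrite /= opprD addrA.
Qed.

Lemma sret_tens_shift d M N :
  sret (gtens M (gshift d N)) (gtens (gshift d M) N).
Proof.
apply: (@sret_same (gtens M (gshift d N)) (gtens (gshift d M) N) idfun idfun) => // n x.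
exact: (etrans (@gtens_shiftr_pr d M N n x) (esym (@gtens_shiftl_pr d M N n x))).
Qed.

(* Omega Sigma^{-1} F *)
Definition AugI : gmod := gshift (-1) OmegaF.

Lemma sret_OmegaDesusp n X :
  sret (gtens (gtpow OmegaF n.+1) (gshift (- n.+1%:Z) X))
       (gtens AugI (gtens (gtpow OmegaF n) (gshift (- n%:Z) X))).
Proof.
apply: sret_trans (ret_sret (@gassocK _ _ _)) _.
apply: sret_trans (@sret_tens_shift (-1) OmegaF _).
apply: sret_tensr.
apply: (@sret_trans _ (gtens (gtpow OmegaF n) (gshift (-1) (gshift (- n%:Z) X)))).
  by apply/sret_tensr/sret_shiftD; rewrite -opprD -PoszD add1n.
rewrite -/gtpow; set A := gtpow _ _; set Y := gshift _ X.
apply: (@sret_same (gtens A (gshift (-1) Y)) (gshift (-1) (gtens A Y)) idfun idfun) => // m x.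
exact: (@gtens_shiftr_pr (-1) A Y m x).
Qed.

Lemma sret_OmegaDesusp0 X : sret (gtens (gtpow OmegaF 0) (gshift (- 0%:Z) X)) X.
Proof.
apply: sret_trans (ret_sret (@gunitK _)) _.
by apply: sret_shift0.
Qed.

(** * The modules Omega Sigma^{-1} F and Omega Sigma^{-1} J *)

Section JokerCover.
Let Q := gspan (gsq1 A1 (gsq2 A1 A1_one)).
Let M := gshift (- 3) A1.
Let N := gshift (- 1) Joker.
Let F : {linear M -> N} := mklin (@gquot_pi_linear A1 Q).
Let pr n x : F (gpr M n x) = gpr N n (F x).
Proof.
rewrite -[RHS]/(gquot_ind_fun (gpr A1 (n - -1 - -2)) (gquot_pi Q x)).
by rewrite (gquot_ind_pi (@gsub_pr _ Q _)) -addrA.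
Qed.
Let sq1 x : F (gsq1 M x) = gsq1 N (F x).
Proof. exact: (esym (gquot_ind_pi (@gsub_sq1 _ Q) _)). Qed.
Let sq2 x : F (gsq2 M x) = gsq2 N (F x).
Proof. exact: (esym (gquot_ind_pi (@gsub_sq2 _ Q) _)). Qed.

Definition Joker_pi : ghom (gshift (- 3) A1) (gshift (- 1) Joker) :=
  @Ghom M N F pr sq1 sq2.

Lemma Joker_pi_surj y : exists x, Joker_pi x = y.
Proof. by exists (repr (y : gquot_car Q)); apply: gquot_reprK. Qed.

(** The left ideal A(1) Sq^1 Sq^2 is spanned by [E 3], [E 6] = Sq^2 [E 3] and [E 7] = Sq^1 [E 6];
    the five coordinates are the remaining ones. *)
Lemma Joker_pi_eq0 x : Joker_pi x = 0 <->
  [/\ co 0 x = 0, co 1 x = 0, co 2 x = 0, co 4 x = 0 & co 5 x = 0].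
Proof.
have h (y : A1) : gquot_pi Q y = gquot_pi Q 0 <-> y \in gsub_pred Q.
  by rewrite -{2}[y]subr0; split=> [e|e]; apply/gquot_piP.
have {h} -> : Joker_pi x = 0 <-> (x : A1) \in gsub_pred Q.
  by rewrite -h -(linear0 Joker_pi).
have e3 : gsq1 A1 (gsq2 A1 A1_one) = E 3 by rewrite E.unlock.
split.
  pose S : {pred A1} := [pred x : A1 | [&& co 0 x == 0, co 1 x == 0, co 2 x == 0,
    co 4 x == 0 & co 5 x == 0]].
  have SP (z : A1) : (z \in S) = [&& co 0 z == 0, co 1 z == 0, co 2 z == 0,
    co 4 z == 0 & co 5 z == 0] by [].
  have Ssub : submod_closed S.
    split=> [|a y z]; rewrite !SP ?linear0 //.
    move=> /and5P[/eqP a0 /eqP a1 /eqP a2 /eqP a4 /eqP a5].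
    move=> /and5P[/eqP b0 /eqP b1 /eqP b2 /eqP b4 /eqP b5].
    by rewrite !linearP a0 a1 a2 a4 a5 b0 b1 b2 b4 b5 !scaler0 !addr0.
  have Spr n z : z \in S -> gpr A1 n z \in S.
    rewrite !SP => /and5P[/eqP a0 /eqP a1 /eqP a2 /eqP a4 /eqP a5].
    by rewrite !co_pr // a0 a1 a2 a4 a5 !mulr0.
  have Ssq1 z : z \in S -> gsq1 A1 z \in S.
    rewrite !SP => /and5P[/eqP a0 /eqP a1 /eqP a2 /eqP a4 /eqP a5].
    by rewrite !co_sq1 a0 a4.
  have Ssq2 z : z \in S -> gsq2 A1 z \in S.
    rewrite !SP => /and5P[/eqP a0 /eqP a1 /eqP a2 /eqP a4 /eqP a5].
    by rewrite !co_sq2 a0 a1 a2.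
  rewrite inE => xQ.
  have := xQ (Gsub Ssub Spr Ssq1 Ssq2); rewrite e3.
  have -> : E 3 \in S by rewrite SP !coE.
  move=> /(_ isT); rewrite SP => /and5P[/eqP a0 /eqP a1 /eqP a2 /eqP a4 /eqP a5].
  by split.
move=> [a0 a1 a2 a4 a5].
have Q3 : E 3 \in gsub_pred Q by rewrite -e3 inE.
have Q6 : E 6 \in gsub_pred Q by rewrite -sq2_E; apply: gsub_sq2.
have Q7 : E 7 \in gsub_pred Q by rewrite -sq1_E; apply: gsub_sq1.
have -> : x = (co 3 x : 'F_2) *: E 3 + (co 6 x : 'F_2) *: E 6 + (co 7 x : 'F_2) *: E 7.
  apply: A1_coP; apply: forall8; rewrite !linearD !linearZ ?(a0, a1, a2, a4, a5);
  by rewrite !coE //= ?scaler0 ?addr0 ?add0r // -[RHS]/(_ * 1) mulr1.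
by rewrite !rpredD // rpredZ.
Qed.
End JokerCover.

(* The "question mark" Omega Sigma^{-1} J, with basis [E 3], [E 6] = Sq^2 [E 3],
   [E 7] = Sq^3 [E 3] in degrees 0, 2, 3. *)
Definition QMark : gmod := gker Joker_pi.

Definition AugI_incl : ghom AugI (gshift (-1) A1) := gshift_hom (-1) (gker_incl A1_aug).
Definition QMark_incl : ghom QMark (gshift (-3) A1) := gker_incl Joker_pi.

Lemma AugI_incl_inj : injective AugI_incl.
Proof. exact: gker_incl_inj. Qed.
Lemma QMark_incl_inj : injective QMark_incl.
Proof. exact: gker_incl_inj. Qed.

Definition cI (j : nat) : {linear AugI -> gF} := co j \o AugI_incl.
Definition cB (j : nat) : {linear QMark -> gF} := co j \o QMark_incl.

Lemma co0_aug x : A1_aug x = co 0 x.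
Proof. by rewrite /=; congr (x _ _); apply/val_inj; rewrite /= inordK. Qed.

Lemma cI0 x : cI 0 x = 0.
Proof. by rewrite -[LHS]co0_aug; apply: gker_inclP. Qed.

Lemma AugI_mk (x : A1) : co 0 x = 0 -> exists k, AugI_incl k = x.
Proof. by rewrite -co0_aug; apply: gker_inclE. Qed.

Lemma cB0 x : (cB 0 x = 0) * (cB 1 x = 0) * (cB 2 x = 0) * (cB 4 x = 0) * (cB 5 x = 0).
Proof. by have /Joker_pi_eq0[a b c d e] := gker_inclP (f := Joker_pi) x. Qed.

Lemma QMark_mk (x : A1) : [/\ co 0 x = 0, co 1 x = 0, co 2 x = 0, co 4 x = 0
  & co 5 x = 0] -> exists k, QMark_incl k = x.
Proof. by move/Joker_pi_eq0/gker_inclE. Qed.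

Lemma cIZ j (a : 'F_2) x : cI j (a *: x) = (a * cI j x : 'F_2).
Proof. exact: linearZ. Qed.
Lemma cBZ j (a : 'F_2) x : cB j (a *: x) = (a * cB j x : 'F_2).
Proof. exact: linearZ. Qed.

Lemma cI_ext x y : (forall j, (j < 8)%N -> cI j x = cI j y) -> x = y.
Proof. by move=> h; apply: AugI_incl_inj; apply: A1_coP. Qed.
Lemma cB_ext x y : (forall j, (j < 8)%N -> cB j x = cB j y) -> x = y.
Proof. by move=> h; apply: QMark_incl_inj; apply: A1_coP. Qed.

Lemma cI_sq1 x : (cI 1 (gsq1 _ x) = 0) * (cI 2 (gsq1 _ x) = 0) *
  (cI 3 (gsq1 _ x) = cI 2 x) * (cI 4 (gsq1 _ x) = 0) * (cI 5 (gsq1 _ x) = cI 4 x) *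
  (cI 6 (gsq1 _ x) = 0) * (cI 7 (gsq1 _ x) = cI 6 x).
Proof.
have h j : cI j (gsq1 AugI x) = co j (gsq1 A1 (AugI_incl x)) by [].
by rewrite !h !co_sq1 -[co 0 _]/(cI 0 x) cI0.
Qed.
Lemma cI_sq2 x : (cI 1 (gsq2 _ x) = 0) * (cI 2 (gsq2 _ x) = 0) *
  (cI 3 (gsq2 _ x) = 0) * (cI 4 (gsq2 _ x) = cI 1 x) * (cI 5 (gsq2 _ x) = cI 2 x) *
  (cI 6 (gsq2 _ x) = cI 3 x) * (cI 7 (gsq2 _ x) = cI 5 x).
Proof.
have h j : cI j (gsq2 AugI x) = co j (gsq2 A1 (AugI_incl x)) by [].
by rewrite !h !co_sq2 -[co 0 _]/(cI 0 x) cI0.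
Qed.
Lemma cB_sq1 x : (cB 3 (gsq1 _ x) = 0) * (cB 6 (gsq1 _ x) = 0) *
  (cB 7 (gsq1 _ x) = cB 6 x).
Proof.
have h j : cB j (gsq1 QMark x) = co j (gsq1 A1 (QMark_incl x)) by [].
by rewrite !h !co_sq1 -[co 2 _]/(cB 2 x) cB0.
Qed.
Lemma cB_sq2 x : (cB 3 (gsq2 _ x) = 0) * (cB 6 (gsq2 _ x) = cB 3 x) *
  (cB 7 (gsq2 _ x) = 0).
Proof.
have h j : cB j (gsq2 QMark x) = co j (gsq2 A1 (QMark_incl x)) by [].
by rewrite !h !co_sq2 -[co 5 _]/(cB 5 x) cB0.
Qed.
Lemma cI_pr j n x : (j < 8)%N -> cI j (gpr AugI n x) = (n + 1 == edeg j)%:R * cI j x.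
Proof. exact: (@co_pr j (n - -1)). Qed.
Lemma cB_pr j n x : (j < 8)%N -> cB j (gpr QMark n x) = (n + 3 == edeg j)%:R * cB j x.
Proof. exact: (@co_pr j (n - -3)). Qed.

Section Bottom.

Let ex_p : exists k : AugI, AugI_incl k = E 1.
Proof. by apply: AugI_mk; rewrite coE. Qed.
Let ex_q : exists k : AugI, AugI_incl k = E 2.
Proof. by apply: AugI_mk; rewrite coE. Qed.
Let ex_b : exists k : QMark, QMark_incl k = E 3.
Proof. by apply: QMark_mk; rewrite !coE. Qed.

Definition pI : AugI := projT1 (cid ex_p).
Definition qI : AugI := projT1 (cid ex_q).
Definition pB : QMark := projT1 (cid ex_b).
Lemma cI_p j : (j < 8)%N -> cI j pI = (1%N == j)%:R.
Proof. by move=> j8; rewrite -coE // /pI; case: cid => k /= <-. Qed.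
Lemma cI_q j : (j < 8)%N -> cI j qI = (2%N == j)%:R.
Proof. by move=> j8; rewrite -coE // /qI; case: cid => k /= <-. Qed.
Lemma cB_p j : (j < 8)%N -> cB j pB = (3%N == j)%:R.
Proof. by move=> j8; rewrite -coE // /pB; case: cid => k /= <-. Qed.
End Bottom.

Lemma hI_pr n x : cI 1 (gpr _ n x) = gpr gF n (cI 1 x).
Proof.
rewrite cI_pr //; congr ((_ : bool)%:R * _).
by rewrite -[edeg 1]/1%N; lia.
Qed.
Definition hI : ghom AugI gF :=
  @Ghom AugI gF (cI 1) hI_pr (fun x => (cI_sq1 x).1.1.1.1.1.1) (fun x => (cI_sq2 x).1.1.1.1.1.1).
Lemma hB_pr n x : cB 3 (gpr _ n x) = gpr gF n (cB 3 x).
Proof.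
rewrite cB_pr //; congr ((_ : bool)%:R * _).
by rewrite -[edeg 3]/3%N; lia.
Qed.
Definition hB : ghom QMark gF :=
  @Ghom QMark gF (cB 3) hB_pr (fun x => (cB_sq1 x).1.1) (fun x => (cB_sq2 x).1.1).

(** * Connective modules with one-dimensional bottom degree *)

Definition connective (X : gmod) := forall n x, n < 0 -> gpr X n x = 0.

(** These properties pass to tensor products, and they make every map from X to F a multiple of y,
    determined by its value at u. *)
Definition bottom (X : gmod) (y : ghom X gF) (u : X) : Prop :=
  [/\ connective X, forall x, gpr X 0 x = (y x : 'F_2) *: u, y u = 1 :> 'F_2
    & gsq1 X u = 0].

Lemma bottomI : bottom hI pI.
Proof.
split=> [n x n0|x||].
- apply: cI_ext; apply: forall8; rewrite cI_pr // linear0 ?cI0 ?mulr0 //;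
  by case: n n0 => [//|[|n]] _; rewrite mul0r.
- apply: cI_ext; apply: forall8; rewrite cI_pr // cIZ ?cI0 ?mulr0 //;
  by rewrite cI_p //= ?mul0r ?mulr0 // mul1r mulr1.
- by rewrite [LHS]cI_p.
- by apply: cI_ext; apply: forall8; rewrite ?cI0 // linear0 cI_sq1 ?cI_p.
Qed.
Lemma bottomB : bottom hB pB.
Proof.
split=> [n x n0|x||].
- apply: cB_ext; apply: forall8; rewrite cB_pr // linear0 ?cB0 ?mulr0 //;
  by case: n n0 => [//|[|[|[|n]]]] _; rewrite mul0r.
- apply: cB_ext; apply: forall8; rewrite cB_pr // cBZ ?cB0 ?mulr0 //;
  by rewrite cB_p //= ?mul0r ?mulr0 // mul1r mulr1.
- by rewrite [LHS]cB_p.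
- by apply: cB_ext; apply: forall8; rewrite ?cB0 // linear0 cB_sq1 ?cB_p.
Qed.

Lemma gpr1I x : gpr AugI 1 x = (cI 2 x : 'F_2) *: qI.
Proof.
apply: cI_ext; apply: forall8; rewrite cI_pr // cIZ ?cI0 ?mulr0 //;
by rewrite cI_q //= ?mul0r ?mulr0 // mul1r mulr1.
Qed.
Lemma gpr1B x : gpr QMark 1 x = 0.
Proof.
by apply: cB_ext; apply: forall8; rewrite cB_pr // linear0 ?cB0 ?mulr0 // mul0r.
Qed.

Lemma bottomF : bottom (gid gF) (1 : 'F_2).
Proof.
split=> [n x|x||] //=; rewrite ?scale1r ?mulr1 //; last first.
  by rewrite -[RHS]/(_ * 1) mulr1.
by rewrite lt_def => /andP[/negbTE]; rewrite eq_sym => -> _; rewrite scale0r.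
Qed.

Lemma tpureZl (X Y : gmod) (a : 'F_2) (u : X) (v : Y) :
  tpure (a *: u) v = a *: (tpure u v : gtens X Y).
Proof. by rewrite linearZl_LR. Qed.

Section Connective.
Variables X Y : gmod.
Hypotheses (cX : connective X) (cY : connective Y).

Lemma connective_ext (W : lmodType 'F_2) (f g : {linear gtens X Y -> W}) :
  (forall i j u v, 0 <= i -> 0 <= j ->
     f (tpure (gpr X i u) (gpr Y j v)) = g (tpure (gpr X i u) (gpr Y j v))) -> f =1 g.
Proof.
move=> h; apply: gtens_homog_ext => i j u v.
have [i0|i0] := ltP i 0; first by rewrite (cX _ i0) linear0l !linear0.
have [j0|j0] := ltP j 0; first by rewrite (cY _ j0) linear0r !linear0.
exact: h.
Qed.

Lemma connective_tens : connective (gtens X Y).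
Proof.
move=> n z n0; move: z; apply: (connective_ext (f := gpr (gtens X Y) n) (g := \0)).
move=> i j u v i0 j0; rewrite [LHS]gtens_prE.
by have -> : (n == i + j) = false by lia.
Qed.

Lemma connective_pr0 z : gpr (gtens X Y) 0 z = tmap (gpr X 0) (gpr Y 0) z.
Proof.
move: z; apply: (connective_ext (f := gpr (gtens X Y) 0)
  (g := tmap (gpr X 0) (gpr Y 0))) => i j u v i0 j0.
rewrite [LHS]gtens_prE [RHS]tmapE !gpr_pr.
have -> : (0 == i + j) = (0 == i) && (0 == j) by lia.
by do 2!case: eqP => _; rewrite ?linear0l ?linear0r.
Qed.

Lemma connective_pr1 z : gpr (gtens X Y) 1 z =
  tmap (gpr X 0) (gpr Y 1) z + tmap (gpr X 1) (gpr Y 0) z.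
Proof.
move: z; apply: (connective_ext (f := gpr (gtens X Y) 1)
  (g := tmap (gpr X 0) (gpr Y 1) \+ tmap (gpr X 1) (gpr Y 0))) => i j u v i0 j0.
rewrite [LHS]gtens_prE -[RHS]/(tmap (gpr X 0) (gpr Y 1) _ + tmap (gpr X 1) (gpr Y 0) _).
rewrite !tmapE !gpr_pr.
have -> : (1 == i + j) = (0 == i) && (1 == j) || (1 == i) && (0 == j) by lia.
case: (eqVneq 0 i) => [<-|_]; rewrite ?linear0l /= ?add0r ?linear0l ?addr0.
  by case: eqP; rewrite ?linear0r.
by case: eqP; rewrite ?linear0l //; case: eqP; rewrite ?linear0r.
Qed.

Definition ymul (y : ghom X gF) (y' : ghom Y gF) : ghom (gtens X Y) gF :=
  gcomp y' (connecting Y y).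
Lemma ymulE y y' u v : ymul y y' (tpure u v) = (y u : 'F_2) * y' v :> 'F_2.
Proof. by rewrite gcompE connectingE linearZ. Qed.

Lemma bottom_tens (y : ghom X gF) (y' : ghom Y gF) u u' : bottom y u -> bottom y' u' ->
  bottom (ymul y y') (tpure u u' : gtens X Y).
Proof.
move=> [_ yu y1 u1] [_ yu' y1' u1']; split.
- exact: connective_tens.
- move=> z; rewrite connective_pr0.
  have l : linear (fun z : gtens X Y => (ymul y y' z : 'F_2) *: (tpure u u' : gtens X Y)).
    by move=> a v w; rewrite linearP scalerDl -scalerA.
  move: z; apply: (tens_lin_ext (g := mklin l)) => v w.
  rewrite tmapE yu yu' linearZl_LR linearZr_LR -[RHS]/((ymul y y' (tpure v w) : 'F_2) *: _).
  rewrite ymulE -[LHS]/((y v : 'F_2) *: ((y' w : 'F_2) *: (tpure u u' : gtens X Y))).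
  by rewrite scalerA.
- by rewrite ymulE y1 y1' mulr1.
- by rewrite gtens_sq1p u1 u1' linear0l linear0r addr0.
Qed.
End Connective.

(* Sufficient conditions for degree-1 functionals to extend along Sq^1 and
   Sq^2; [ext12 X] says that maps from AugI (x) X to Sigma F extend to
   Sigma^{-1} A(1) (x) X. *)
Definition in_deg (X : gmod) (k : int) (a : {linear X -> gF}) := forall x, a (gpr X k x) = a x.
Definition ext1 (X : gmod) : Prop := forall a : {linear X -> gF},
  in_deg 1 a -> (forall x, a (gsq1 X x) = 0) ->
  exists t : {linear X -> gF}, [/\ in_deg 2 t, forall x, t (gsq1 X x) = a x
    & forall x, t (gsq2 X x) = 0].
Definition ext12 (X : gmod) : Prop := forall a b : {linear X -> gF},
  in_deg 1 a -> in_deg 0 b -> (forall x, a (gsq1 X x) = 0) ->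
  exists t : {linear X -> gF}, [/\ in_deg 2 t, forall x, t (gsq1 X x) = a x
    & forall x, t (gsq2 X x) = b x].

Lemma ext12_ext1 X : ext12 X -> ext1 X.
Proof.
move=> h a a1 asq; apply: (h a \0) => // x; by [].
Qed.

(** Start of the induction over tensor factors. The trivial module does not satisfy [ext12], since
    Sq^2 = 0 on it while [b] may be the identity; this is why the weaker [ext1] is carried along. *)
Lemma ext1F : ext1 gF.
Proof.
move=> a a1 _; exists \0; split=> // x.
by rewrite -a1 /= scale0r linear0.
Qed.

Definition fmul (X Y : gmod) (f : {linear X -> gF}) (g : {linear Y -> gF}) :
  {linear gtens X Y -> gF} := gunit gF \o tmap f g.
Lemma fmulE X Y f g u v : @fmul X Y f g (tpure u v) = (f u : 'F_2) * g v :> 'F_2.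
Proof. by rewrite -[LHS]/(gunit gF (tmap f g _)) tmapE gunitE. Qed.

Lemma in_deg_fmul X Y (i j k : int) f g : in_deg i f -> in_deg j g -> k = i + j ->
  in_deg k (@fmul X Y f g).
Proof.
move=> fi gj ->.
apply: (gtens_homog_ext (f := fmul f g \o gpr (gtens X Y) (i + j))) => m n u v.
rewrite -[LHS]/(fmul f g (gtens_pr X Y _ _)) gtens_prE.
case: eqP => // ne; rewrite linear0 fmulE -fi -gj !gpr_pr.
case: eqP => [e|_]; last by rewrite linear0 mul0r.
case: eqP => [e'|_]; last by rewrite linear0 mulr0.
by case: ne; rewrite e e'.
Qed.

Lemma in_deg_add (X : gmod) k (f g : {linear X -> gF}) : in_deg k f -> in_deg k g -> in_deg k (f \+ g).
Proof. by move=> fk gk x; rewrite /= fk gk. Qed.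

Lemma in_deg_part (X : gmod) k (f : {linear X -> gF}) : in_deg k (f \o gpr X k).
Proof. by move=> x; rewrite -[LHS]/(f (gpr X k (gpr X k x))) gpr_pr eqxx. Qed.

Lemma ext12I X : connective X -> ext1 X -> ext12 (gtens AugI X).
Proof.
move=> cX hX a b a1 b0 asq.
have [] := hX ((a \o tpr X pI) \o gpr X 1).
- exact: in_deg_part.
- move=> x.
  have [_ _ _ p1] := bottomI.
  have := asq (tpure pI (gpr X 0 x)); rewrite gtens_sq1p p1 linear0l add0r.
  by rewrite gsq1_pr.
move=> t [t2 t_sq1 t_sq2].
pose k : {linear X -> gF} := (a \o tpr X qI) \o gpr X 0.
pose l : {linear X -> gF} := (b \o tpr X pI) \o gpr X 0.
have k_deg : in_deg 0 k by apply: in_deg_part.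
have l_deg : in_deg 0 l by apply: in_deg_part.
have cI_deg j (n : int) : (j < 8)%N -> n + 1 = edeg j -> in_deg n (cI j).
  by move=> j8 e x; rewrite cI_pr // e eqxx mul1r.
have kS x : gpr X 0 (gsq1 X x) = 0.
  by rewrite -[0](addNr 1) -gsq1_pr cX // linear0.
have kS2 x : gpr X 0 (gsq2 X x) = 0.
  by rewrite -[0](addNr 2) -gsq2_pr cX // linear0.
have [cI_conn pr0I _ _] := bottomI.
(* Sq^1 sends q to [E 3] and Sq^2 sends p to [E 4]. So the coordinates 3 and 4 carry the values of
   [a] on q (x) X^0 and of [b] on p (x) X^0, while the term with [t] produces [a] on p (x) X^1. *)
pose T : {linear gtens AugI X -> gF} := (fmul (cI 1) t \+ fmul (cI 3) k) \+ fmul (cI 4) l.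
have TE u x : T (tpure u x) = (cI 1 u : 'F_2) * t x + (cI 3 u : 'F_2) * k x + (cI 4 u : 'F_2) * l x.
  by rewrite -!fmulE.
have kE x : k x = a (tpure qI (gpr X 0 x)) by [].
have lE x : l x = b (tpure pI (gpr X 0 x)) by [].
exists T; split.
- apply: in_deg_add; first apply: in_deg_add.
  + by apply: (@in_deg_fmul _ _ 0 2) => //; apply: cI_deg.
  + by apply: (@in_deg_fmul _ _ 2 0) => //; apply: cI_deg.
  + by apply: (@in_deg_fmul _ _ 2 0) => //; apply: cI_deg.
- move=> z; rewrite -[RHS]a1 (connective_pr1 cI_conn cX).
  move: z; apply: (tens_lin_ext (f := T \o gsq1 (gtens AugI X))
    (g := a \o (tmap (gpr AugI 0) (gpr X 1) \+ tmap (gpr AugI 1) (gpr X 0)))) => u x.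
  rewrite -[LHS]/(T (gsq1 (gtens AugI X) (tpure u x))).
  rewrite -[RHS]/(a (tmap (gpr AugI 0) (gpr X 1) (tpure u x) +
    tmap (gpr AugI 1) (gpr X 0) (tpure u x))).
  rewrite !tmapE pr0I gpr1I gtens_sq1p !linearD !TE !cI_sq1 !kE !lE kS !linear0r !linear0.
  rewrite t_sq1 !tpureZl !linearZ !mul0r !mulr0 !addr0 add0r addrC.
  by [].
- move=> z; rewrite -[RHS]b0 (connective_pr0 cI_conn cX).
  move: z; apply: (tens_lin_ext (f := T \o gsq2 (gtens AugI X))
    (g := b \o (tmap (gpr AugI 0) (gpr X 0)))) => u x.
  rewrite -[LHS]/(T (gsq2 (gtens AugI X) (tpure u x))).
  rewrite -[RHS]/(b (tmap (gpr AugI 0) (gpr X 0) (tpure u x))).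
  rewrite !tmapE pr0I gtens_sq2p !linearD !TE !(cI_sq1, cI_sq2) !kE !lE !(kS, kS2) !linear0r !linear0.
  by rewrite t_sq2 tpureZl linearZ !mul0r !mulr0 !addr0 !add0r.
Qed.

Lemma ext12B X : connective X -> ext1 X -> ext12 (gtens QMark X).
Proof.
move=> cX hX a b a1 b0 asq.
have [cB_conn pr0B pB1 pB_sq1] := bottomB.
have [] := hX ((a \o tpr X pB) \o gpr X 1).
- exact: in_deg_part.
- move=> x.
  have := asq (tpure pB (gpr X 0 x)); rewrite gtens_sq1p pB_sq1 linear0l add0r.
  by rewrite gsq1_pr.
move=> t [t2 t_sq1 t_sq2].
pose l : {linear X -> gF} := (b \o tpr X pB) \o gpr X 0.
have l_deg : in_deg 0 l by apply: in_deg_part.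
have cB_deg j (n : int) : (j < 8)%N -> n + 3 = edeg j -> in_deg n (cB j).
  by move=> j8 e x; rewrite cB_pr // e eqxx mul1r.
have kS x : gpr X 0 (gsq1 X x) = 0.
  by rewrite -[0](addNr 1) -gsq1_pr cX // linear0.
have kS2 x : gpr X 0 (gsq2 X x) = 0.
  by rewrite -[0](addNr 2) -gsq2_pr cX // linear0.
(* [QMark] vanishes in degree 1, so [a] only lives on the bottom class times X^1; the coordinate 6
   detects Sq^2 of the bottom class. *)
pose T : {linear gtens QMark X -> gF} := fmul (cB 3) t \+ fmul (cB 6) l.
have TE u x : T (tpure u x) = (cB 3 u : 'F_2) * t x + (cB 6 u : 'F_2) * l x.
  by rewrite -!fmulE.
have lE x : l x = b (tpure pB (gpr X 0 x)) by [].
exists T; split.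
- apply: in_deg_add.
  + by apply: (@in_deg_fmul _ _ 0 2) => //; apply: cB_deg.
  + by apply: (@in_deg_fmul _ _ 2 0) => //; apply: cB_deg.
- move=> z; rewrite -[RHS]a1 (connective_pr1 cB_conn cX).
  move: z; apply: (tens_lin_ext (f := T \o gsq1 (gtens QMark X))
    (g := a \o (tmap (gpr QMark 0) (gpr X 1) \+ tmap (gpr QMark 1) (gpr X 0)))) => u x.
  rewrite -[LHS]/(T (gsq1 (gtens QMark X) (tpure u x))).
  rewrite -[RHS]/(a (tmap (gpr QMark 0) (gpr X 1) (tpure u x) +
    tmap (gpr QMark 1) (gpr X 0) (tpure u x))).
  rewrite !tmapE pr0B gpr1B gtens_sq1p !linearD !TE !cB_sq1 !lE kS !linear0r !linear0l !linear0.
  rewrite t_sq1 !tpureZl !linearZ !mul0r !mulr0 !addr0 add0r.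
  by [].
- move=> z; rewrite -[RHS]b0 (connective_pr0 cB_conn cX).
  move: z; apply: (tens_lin_ext (f := T \o gsq2 (gtens QMark X))
    (g := b \o (tmap (gpr QMark 0) (gpr X 0)))) => u x.
  rewrite -[LHS]/(T (gsq2 (gtens QMark X) (tpure u x))).
  rewrite -[RHS]/(b (tmap (gpr QMark 0) (gpr X 0) (tpure u x))).
  rewrite !tmapE pr0B gtens_sq2p !linearD !TE !(cB_sq1, cB_sq2) !lE !(kS, kS2) !linear0r !linear0.
  by rewrite t_sq2 tpureZl linearZ !mul0r !mulr0 !addr0 !add0r.
Qed.

(** * Symmetrized multiplication by a map to F *)

Lemma addF2 (a : 'F_2) : a + a = 0.
Proof. exact: (@char2 gF a). Qed.

Lemma bottom_hom (X : gmod) (y : ghom X gF) (u : X) (f : ghom X gF) : bottom y u ->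
  forall x, f x = (y x : 'F_2) * f u :> 'F_2.
Proof.
move=> [_ yu _ _] x.
have <- : f (gpr X 0 x) = f x by rewrite ghom_pr /= scale1r.
by rewrite yu linearZ.
Qed.

Lemma null_gtens_homl (M N X Y : gmod) (f : ghom M N) (k : ghom X Y) :
  null f -> null (gtens_hom f k).
Proof.
move=> hf; apply: eq_null (null_compl (gtens_hom (gid N) k) (null_tensl X hf)).
apply: (ghom_tens_ext (f := gcomp (gtens_hom (gid N) k) (gtens_hom f (gid X)))) => u v.
by rewrite gcompE [gtens_hom f _ _]tmapE [LHS]tmapE [RHS]tmapE.
Qed.

Lemma null_gtens_homr (M N X Y : gmod) (f : ghom M N) (k : ghom X Y) :
  null k -> null (gtens_hom f k).
Proof.
move=> hk; apply: eq_null (null_compl (gtens_hom f (gid Y)) (null_tensr M hk)).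
apply: (ghom_tens_ext (f := gcomp (gtens_hom f (gid Y)) (gtens_hom (gid M) k))) => u v.
by rewrite gcompE [gtens_hom _ k _]tmapE [LHS]tmapE [RHS]tmapE.
Qed.

Lemma tpureDl (X Y : gmod) (a b : X) (v : Y) :
  tpure (a + b) v = tpure a v + tpure b v :> gtens X Y.
Proof. exact: linearDl. Qed.
Lemma tpureDr (X Y : gmod) (a : X) (v w : Y) :
  tpure a (v + w) = tpure a v + tpure a w :> gtens X Y.
Proof. exact: linearDr. Qed.
Lemma tpureZr (X Y : gmod) (a : 'F_2) (u : X) (v : Y) :
  tpure u (a *: v) = a *: (tpure u v : gtens X Y).
Proof. by rewrite linearZr_LR. Qed.

Section Gsym.
Variables (L : gmod) (y : ghom L gF).

(* For invertible [L] this is stably [y (x) 1 + 1 (x) y = 0], and it takes its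
   values in [gker y], where it restricts to multiplication by [y] on
   L (x) gker y. *)
Definition gsym : ghom (gtens L L) L :=
  gadd (connecting L y) (gcomp (connecting L y) (gswap L L)).
Lemma gsymE l m : gsym (tpure l m) = (y l : 'F_2) *: m + (y m : 'F_2) *: l.
Proof.
rewrite -[LHS]/(connecting L y (tpure l m) + connecting L y (gswap L L (tpure l m))).
by rewrite gswapE !connectingE.
Qed.
Lemma y_gsym z : y (gsym z) = 0.
Proof.
move: z; apply: (tens_lin_ext (f := y \o gsym) (g := \0)) => l m.
rewrite -[LHS]/(y (gsym (tpure l m))) gsymE linearD !linearZ.
by rewrite -[LHS]/((y l : 'F_2) * y m + (y m : 'F_2) * y l) mulrC addF2.
Qed.
End Gsym.

Section Shuffle.
Variables X Y : gmod.
Definition gshuffle : ghom (gtens (gtens X Y) (gtens X Y)) (gtens (gtens X X) (gtens Y Y)) :=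
  gcomp (gassocV X X (gtens Y Y)) (gcomp (gtens_hom (gid X)
    (gcomp (gassoc X Y Y) (gcomp (gtens_hom (gswap Y X) (gid Y)) (gassocV Y X Y))))
    (gassoc X Y (gtens X Y))).
Lemma gshuffleE x y x' y' :
  gshuffle (tpure (tpure x y) (tpure x' y')) = tpure (tpure x x') (tpure y y').
Proof.
rewrite /gshuffle !gcompE gassocE [gtens_hom (gid X) _ _]tmapE !gcompE gassocVE.
by rewrite [gtens_hom (gswap _ _) _ _]tmapE gswapE gassocE gassocVE.
Qed.

Lemma tens4_ext (W : lmodType 'F_2) (f g : {linear gtens (gtens X Y) (gtens X Y) -> W}) :
  (forall x y x' y', f (tpure (tpure x y) (tpure x' y')) = g (tpure (tpure x y) (tpure x' y'))) ->
  f =1 g.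
Proof.
move=> h; apply: tens_lin_ext => z z'.
apply: (tens_lin_ext (f := f \o tpl _ z') (g := g \o tpl _ z')) => x y.
apply: (tens_lin_ext (f := f \o tpr _ (tpure x y)) (g := g \o tpr _ (tpure x y))) => x' y'.
exact: h.
Qed.

(** A Leibniz formula: on a (x) b and a' (x) b' the symmetrization of y (x) y' is gsym y (a, a') (x)
    y'(b) b' + y(a') a (x) gsym y' (b, b'), the mixed terms y(a') y'(b) a (x) b' cancelling. *)
Lemma null_gsym_tens (y : ghom X gF) (y' : ghom Y gF) :
  null (gsym y) -> null (gsym y') -> null (gsym (ymul y y')).
Proof.
move=> h h'.
pose k := gcomp (connecting X y) (gswap X X).
have kE a b : k (tpure a b) = (y b : 'F_2) *: a.
  by rewrite -[LHS]/(connecting X y (gswap X X (tpure a b))) gswapE connectingE.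
have n1 := null_compr gshuffle (null_gtens_homl (connecting Y y') h).
have n2 := null_compr gshuffle (null_gtens_homr k h').
apply: eq_null (null_add n1 n2) => z.
move: z; apply: (tens4_ext (f := (gtens_hom (gsym y) (connecting Y y') \o gshuffle) \+
  (gtens_hom k (gsym y') \o gshuffle))) => a b a' b'.
rewrite gsymE !ymulE.
rewrite -[LHS]/(gtens_hom (gsym y) (connecting Y y') (gshuffle (tpure (tpure a b) (tpure a' b'))) +
  gtens_hom k (gsym y') (gshuffle (tpure (tpure a b) (tpure a' b')))).
rewrite gshuffleE [gtens_hom (gsym y) _ _]tmapE [gtens_hom k _ _]tmapE kE.
rewrite !gsymE !connectingE.
rewrite tpureDl tpureDr !tpureZl !tpureZr !scalerA.
rewrite -addrA.
by rewrite [X in _ + X]addrA char2 add0r.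
Qed.
End Shuffle.

Lemma null_gsymF : null (gsym (gid gF)).
Proof.
apply: eq_null (null0 _ _).
apply: (tens_lin_ext (f := \0) (g := gsym (gid gF))) => a b.
by rewrite gsymE -[RHS]/((a : 'F_2) * b + (b : 'F_2) * a) mulrC addF2.
Qed.

Lemma gsq1D (X : gmod) (x y : X) : gsq1 X (x + y) = gsq1 X x + gsq1 X y.
Proof. exact: linearD. Qed.
Lemma gsq2D (X : gmod) (x y : X) : gsq2 X (x + y) = gsq2 X x + gsq2 X y.
Proof. exact: linearD. Qed.

Lemma fmulD (X Y : gmod) f g (z w : gtens X Y) :
  fmul f g (z + w) = (fmul f g z + fmul f g w : 'F_2).
Proof. exact: linearD. Qed.

(** The three words are those at which [trace_rank1] evaluates its functional. The hypotheses are
    the action on the coordinates of [QMark], and the values turn out to be the coordinates of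
    [gsym y z]. *)
Lemma fmul_gsym (X : gmod) (c3 c6 c7 : {linear X -> gF}) (y : ghom X gF) :
  (forall x, c3 (gsq1 X x) = 0) -> (forall x, c6 (gsq1 X x) = 0) ->
  (forall x, c7 (gsq1 X x) = c6 x) -> (forall x, c3 (gsq2 X x) = 0) ->
  (forall x, c6 (gsq2 X x) = c3 x) -> (forall x, c7 (gsq2 X x) = 0) ->
  (forall x, y x = c3 x) ->
  forall z,
  [/\ fmul c7 c7 (gsq1 (gtens X X) (gsq2 (gtens X X) z)) = c7 (gsym y z),
      fmul c7 c7 (gsq2 (gtens X X) (gsq2 (gtens X X) z)) = c6 (gsym y z) &
      fmul c7 c7 (gsq2 (gtens X X) (gsq2 (gtens X X) (gsq2 (gtens X X) z))) = c3 (gsym y z)].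
Proof.
move=> e31 e61 e71 e32 e62 e72 yE z.
have sE (c : {linear X -> gF}) u v :
    c (gsym y (tpure u v)) = (c3 u : 'F_2) * c v + (c u : 'F_2) * c3 v.
  rewrite gsymE !yE linearD !linearZ; congr (_ + _).
  exact: (mulrC (c3 v : 'F_2)).
have h6 w : fmul c7 c7 (gsq2 (gtens X X) (gsq2 (gtens X X) w)) = c6 (gsym y w).
  move: w; apply: (tens_lin_ext (g := c6 \o gsym y)
    (f := fmul c7 c7 \o (gsq2 (gtens X X) \o gsq2 (gtens X X)))) => u v.
  rewrite -[LHS]/(fmul c7 c7 (gsq2 (gtens X X) (gsq2 (gtens X X) (tpure u v)))).
  rewrite -[RHS]/(c6 (gsym y (tpure u v))) sE.
  rewrite !(gtens_sq1p, gtens_sq2p, gsq1D, gsq2D) !fmulD !fmulE.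
  rewrite !(e31, e61, e71, e32, e62, e72).
  by rewrite !(mul0r, mulr0, add0r, addr0).
split=> //; last by rewrite h6 ghom_sq2 e62.
move: z; apply: (tens_lin_ext (g := c7 \o gsym y)
  (f := fmul c7 c7 \o (gsq1 (gtens X X) \o gsq2 (gtens X X)))) => u v.
rewrite -[LHS]/(fmul c7 c7 (gsq1 (gtens X X) (gsq2 (gtens X X) (tpure u v)))).
rewrite -[RHS]/(c7 (gsym y (tpure u v))) sE.
rewrite !(gtens_sq1p, gtens_sq2p, gsq1D, gsq2D) !fmulD !fmulE.
rewrite !(e31, e61, e71, e32, e62, e72).
by rewrite !(mul0r, mulr0, add0r, addr0).
Qed.

Lemma coord367 (f : nat -> 'F_2) j : f 0%N = 0 -> f 1%N = 0 -> f 2%N = 0 ->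
  f 4%N = 0 -> f 5%N = 0 -> (j < 8)%N ->
  f 7%N * (7 == j)%N%:R + f 6%N * (6 == j)%N%:R + f 3%N * (3 == j)%N%:R = f j.
Proof.
by move=> f0 f1 f2 f4 f5; move: j; apply: forall8;
  rewrite /= ?mulr0 ?mulr1 ?addr0 ?add0r.
Qed.

Lemma cBD j x y : cB j (x + y) = (cB j x + cB j y : 'F_2).
Proof. exact: linearD. Qed.

Section GsymB.
Let tau : {linear gtens QMark QMark -> gF} := fmul (cB 7) (cB 7).
Let h_lin : linear (fun z : gtens QMark QMark => (tau z : 'F_2) *: pB).
Proof. by move=> a x y; rewrite linearP scalerDl -scalerA. Qed.
Let h : {linear gtens QMark QMark -> QMark} := mklin h_lin.
Let hE z : h z = (tau z : 'F_2) *: pB. Proof. by []. Qed.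

(** The hypotheses on [c] are relations satisfied by the bottom class of [QMark]. They leave only
    the components along [c], Sq^2 [c] and Sq^1 Sq^2 [c], which for [QMark] form a basis. *)
Lemma trace_rank1 (M N : gmod) (t : {linear M -> gF}) (c : N) (k : {linear M -> N}) :
  (forall z, k z = (t z : 'F_2) *: c) -> gsq1 N c = 0 -> gsq2 N (gsq2 N c) = 0 ->
  gsq2 N (gsq1 N (gsq2 N c)) = 0 ->
  forall z, trace k z = (t (gsq1 M (gsq2 M z)) : 'F_2) *: gsq1 N (gsq2 N c) +
    (t (gsq2 M (gsq2 M z)) : 'F_2) *: gsq2 N c +
    (t (gsq2 M (gsq2 M (gsq2 M z))) : 'F_2) *: c.
Proof.
move=> kE c1 c22 c212 z.
have k1E w : d2 k w = (t w : 'F_2) *: gsq2 N c + (t (gsq2 M w) : 'F_2) *: c.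
  by rewrite d2E !kE !linearZ /= c1 scaler0 addr0.
have k2E w : d2 (d2 k) w = (t (gsq1 M w) : 'F_2) *: gsq1 N (gsq2 N c) +
    (t (gsq2 M (gsq2 M w)) : 'F_2) *: c.
  rewrite [LHS]d2E !k1E !linearD !linearZ /= c1 c22 !scaler0 !addr0 add0r.
  by rewrite [LHS](AC (1*1*2) ((2*4)*(1*3))) /= char2 addr0.
rewrite [LHS]d2E !k2E !linearD !linearZ /= c1 c212 !gsq1_sq1 (linear0 t).
by rewrite scale0r !scaler0 !addr0 add0r addrCA addrA.
Qed.

Lemma null_gsymB : null (gsym hB).
Proof.
have [_ homB0 y1 p1] := bottomB.
have homB : gpr QMark 0 pB = pB by rewrite homB0 y1 scale1r.
have c2 j : (j < 8)%N -> cB j (gsq2 QMark pB) = (6 == j)%:R.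
  by move: j; apply: forall8; rewrite ?cB0 ?cB_sq2 ?cB_p.
have c3 j : (j < 8)%N -> cB j (gsq1 QMark (gsq2 QMark pB)) = (7 == j)%:R.
  by move: j; apply: forall8; rewrite ?cB0 ?cB_sq1 ?c2.
(* The product of the two top coordinates lives in degree 3 + 3 = 6 and the bottom class in degree
   0, so [h] has the degree -6 of a trace. *)
exists h; split.
  have tau6 : in_deg 6 tau.
    apply: (@in_deg_fmul _ _ 3 3) => // x; by rewrite cB_pr // eqxx mul1r.
  move=> n z; rewrite !hE linearZ -(tau6 (gpr _ n z)) gpr_pr -homB gpr_pr.
  rewrite subr_eq0 eq_sym; case: eqP => [->|_]; first by rewrite homB tau6.
  by rewrite linear0 scale0r; exact: (esym (scaler0 _ _)).
have cB_g := fmul_gsym (fun x => (cB_sq1 x).1.1) (fun x => (cB_sq1 x).1.2)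
  (fun x => (cB_sq1 x).2) (fun x => (cB_sq2 x).1.1) (fun x => (cB_sq2 x).1.2)
  (fun x => (cB_sq2 x).2) (y := hB) (fun=> erefl).
move=> z; rewrite (trace_rank1 hE) //; last 2 first.
- by apply: cB_ext; apply: forall8; rewrite ?cB0 ?linear0 // cB_sq2 ?c2.
- by apply: cB_ext; apply: forall8; rewrite ?cB0 ?linear0 // cB_sq2 ?c3.
have [-> -> ->] := cB_g z.
move: (gsym hB z) => w; have [[[[w0 w1] w2] w4] w5] := cB0 w.
apply: cB_ext => j j8; rewrite !cBD !cBZ c2 // c3 // cB_p //.
exact: (@coord367 (fun i => cB i w) j w0 w1 w2 w4 w5 j8).
Qed.
End GsymB.

(** * Extension to Sigma^{-1} A(1) *)

Lemma aug_decomp (x : gshift (-1) A1) :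
  exists k : AugI, AugI_incl k = x + (co 0 x : 'F_2) *: (E 0 : A1).
Proof.
apply: AugI_mk; rewrite linearD linearZ coE //.
by rewrite -[X in _ + X]/((co 0 x : 'F_2) * 1) mulr1 char2.
Qed.

Section AugRetraction.
Let exr := choice aug_decomp.
Let r := projT1 exr.
Let rE x : AugI_incl (r x) = x + (co 0 x : 'F_2) *: (E 0 : A1) := projT2 exr x.
Let r_lin : linear r.
Proof.
apply: linear_F2 => x y; apply: AugI_incl_inj; rewrite [RHS]linearD !rE.
by rewrite linearD scalerDl addrACA.
Qed.
Definition aug_ret : {linear gshift (-1) A1 -> AugI} := mklin r_lin.
Lemma aug_retE x : AugI_incl (aug_ret x) = x + (co 0 x : 'F_2) *: (E 0 : A1).
Proof. exact: rE. Qed.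
Lemma aug_retK x : aug_ret (AugI_incl x) = x.
Proof.
apply: AugI_incl_inj; rewrite aug_retE -[co 0 _]/(cI 0 x) cI0 scale0r.
exact: addr0.
Qed.
Lemma aug_ret_deg : hdeg 0 aug_ret.
Proof.
move=> n x; apply: AugI_incl_inj; rewrite addr0 ghom_pr !aug_retE linearD linearZ.
congr (_ + _); rewrite -[co 0 _]/(co 0 (gpr A1 (n - -1) x)) co_pr //.
rewrite -[gpr (gshift _ _) _ _]/(gpr A1 (n - -1) (E 0)) E_pr //= scalerA.
by rewrite mulrC.
Qed.
End AugRetraction.

Definition SA1 : gmod := gshift (-1) A1.

Lemma gproj_SA1 X : gproj (gtens SA1 X).
Proof. exact/gproj_tensl/gproj_shift/gproj_A1. Qed.

Definition AugI_tens X : ghom (gtens AugI X) (gtens SA1 X) := gtens_hom AugI_incl (gid X).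
Lemma AugI_tensE X u x : AugI_tens X (tpure u x) = tpure (AugI_incl u) x.
Proof. exact: tmapE. Qed.

Lemma AugI_tensK X : cancel (AugI_tens X) (tensl X aug_ret).
Proof.
apply: (tens_lin_ext (f := tensl X aug_ret \o AugI_tens X) (g := idfun)) => u x.
rewrite -[LHS]/(tensl X aug_ret (AugI_tens X (tpure u x))).
by rewrite AugI_tensE tenslE aug_retK.
Qed.

Lemma AugI_tens_inj X : injective (AugI_tens X).
Proof. exact: can_inj (@AugI_tensK X). Qed.

Lemma aug_incl X z : connecting X A1_aug (AugI_tens X z) = 0.
Proof.
move: z; apply: (tens_lin_ext (f := connecting X A1_aug \o AugI_tens X) (g := \0)) => v x.
rewrite -[LHS]/(connecting X A1_aug (AugI_tens X (tpure v x))) AugI_tensE connectingE co0_aug.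
by rewrite -[co 0 _]/(cI 0 v) cI0 scale0r.
Qed.

Lemma homog_SA1 : homog (M := SA1) (-1) (E 0).
Proof. by rewrite /homog -[LHS]/(gpr A1 (-1 - -1) (E 0)) E_pr // scale1r. Qed.

(** Write f = trace h and extend h through the graded linear retraction [aug_ret]. The trace of the
    extension is a module map that restricts to f. *)
Lemma AugI_extend X Y (f : ghom (gtens AugI X) Y) : null f ->
  exists G : ghom (gtens SA1 X) Y, forall z, G (AugI_tens X z) = f z.
Proof.
move=> [h [hd hf]].
have kd : hdeg (-6) (h \o tensl X aug_ret).
  move=> n z; rewrite -[LHS]/(h (tensl X aug_ret (gpr (gtens SA1 X) n z))).
  by rewrite (@hdeg_tensl _ _ X _ _ aug_ret_deg) addr0 hd.
exists (trace_hom kd) => z; rewrite -hf.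
rewrite -[LHS]/((trace (h \o tensl X aug_ret) \o AugI_tens X) z) -trace_compr.
apply: eq_trace => {}z.
by rewrite -[LHS]/(h (tensl X aug_ret (AugI_tens X z))) AugI_tensK.
Qed.

(* Every element of Sigma^{-1} A(1) (x) X is the sum of an element of
   AugI (x) X and of some 1 (x) x. *)
Lemma SA1_ext (W : lmodType 'F_2) X (f g : {linear gtens SA1 X -> W}) :
  (forall z, f (AugI_tens X z) = g (AugI_tens X z)) ->
  (forall x, f (tpure (E 0) x) = g (tpure (E 0) x)) -> f =1 g.
Proof.
move=> h1 h2; apply: tens_lin_ext => a x.
have e : a = AugI_incl (aug_ret a) + (co 0 a : 'F_2) *: (E 0 : A1).
  by rewrite aug_retE -addrA char2 addr0.
rewrite e tpureDl !linearD -AugI_tensE h1; congr (_ + _).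
by rewrite (tpureZl (X := SA1)) !linearZ h2.
Qed.

(** Followed by the inclusion into the projective Sigma^{-1} A(1) the map is stably zero, hence
    extends to Sigma^{-1} A(1) (x) [AugI]. The extension still takes values in [AugI], so the map
    itself factors through a projective. *)
Lemma null_gsymI : null (gsym hI).
Proof.
have hn : null (gcomp AugI_incl (gsym hI)).
  exact/null_proj_cod/gproj_shift/gproj_A1.
have [G GE] := AugI_extend hn.
have [cI_conn prI yp p1] := bottomI.
have sq1E0 : gsq1 A1 (E 0) = E 1 by rewrite sq1_E.
have inclp : AugI_incl pI = E 1 by apply: A1_coP => j j8; rewrite coE // -cI_p.
have hom0 n x : gpr (gtens SA1 AugI) n (tpure (E 0) x) = tpure (E 0) (gpr AugI (n + 1) x).
  by rewrite (gpr_tpurel _ _ homog_SA1) opprK.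
have Gp : G (tpure (E 0) pI) = (co 0 (G (tpure (E 0) pI)) : 'F_2) *: (E 0 : A1).
  have {1}<- : gpr SA1 (-1) (G (tpure (E 0) pI)) = G (tpure (E 0) pI).
    by rewrite -ghom_pr hom0 prI yp scale1r.
  apply: A1_coP => j j8; rewrite linearZ coE //.
  rewrite -[LHS]/(co j (gpr A1 (-1 - -1) _)) co_pr //.
  have aux (f : nat -> 'F_2) :
      ((-1 - -1 : int) == edeg j)%:R * f j = f 0%N * (0%N == j)%:R.
    by move: j j8; apply: forall8; rewrite /= ?mul0r ?mulr0 ?mul1r ?mulr1.
  exact: (aux (fun i => co i (G (tpure (E 0) pI)))).
(* Apply Sq^1: since Sq^1 p = 0, the element 1 (x) p goes to p (x) p, on which the symmetrization is
   p + p = 0, while Sq^1 is injective on multiples of 1. *)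
have c0 : co 0 (G (tpure (E 0) pI)) = 0.
  have := congr1 (gsq1 SA1) Gp; rewrite -ghom_sq1 gtens_sq1p p1 linear0r addr0.
  rewrite sq1E0 -inclp -AugI_tensE GE gcompE gsymE char2 linear0 linearZ.
  rewrite -[X in _ = _ X]/(gsq1 A1 (E 0)) sq1E0.
  move/(congr1 (co 1)); rewrite linear0 linearZ coE // => /esym.
  by rewrite -[X in X = _]/((co 0 (G (tpure (E 0) pI)) : 'F_2) * 1) mulr1.
have co0G z : co 0 (G z) = 0.
  move: z; apply: (SA1_ext (f := co 0 \o G) (g := \0)) => [z|x].
    rewrite -[LHS]/(co 0 (G (AugI_tens _ z))) GE; exact: cI0.
  rewrite -[LHS]/(co 0 (G (tpure (E 0) x))).
  have <- : co 0 (gpr SA1 (-1) (G (tpure (E 0) x))) = co 0 (G (tpure (E 0) x)).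
    by rewrite -[LHS]/(co 0 (gpr A1 (-1 - -1) _)) co_pr // mul1r.
  rewrite -ghom_pr hom0 prI.
  have -> : tpure (E 0) ((hI x : 'F_2) *: pI) = (hI x : 'F_2) *: (tpure (E 0) pI : gtens SA1 AugI).
    exact: tpureZr.
  by rewrite !linearZ c0; exact: (scaler0 _ _).
have [k kE] := ghom_factor AugI_incl_inj (fun z => AugI_mk (co0G z)).
apply: eq_null (null_compr (AugI_tens AugI) (null_proj_dom k (gproj_SA1 AugI))) => z.
by apply: AugI_incl_inj; rewrite -[LHS]/(AugI_incl (k (AugI_tens _ z))) kE GE.
Qed.

(** * Models of (Omega Sigma^{-1})^n J^epsilon *)

(* [T s] is stably (Omega Sigma^{-1})^(size s) J^r with [r] the number of [true]
   in [s], and [yT s] is the non-trivial map to F. *)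
Definition atom (b : bool) : gmod := if b then QMark else AugI.
Definition hatom (b : bool) : ghom (atom b) gF :=
  if b as b return ghom (atom b) gF then hB else hI.
Definition patom (b : bool) : atom b := if b as b return atom b then pB else pI.

Fixpoint T (s : seq bool) : gmod := if s is b :: s' then gtens (atom b) (T s') else gF.
Fixpoint yT (s : seq bool) : ghom (T s) gF :=
  if s is b :: s' return ghom (T s) gF then ymul (hatom b) (yT s') else gid gF.
Fixpoint uT (s : seq bool) : T s :=
  if s is b :: s' return T s then tpure (patom b) (uT s') else (1 : 'F_2).

Lemma bottom_atom b : bottom (hatom b) (patom b).
Proof. by case: b; [apply: bottomB | apply: bottomI]. Qed.

Lemma bottomT s : bottom (yT s) (uT s).
Proof.
elim: s => [|b s IH]; first exact: bottomF.
have [c1 _ _ _] := bottom_atom b; have [c2 _ _ _] := IH.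
exact (bottom_tens c1 c2 (bottom_atom b) IH).
Qed.

Lemma connectiveT s : connective (T s).
Proof. by have [] := bottomT s. Qed.

Lemma null_gsymT s : null (gsym (yT s)).
Proof.
elim: s => [|b s IH]; first exact: null_gsymF.
apply: null_gsym_tens => //; case: b; [exact: null_gsymB | exact: null_gsymI].
Qed.

Lemma ext1T s : ext1 (T s).
Proof.
elim: s => [|b s IH]; first exact: ext1F.
apply: ext12_ext1; case: b; [apply: ext12B | apply: ext12I] => //; exact: connectiveT.
Qed.

Lemma ext12T b s : ext12 (T (b :: s)).
Proof.
case: b; [apply: ext12B | apply: ext12I]; by [apply: connectiveT | apply: ext1T].
Qed.

Lemma T_cat s s' : exists (f : ghom (gtens (T s) (T s')) (T (s ++ s')))
  (g : ghom (T (s ++ s')) (gtens (T s) (T s'))), cancel f g.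
Proof.
elim: s => [|b s [f [g fK]]]; first by exists (gunit _), (gunitV _); apply: gunitK.
exists (gcomp (gtens_hom (gid (atom b)) f) (gassoc _ _ _)).
exists (gcomp (gassocV _ _ _) (gtens_hom (gid (atom b)) g)) => z.
rewrite -[LHS]/(gassocV _ _ _ (gcomp (gtens_hom (gid (atom b)) g)
  (gtens_hom (gid (atom b)) f) (gassoc _ _ _ z))).
rewrite -[RHS](gassocK (M := atom b)); congr (gassocV _ _ _ _).
move: (gassoc _ _ _ z) => {}z; move: z.
apply: (ghom_tens_ext (g := gid _)) => u v.
by rewrite gcompE [gtens_hom _ f _]tmapE [LHS]tmapE fK.
Qed.

Section SigmaF.
Variable X : gmod.
Hypotheses (cX : connective X) (hX : ext12 X).

(** For degree reasons [s] consists of [a] on p (x) X^1 and [b] on q (x) X^0. An extension to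
    Sigma^{-1} A(1) (x) X adds a component t on 1 (x) X^2; it kills Sq^1 and Sq^2 of 1 (x) x if t
    Sq^1 = a and t Sq^2 = b, which is what [ext12] provides. *)
Lemma null_SigmaF (s : ghom (gtens AugI X) (gshift 1 gF)) : null s.
Proof.
have [cI_conn prI yp p1] := bottomI.
have homp : homog 0 pI by rewrite /homog prI yp scale1r.
have homq : homog 1 qI by rewrite /homog gpr1I cI_q // scale1r.
pose a : {linear X -> gF} := s \o tpr X pI.
pose b : {linear X -> gF} := s \o tpr X qI.
have aE x : a x = s (tpure pI x) by [].
have bE x : b x = s (tpure qI x) by [].
have s1 z : s (gpr (gtens AugI X) 1 z) = s z.
  by rewrite ghom_pr; exact: scale1r.
have a1 : in_deg 1 a.
  by move=> x; rewrite !aE -[RHS]s1 (gpr_tpurel _ _ homp) subr0.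
have b0 : in_deg 0 b.
  by move=> x; rewrite !bE -[RHS]s1 (gpr_tpurel _ _ homq) subrr.
have asq x : a (gsq1 X x) = 0.
  rewrite aE; have := ghom_sq1 s (tpure pI x).
  by rewrite gtens_sq1p p1 linear0l add0r.
have [t [t2 t_sq1 t_sq2]] := hX a1 b0 asq.
pose S : {linear gtens SA1 X -> gF} :=
  (fmul (X := SA1) (co 0) t \+ fmul (X := SA1) (co 1) a) \+ fmul (X := SA1) (co 2) b.
have SE c x : S (tpure c x) =
    (co 0 c : 'F_2) * t x + (co 1 c : 'F_2) * a x + (co 2 c : 'F_2) * b x.
  by rewrite -!(fmulE (X := SA1)).
have co_deg j (n : int) : (j < 8)%N -> n + 1 = edeg j -> in_deg (X := SA1) n (co j).
  move=> j8 e x; rewrite -[LHS]/(co j (gpr A1 (n - -1) x)) co_pr //.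
  by rewrite opprK e eqxx mul1r.
have S1 : in_deg 1 S.
  apply: in_deg_add; first apply: in_deg_add.
  + by apply: (@in_deg_fmul _ _ (-1) 2) => //; apply: co_deg.
  + by apply: (@in_deg_fmul _ _ 0 1) => //; apply: co_deg.
  + by apply: (@in_deg_fmul _ _ 1 0) => //; apply: co_deg.
have b_sq x : (b (gsq1 X x) = 0) * (b (gsq2 X x) = 0) * (a (gsq2 X x) = 0).
  split; [split|].
  + by rewrite -b0 -[0](addNr 1) -gsq1_pr cX // !linear0.
  + by rewrite -b0 -[0](addNr 2) -gsq2_pr cX // !linear0.
  + by rewrite -a1 [gpr X 1 _](_ : _ = gpr X (-1 + 2) (gsq2 X x)) // -gsq2_pr cX // !linear0.
have Sd i j u v : homog (M := gshift 1 gF) (i + j) (S (tpure (gpr SA1 i u) (gpr X j v))).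
  rewrite /homog -S1 [gpr _ 1 _]gtens_prE; case: eqP => [<-|_]; last by rewrite !linear0.
  exact: scale1r.
have Ssq1 u v : gsq1 (gshift 1 gF) (S (tpure u v)) =
    S (tpure (gsq1 SA1 u) v) + S (tpure u (gsq1 X v)).
  rewrite -[LHS]/(0 : 'F_2) !SE t_sq1 asq b_sq.
  rewrite -[gsq1 SA1 u]/(gsq1 A1 u) !co_sq1.
  by rewrite !mul0r !mulr0 !addr0 add0r addF2.
have Ssq2 u v : gsq2 (gshift 1 gF) (S (tpure u v)) = S (tpure (gsq2 SA1 u) v) +
    S (tpure (gsq1 SA1 u) (gsq1 X v)) + S (tpure u (gsq2 X v)).
  rewrite -[LHS]/(0 : 'F_2) !SE t_sq1 t_sq2 asq !b_sq.
  rewrite -[gsq1 SA1 u]/(gsq1 A1 u) -[gsq2 SA1 u]/(gsq2 A1 u) !co_sq1 !co_sq2.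
  by rewrite !mul0r !mulr0 !addr0 !add0r addF2.
apply: eq_null (null_compr (AugI_tens X) (null_proj_dom
  (glift (X := gshift 1 gF) (F := S) Sd Ssq1 Ssq2) (gproj_SA1 X))) => z.
rewrite -[LHS]/(S (AugI_tens X z)) -S1 -ghom_pr -[RHS]s1 (connective_pr1 cI_conn cX).
move: z; apply: (tens_lin_ext (f := S \o (AugI_tens X \o (tmap (gpr AugI 0) (gpr X 1) \+ tmap (gpr AugI 1) (gpr X 0))))
  (g := s \o (tmap (gpr AugI 0) (gpr X 1) \+ tmap (gpr AugI 1) (gpr X 0)))) => u x.
rewrite -[LHS]/(S (AugI_tens X (tmap (gpr AugI 0) (gpr X 1) (tpure u x) +
  tmap (gpr AugI 1) (gpr X 0) (tpure u x)))).
rewrite -[RHS]/(s (tmap (gpr AugI 0) (gpr X 1) (tpure u x) +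
  tmap (gpr AugI 1) (gpr X 0) (tpure u x))).
rewrite !tmapE prI gpr1I !linearD !AugI_tensE !SE.
have cE j w : co j (AugI_incl w) = cI j w by [].
have e : (cI 1 pI = 1) * (cI 2 pI = 0) * (cI 1 qI = 0) * (cI 2 qI = 1).
  by do 3?split; rewrite ?cI_p ?cI_q.
rewrite !cE !cIZ !e !cI0 !tpureZl !linearZ -aE -bE.
by rewrite !mulr0 !mul0r !mulr1 !addr0 !add0r.
Qed.
End SigmaF.

(* If [g] is stably zero as a map to [L], its extension [G] over the projective
   Sigma^{-1} A(1) (x) X can be corrected by a map that factors through X so as
   to land in [gker y]: the obstruction is a map from X to Sigma F. *)
Lemma null_lift_ker X L (y : ghom L gF) (u : L) (g : ghom (gtens AugI X) (gker y)) :
  homog 0 u -> y u = 1 :> 'F_2 -> null (gcomp (gker_incl y) g) ->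
  (forall s : ghom X (gshift 1 gF), null s) -> null g.
Proof.
move=> u0 yu hg hX.
have [G GE] := AugI_extend hg.
have yG z : y (G (AugI_tens X z)) = 0 by rewrite GE gcompE gker_inclP.
(* [s] measures the failure of [G] to land in the kernel of [y]. It is a module map because 1 (x)
   Sq^i x differs from Sq^i (1 (x) x) by elements of [AugI] (x) X, where y G = 0; the degree -1 of
   the unit makes its target Sigma F. *)
pose s : {linear X -> gF} := y \o (G \o tpr X (E 0 : SA1)).
have sE x : s x = y (G (tpure (E 0 : SA1) x)) by [].
have s_pr n x : s (gpr X n x) = gpr (gshift 1 gF) n (s x).
  rewrite !sE -[RHS]/(gpr gF (n - 1) _) -!ghom_pr (gpr_tpurel _ _ homog_SA1).
  by rewrite opprK subrK.
have incl1 : exists k, AugI_incl k = gsq1 SA1 (E 0) by apply: AugI_mk; rewrite co_sq1.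
have incl2 : exists k, AugI_incl k = gsq2 SA1 (E 0) by apply: AugI_mk; rewrite co_sq2.
have s_sq1 x : s (gsq1 X x) = gsq1 (gshift 1 gF) (s x).
  rewrite -[RHS]/(0 : 'F_2) sE.
  have := ghom_sq1 y (G (tpure (E 0 : SA1) x)).
  rewrite -ghom_sq1 gtens_sq1p !linearD; have [k <-] := incl1.
  by rewrite -AugI_tensE yG add0r.
have s_sq2 x : s (gsq2 X x) = gsq2 (gshift 1 gF) (s x).
  rewrite -[RHS]/(0 : 'F_2) sE.
  have := ghom_sq2 y (G (tpure (E 0 : SA1) x)).
  rewrite -ghom_sq2 gtens_sq2p !linearD; have [k <-] := incl1; have [k' <-] := incl2.
  by rewrite -!AugI_tensE !yG !add0r.
pose s' := @Ghom X (gshift 1 gF) s s_pr s_sq1 s_sq2.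
have [t [td tE]] := hX s'.
have k_lin : linear (fun x : X => (t x : 'F_2) *: u).
  by move=> a v w; rewrite linearP scalerDl -scalerA.
(* A lift of [s] through [y]: with s = trace t and y u = 1, the trace of x |-> t(x) u is a module
   map whose composite with y is s. *)
pose k : {linear X -> gshift 1 L} := mklin k_lin.
have kd : hdeg (-6) k.
  move=> n x; rewrite -[LHS]/((t (gpr X n x) : 'F_2) *: u) td.
  rewrite -[RHS]/(gpr L (n + -6 - 1) ((t x : 'F_2) *: u)) linearZ -u0 gpr_pr u0.
  rewrite -[gpr (gshift 1 gF) _ _]/(((n + -6 - 1 == 0)%:R : 'F_2) * t x).
  by case: eqP => _; rewrite ?mul1r // mul0r scale0r; exact: (esym (scaler0 _ _)).
pose S := trace_hom kd.
have yS x : y (S x) = s x.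
  rewrite -[RHS]tE -[LHS]/(((gshift_hom 1 y) \o trace k) x) -trace_compl.
  apply: eq_trace => {}x; rewrite -[LHS]/(y ((t x : 'F_2) *: u)) linearZ yu.
  exact: (mulr1 (t x : 'F_2)).
pose C := connecting X A1_aug.
have C_incl z : C (AugI_tens X z) = 0 by apply: aug_incl.
have C_one x : C (tpure (E 0) x) = x.
  by rewrite connectingE co0_aug coE // scale1r.
pose G2 : {linear gtens SA1 X -> L} := G \+ (S \o C).
have G2E z : G2 z = G z + S (C z) by [].
have G2_pr n z : G2 (gpr (gtens SA1 X) n z) = gpr L n (G2 z).
  rewrite !G2E (linearD (gpr L n)) -(ghom_pr G); congr (_ + _).
  rewrite [gpr (gtens SA1 X) n z]gtens_shiftl_pr (ghom_pr C) (ghom_pr S).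
  by rewrite -[LHS]/(gpr L (n - -1 - 1) _) opprK addrK.
have G2_sq1 z : G2 (gsq1 (gtens SA1 X) z) = gsq1 L (G2 z).
  rewrite !G2E (linearD (gsq1 L)) -(ghom_sq1 G); congr (_ + _).
  by rewrite -[LHS]/(S (C (gsq1 (gtens A1 X) z))) !ghom_sq1.
have G2_sq2 z : G2 (gsq2 (gtens SA1 X) z) = gsq2 L (G2 z).
  rewrite !G2E (linearD (gsq2 L)) -(ghom_sq2 G); congr (_ + _).
  by rewrite -[LHS]/(S (C (gsq2 (gtens A1 X) z))) !ghom_sq2.
pose G' := @Ghom (gtens SA1 X) L G2 G2_pr G2_sq1 G2_sq2.
have yG' z : y (G' z) = 0.
  move: z; apply: (SA1_ext (f := y \o G') (g := \0)) => [z|x].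
    rewrite -[LHS]/(y (G2 (AugI_tens X z))) G2E linearD yG C_incl linear0.
    by rewrite add0r linear0.
  rewrite -[LHS]/(y (G2 (tpure (E 0 : SA1) x))) G2E linearD C_one yS -sE.
  exact: char2.
have [G'' G''E] := gker_factor yG'.
apply: eq_null (null_compr (AugI_tens X) (null_proj_dom G'' (gproj_SA1 X))) => z.
apply: gker_incl_inj; rewrite -[LHS]/(gker_incl y (G'' (AugI_tens X z))) G''E.
by rewrite -[LHS]/(G2 _) G2E GE C_incl linear0 addr0.
Qed.

(** * Vanishing and divisibility *)

Lemma gsym_ker_ex (L : gmod) (y : ghom L gF) :
  exists g : ghom (gtens L L) (gker y), forall z, gker_incl y (g z) = gsym y z.
Proof. by apply: gker_factor => z; apply: y_gsym. Qed.

Definition gsym_ker (L : gmod) (y : ghom L gF) : ghom (gtens L L) (gker y) :=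
  projT1 (cid (gsym_ker_ex y)).
Lemma gsym_kerE (L : gmod) (y : ghom L gF) z : gker_incl y (gsym_ker y z) = gsym y z.
Proof. exact: (projT2 (cid (gsym_ker_ex y))). Qed.

Lemma null_iso (X Y Z : gmod) (e : ghom X Y) (i : ghom Y X) (t : ghom X Z) :
  cancel e i -> null (gcomp t i) -> null t.
Proof.
by move=> eK h; apply: eq_null (null_compr e h) => z; rewrite -[LHS]/(t (i (e z))) eK.
Qed.

Lemma gtens_homr_can (V X Y : gmod) (e : ghom X Y) (i : ghom Y X) : cancel e i ->
  cancel (gtens_hom (gid V) e) (gtens_hom (gid V) i).
Proof.
move=> eK; apply: (ghom_tens_ext (f := gcomp (gtens_hom (gid V) i) (gtens_hom (gid V) e))
  (g := gid _)) => u v.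
by rewrite gcompE [gtens_hom _ e _]tmapE [LHS]tmapE eK.
Qed.

Lemma shuffle_iso (V P Q : gmod) (f : ghom (gtens P P) Q) (f' : ghom Q (gtens P P)) :
  cancel f f' -> exists (e : ghom (gtens P (gtens V P)) (gtens V Q))
    (i : ghom (gtens V Q) (gtens P (gtens V P))), cancel e i.
Proof.
move=> fK.
exists (gcomp (gtens_hom (gid V) f) (gcomp (gassoc V P P) (gswap P (gtens V P)))).
exists (gcomp (gswap (gtens V P) P) (gcomp (gassocV V P P) (gtens_hom (gid V) f'))).
by move=> z; rewrite !gcompE (gtens_homr_can fK) gassocK gswapK.
Qed.

(** The leading [AugI] is the factor along which maps are extended. What remains, P (x) ([AugI] (x)
    P), is a retract of [AugI] (x) Q, so [null_SigmaF] gives the vanishing that [null_lift_ker] asks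
    for. *)
Lemma null_gsym_ker (P Q : gmod) (y : ghom (gtens AugI P) gF) u
    (f : ghom (gtens P P) Q) (f' : ghom Q (gtens P P)) :
  homog 0 u -> y u = 1 :> 'F_2 -> cancel f f' -> connective Q -> ext12 Q ->
  null (gsym y) -> null (gsym_ker y).
Proof.
move=> u0 yu fK cQ hQ hy; apply: (null_iso (@gassocK AugI P (gtens AugI P))).
apply: (null_lift_ker u0 yu).
  apply: eq_null (null_compr (gassocV AugI P (gtens AugI P)) hy) => z.
  by rewrite gcompE gsym_kerE.
have [e [i eK]] := shuffle_iso AugI fK.
by move=> t; apply: (null_iso eK); apply: null_SigmaF.
Qed.

(** The second letter keeps the word [(b :: s) ++ (b :: s)] nonempty, as [ext12T] requires. *)
Lemma null_gsym_kerT b s : null (gsym_ker (yT [:: false, b & s])).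
Proof.
have [_ yu y1 _] := bottomT [:: false, b & s].
have [f [f' fK]] := T_cat (b :: s) (b :: s).
apply: (@null_gsym_ker _ _ _ (uT [:: false, b & s]) f f') => //.
- by rewrite /homog yu y1 scale1r.
- exact: connectiveT.
- exact: ext12T.
- exact: (@null_gsymT [:: false, b & s]).
Qed.

Lemma connecting_comp (L L' A : gmod) (y : ghom L gF) (y' : ghom L' gF) (z : ghom L L') :
  (forall x, y' (z x) = y x) ->
  connecting A y =1 connecting A y' \o gtens_hom z (gid A).
Proof.
move=> zE; apply: (ghom_tens_ext (g := gcomp (connecting A y') (gtens_hom z (gid A)))) => l a.
by rewrite gcompE [gtens_hom z _ _]tmapE !connectingE zE.
Qed.

(** For k in the kernel of y, symmetrized multiplication sends z(m) (x) k to y(z m) k + y(k) z(m) =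
    y'(m) k, so multiplication by y' is a restriction of it. *)
Lemma null_connecting (L M : gmod) (y : ghom L gF) (y' : ghom M gF) (z : ghom M L) :
  (forall x, y (z x) = y' x) -> null (gsym_ker y) -> null (connecting (gker y) y').
Proof.
move=> zE h; apply: eq_null (null_compr (gtens_hom z (gker_incl y)) h).
apply: (ghom_tens_ext (f := gcomp (gsym_ker y) (gtens_hom z (gker_incl y)))) => l a.
rewrite gcompE [gtens_hom z _ _]tmapE connectingE; apply: gker_incl_inj.
by rewrite gsym_kerE gsymE gker_inclP scale0r addr0 zE [RHS]linearZ.
Qed.

(** [yT s] is a multiple of [yT s']: the first word is the divisible one. *)
Definition divT (s s' : seq bool) : Prop :=
  exists z : ghom (T s) (T s'), forall x, yT s' (z x) = yT s x.

Lemma null_connectingT b s s' : divT s' [:: false, b & s] ->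
  null (connecting (gker (yT [:: false, b & s])) (yT s')).
Proof. by move=> [z zE]; apply: (null_connecting zE); apply: null_gsym_kerT. Qed.

Lemma divT_refl s : divT s s.
Proof. by exists (gid _). Qed.

Lemma divT_trans s1 s2 s3 : divT s1 s2 -> divT s2 s3 -> divT s1 s3.
Proof. by move=> [z zE] [w wE]; exists (gcomp w z) => x; rewrite gcompE wE. Qed.

Lemma divT_cons b s s' : divT s s' -> divT (b :: s) (b :: s').
Proof.
move=> [z zE]; exists (gtens_hom (gid (atom b)) z).
apply: (ghom_tens_ext (f := gcomp (yT (b :: s')) (gtens_hom (gid (atom b)) z))) => u v.
by rewrite gcompE [gtens_hom _ z _]tmapE [LHS]ymulE [RHS]ymulE zE.
Qed.

Lemma divT_drop b s : divT (b :: s) s.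
Proof. by exists (connecting (T s) (hatom b)). Qed.

Lemma divT_cat r s s' : divT s s' -> divT (r ++ s) (r ++ s').
Proof. by move=> h; elim: r => // b r IH; apply: divT_cons. Qed.

Lemma gprZ (X : gmod) n (a : 'F_2) (x : X) : gpr X n (a *: x) = a *: gpr X n x.
Proof. exact: linearZ. Qed.
Lemma gprD (X : gmod) n (x y : X) : gpr X n (x + y) = gpr X n x + gpr X n y.
Proof. exact: linearD. Qed.
Lemma gsq1Z (X : gmod) (a : 'F_2) (x : X) : gsq1 X (a *: x) = a *: gsq1 X x.
Proof. exact: linearZ. Qed.
Lemma gsq2Z (X : gmod) (a : 'F_2) (x : X) : gsq2 X (a *: x) = a *: gsq2 X x.
Proof. exact: linearZ. Qed.

Lemma addr6 (V : zmodType) (a b c d e f : V) :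
  a + b + (c + d) + (e + f) = a + c + e + (b + d + f).
Proof. by rewrite [LHS](AC (2*2*2) (1*3*5*(2*4*6))). Qed.

(* A map to QMark is given by its component on the top class. *)
Lemma QMark_hom (X : gmod) (c : {linear X -> gF}) : in_deg 3 c ->
  (forall x, c (gsq2 X x) = 0) ->
  exists f : ghom X QMark, forall x, hB (f x) = c (gsq1 X (gsq2 X x)).
Proof.
move=> c3 csq2.
(* The coordinates are forced: [E 7] has coordinate c(x), and since Sq^1 [E 6] = [E 7] and Sq^2
   [E 3] = [E 6] the others are c(Sq^1 x) and c(Sq^1 Sq^2 x). *)
pose F (x : X) : A1 := (c (gsq1 X (gsq2 X x)) : 'F_2) *: E 3 +
  (c (gsq1 X x) : 'F_2) *: E 6 + (c x : 'F_2) *: E 7.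
have FE j x : (j < 8)%N -> co j (F x) = c (gsq1 X (gsq2 X x)) * (3%N == j)%:R +
    c (gsq1 X x) * (6%N == j)%:R + c x * (7%N == j)%:R :> 'F_2.
  by move=> j8; rewrite !linearD !linearZ !coE.
have cpr m w : c (gpr X m w) = ((m == 3)%:R * c w : 'F_2).
  rewrite -[LHS]c3 gpr_pr eq_sym; case: eqP => [->|_]; first by rewrite mul1r c3.
  by rewrite linear0 mul0r.
have csq12 x : c (gsq1 X (gsq2 X (gsq1 X x))) = 0 by rewrite -gsq2_sq2 csq2.
have F_lin : linear F.
  by apply: linear_F2 => x y; rewrite /F !linearD !scalerDl; exact: addr6.
have mZ (b : bool) (v : 'F_2) (w : A1) : (b%:R * v) *: w = v *: (b%:R *: w).
  by rewrite mulrC scalerA.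
have F_pr n x : F (gpr X n x) = gpr (gshift (-3) A1) n (F x).
  have a3 : c (gsq1 X (gsq2 X (gpr X n x))) = ((n + 3 == edeg 3)%:R * c (gsq1 X (gsq2 X x)) : 'F_2).
    rewrite gsq2_pr gsq1_pr cpr; congr ((_ : bool)%:R * _).
    by rewrite -[edeg 3]/3%N; lia.
  have a6 : c (gsq1 X (gpr X n x)) = ((n + 3 == edeg 6)%:R * c (gsq1 X x) : 'F_2).
    rewrite gsq1_pr cpr; congr ((_ : bool)%:R * _).
    by rewrite -[edeg 6]/5%N; lia.
  have a7 : c (gpr X n x) = ((n + 3 == edeg 7)%:R * c x : 'F_2).
    rewrite cpr; congr ((_ : bool)%:R * _).
    by rewrite -[edeg 7]/6%N; lia.
  have e j : (j < 8)%N -> gpr A1 (n + 3) (E j) = (n + 3 == edeg j)%:R *: E j by apply: E_pr.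
  rewrite -[RHS]/(gpr A1 (n + 3) (F x)) /F a3 a6 a7 gprD gprD !gprZ.
  by rewrite (e 3%N isT) (e 6%N isT) (e 7%N isT) mZ mZ mZ.
have F_sq1 x : F (gsq1 X x) = gsq1 A1 (F x).
  rewrite /F csq12 gsq1_sq1 linear0 !gsq1D !gsq1Z !sq1_E.
  by rewrite !scale0r !scaler0 !add0r addr0.
have F_sq2 x : F (gsq2 X x) = gsq2 A1 (F x).
  rewrite /F csq2 !gsq2D !gsq2Z !sq2_E gsq2_sq2 gsq1_sq1 linear0.
  by rewrite !scale0r !scaler0 !add0r !addr0.
pose F' := @Ghom X (gshift (-3) A1) (mklin F_lin) F_pr F_sq1 F_sq2.
have F0 j x : (j < 8)%N -> (3%N == j) = false -> (6%N == j) = false ->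
    (7%N == j) = false -> co j (F x) = 0.
  by move=> j8 h3 h6 h7; rewrite FE // h3 h6 h7 !mulr0 !addr0.
have FQ x : exists k, QMark_incl k = F' x.
  by apply: QMark_mk; split; apply: F0.
have [f fE] := ghom_factor QMark_incl_inj FQ.
exists f => x; rewrite -[LHS]/(co 3 (QMark_incl (f x))) fE.
by rewrite -[LHS]/(co 3 (F x)) FE // mulr1 !mulr0 !addr0.
Qed.

(* The functional [c] vanishes on Sq^2 of q (x) p and takes the value 1 on
   Sq^1 Sq^2 (p (x) p), where p = Sq^1 and q = Sq^2 generate AugI. *)
Lemma divT_II : exists w : ghom (gtens AugI AugI) QMark, forall z, hB (w z) = ymul hI hI z.
Proof.
pose c : {linear gtens AugI AugI -> gF} := fmul (cI 5) (cI 1) \+ fmul (cI 2) (cI 4).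
have cE u v : c (tpure u v) = ((cI 5 u : 'F_2) * cI 1 v + (cI 2 u : 'F_2) * cI 4 v : 'F_2).
  by rewrite -!fmulE.
have cD x y : c (x + y) = (c x + c y : 'F_2) by exact: linearD.
have cI_deg j (n : int) : (j < 8)%N -> n + 1 = edeg j -> in_deg n (cI j).
  by move=> j8 e x; rewrite cI_pr // e eqxx mul1r.
have c3 : in_deg 3 c.
  apply: in_deg_add.
  + by apply: (@in_deg_fmul _ _ 3 0) => //; apply: cI_deg.
  + by apply: (@in_deg_fmul _ _ 1 2) => //; apply: cI_deg.
have csq2 z : c (gsq2 _ z) = 0.
  move: z; apply: (tens_lin_ext (f := c \o gsq2 (gtens AugI AugI)) (g := \0)) => u v.
  rewrite -[LHS]/(c (gsq2 (gtens AugI AugI) (tpure u v))) gtens_sq2p !cD !cE.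
  rewrite !cI_sq2 !cI_sq1 !mul0r !mulr0 !add0r !addr0.
  exact: addF2.
have [f fE] := QMark_hom c3 csq2.
exists f => z; rewrite fE.
move: z; apply: (tens_lin_ext (f := c \o (gsq1 (gtens AugI AugI) \o gsq2 (gtens AugI AugI))) (g := ymul hI hI)) => u v.
rewrite -[LHS]/(c (gsq1 (gtens AugI AugI) (gsq2 (gtens AugI AugI) (tpure u v)))).
rewrite !(gtens_sq1p, gtens_sq2p, gsq1D) !cD !cE.
rewrite !(cI_sq2, cI_sq1) !mul0r !mulr0 !add0r !addr0 ymulE.
by [].
Qed.

Lemma divT_swap s : divT [:: false, false & s] (true :: s).
Proof.
have [w wE] := divT_II.
have aux (Y : gmod) (y : ghom Y gF) (v : gtens (gtens AugI AugI) Y) :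
    ymul hB y (gtens_hom w (gid Y) v) = ymul hI (ymul hI y) (gassoc AugI AugI Y v).
  move: v; apply: (ghom_tens_ext (f := gcomp (ymul hB y) (gtens_hom w (gid Y)))
    (g := gcomp (ymul hI (ymul hI y)) (gassoc AugI AugI Y))) => v x.
  rewrite -[LHS]/(ymul hB y (gtens_hom w (gid Y) (tpure v x))) [gtens_hom w _ _]tmapE ymulE wE -(ymulE (ymul hI hI) y).
  move: v; apply: (tens_lin_ext (f := ymul (ymul hI hI) y \o tpl (gtens AugI AugI) x)
    (g := ymul hI (ymul hI y) \o (gassoc AugI AugI Y \o tpl (gtens AugI AugI) x))) => v v'.
  rewrite -[LHS]/(ymul (ymul hI hI) y (tpure (tpure v v') x)).
  rewrite -[RHS]/(ymul hI (ymul hI y) (gassoc AugI AugI Y (tpure (tpure v v') x))).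
  by rewrite gassocE !ymulE mulrA.
exists (gcomp (gtens_hom w (gid (T s))) (gassocV AugI AugI (T s))) => z.
rewrite -[RHS](congr1 (yT [:: false, false & s]) (gassocVK z)).
exact: aux.
Qed.

(** * Desuspension and failure of divisibility *)

Lemma connectiveA1 : connective A1.
Proof.
move=> n x n0; apply: A1_coP => j j8; rewrite co_pr // linear0.
have -> : (n == edeg j) = false by lia.
exact: mul0r.
Qed.

Lemma gpr0A1 x : gpr A1 0 x = (co 0 x : 'F_2) *: E 0.
Proof.
apply: A1_coP => j j8; rewrite co_pr //.
have -> : co j ((co 0 x : 'F_2) *: E 0) = (co 0 x : 'F_2) * (0%N == j)%:R.
  by rewrite linearZ coE.
by move: j j8; apply: forall8; rewrite ?mul0r ?mulr0 // mul1r mulr1.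
Qed.

Section Desuspend.
Variables (X Y : gmod) (yX : ghom X gF) (uX : X) (yY : ghom Y gF) (uY : Y).
Hypotheses (bX : bottom yX uX) (bY : bottom yY uY).

(* [r] extends to free covers and hence induces a map of cokernels. *)
Lemma desuspend (r : ghom (gtens AugI X) (gtens AugI Y)) :
  (forall z, ymul hI yY (r z) = ymul hI yX z) ->
  exists r' : ghom X Y, forall x, yY (r' x) = yX x.
Proof.
move=> hr.
have hn : null (gcomp (AugI_tens Y) r) by apply/null_proj_cod/gproj_SA1.
have [R RE] := AugI_extend hn.
pose C := connecting Y A1_aug.
have CR z : C (R (AugI_tens X z)) = 0 by rewrite RE; apply: aug_incl.
pose f : {linear X -> Y} := C \o (R \o tpr X (E 0 : SA1)).
have fE x : f x = C (R (tpure (E 0 : SA1) x)) by [].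
have incl1 : exists k, AugI_incl k = gsq1 SA1 (E 0) by apply: AugI_mk; rewrite co_sq1.
have incl2 : exists k, AugI_incl k = gsq2 SA1 (E 0) by apply: AugI_mk; rewrite co_sq2.
have f_pr n x : f (gpr X n x) = gpr Y n (f x).
  rewrite !fE -(ghom_pr C).
  have -> : tpure (E 0 : SA1) (gpr X n x) = gpr (gtens SA1 X) (n - 1) (tpure (E 0 : SA1) x).
    by rewrite (gpr_tpurel _ _ homog_SA1) opprK subrK.
  rewrite ghom_pr [gpr (gtens SA1 Y) _ _]gtens_shiftl_pr opprK subrK.
  by [].
have f_sq1 x : f (gsq1 X x) = gsq1 Y (f x).
  rewrite !fE -(ghom_sq1 C).
  have := ghom_sq1 R (tpure (E 0 : SA1) x); rewrite gtens_sq1p; have [k <-] := incl1.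
  move/(congr1 C); rewrite !linearD -AugI_tensE CR add0r => ->.
  by [].
have f_sq2 x : f (gsq2 X x) = gsq2 Y (f x).
  rewrite !fE -(ghom_sq2 C).
  have := ghom_sq2 R (tpure (E 0 : SA1) x); rewrite gtens_sq2p.
  have [k <-] := incl1; have [k' <-] := incl2.
  move/(congr1 C); rewrite !linearD -!AugI_tensE !CR !add0r => ->.
  by [].
pose r' := @Ghom X Y f f_pr f_sq1 f_sq2; exists r' => x.
have [cX prX y1X sqX] := bX; have [cY prY y1Y sqY] := bY.
rewrite -[LHS]/(gcomp yY r' x) (bottom_hom (gcomp yY r') bX) -[RHS]mulr1; congr (_ * _).
rewrite -[LHS]/(yY (C (R (tpure (E 0 : SA1) uX)))).
(* For degree reasons [w] is c times 1 (x) [uY]. Applying Sq^1 turns this into r(p (x) [uX]) = c p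
   (x) [uY], and comparing bottom coordinates gives c = 1. *)
set w := R _; set c : 'F_2 := yY (C w).
have wE : w = c *: (tpure (E 0) uY : gtens A1 Y).
  have -> : w = gpr (gtens A1 Y) 0 w.
    have <- : gpr (gtens SA1 Y) (-1) w = w.
      rewrite -ghom_pr (gpr_tpurel _ _ homog_SA1) subrr prX y1X scale1r.
      by [].
    by rewrite [gpr (gtens SA1 Y) _ _]gtens_shiftl_pr addNr gpr_pr.
  rewrite (connective_pr0 connectiveA1 cY) /c.
  have l : linear (fun z : gtens A1 Y => (yY (C z) : 'F_2) *: (tpure (E 0) uY : gtens A1 Y)).
    by move=> a u v; rewrite !linearP scalerDl -scalerA.
  move: w {c}; apply: (tens_lin_ext (g := mklin l)) => u v.
  rewrite tmapE gpr0A1 prY tpureZl tpureZr scalerA.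
  rewrite -[RHS]/((yY (C (tpure u v)) : 'F_2) *: _) connectingE linearZ co0_aug.
  by [].
have [_ _ yp _] := bottomI.
have inclp : AugI_incl pI = E 1 by apply: A1_coP => j j8; rewrite coE // -cI_p.
have e1 : AugI_tens Y (r (tpure pI uX)) = c *: (tpure (E 1) uY : gtens A1 Y).
  have := congr1 (gsq1 (gtens A1 Y)) wE.
  rewrite gsq1Z gtens_sq1p sqY linear0r addr0 sq1_E => <-.
  rewrite -[LHS]/(gcomp (AugI_tens Y) r (tpure pI uX)) -RE AugI_tensE inclp.
  rewrite -[RHS]/(gsq1 (gtens SA1 Y) w) -ghom_sq1 gtens_sq1p sqX linear0r addr0.
  by rewrite -[gsq1 SA1 (E 0)]/(gsq1 A1 (E 0)) sq1_E.
have aux z : fmul (X := A1) (co 1) yY (AugI_tens Y z) = ymul hI yY z.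
  move: z; apply: (tens_lin_ext (f := fmul (X := A1) (co 1) yY \o AugI_tens Y) (g := ymul hI yY)) => u v.
  by rewrite -[LHS]/(fmul (X := A1) (co 1) yY (AugI_tens Y (tpure u v))) AugI_tensE fmulE ymulE.
have := aux (r (tpure pI uX)); rewrite hr ymulE yp y1X mulr1 e1 linearZ.
rewrite -[X in X = _]/(c * fmul (X := A1) (co 1) yY (tpure (E 1) uY)) fmulE coE // y1Y !mulr1.
by [].
Qed.
End Desuspend.

Lemma bottom_val (X Y : gmod) (y : ghom X gF) u (y' : ghom Y gF) u' (z : ghom X Y) :
  bottom y u -> bottom y' u' -> (forall x, y' (z x) = y x) -> z u = u'.
Proof.
move=> [_ pr y1 _] [_ pr' _ _] zE.
have e : gpr X 0 u = u by rewrite pr y1 scale1r.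
by rewrite -e ghom_pr pr' zE y1 scale1r.
Qed.

(** In [AugI] the relation Sq^2 q = Sq^1 Sq^2 p holds. A map to [QMark] kills q, as degree 1
    vanishes there, but Sq^1 Sq^2 of the bottom class of [QMark] is the top class. *)
Lemma not_divT_IB : ~ divT [:: false] [:: true].
Proof.
move=> [z zE]; pose o : gF := (1 : 'F_2).
have hz : z (tpure pI o) = tpure pB o := bottom_val (bottomT _) (bottomT _) zE.
have [cI_conn _ _ _] := bottomI; have [cB_conn _ _ _] := bottomB.
have [cF _ _ _] := bottomF.
have homq : homog 1 qI by rewrite /homog gpr1I cI_q // scale1r.
have hq : z (tpure qI o) = 0.
  have -> : tpure qI o = gpr (gtens AugI gF) 1 (tpure qI o).
    by rewrite (gpr_tpurel _ _ homq) subrr /= scale1r.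
  rewrite ghom_pr -[gpr (T [:: true]) 1 _]/(gpr (gtens QMark gF) 1 _) (connective_pr1 cB_conn cF).
  move: (z _); apply: (tens_lin_ext (f := tmap (gpr QMark 0) (gpr gF 1) \+ tmap (gpr QMark 1) (gpr gF 0)) (g := \0)) => u v.
  rewrite -[LHS]/(tmap (gpr QMark 0) (gpr gF 1) (tpure u v) + tmap (gpr QMark 1) (gpr gF 0) (tpure u v)).
  by rewrite !tmapE gpr1B linear0l addr0 /= scale0r linear0r.
have e : gsq2 AugI qI = gsq1 AugI (gsq2 AugI pI).
  apply: cI_ext; apply: forall8; rewrite ?cI0 // ?cI_sq1 ?cI_sq2 ?cI_sq1 ?cI_sq2;
  by rewrite ?cI_p ?cI_q.
have := ghom_sq2 z (tpure qI o); rewrite hq linear0 gtens_sq2p !linear0r !addr0 e.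
have -> : tpure (gsq1 AugI (gsq2 AugI pI)) o =
    gsq1 (gtens AugI gF) (gsq2 (gtens AugI gF) (tpure pI o)).
  by rewrite gtens_sq2p !linear0r !addr0 gtens_sq1p linear0r addr0.
rewrite ghom_sq1 ghom_sq2 hz gtens_sq2p !linear0r !addr0 gtens_sq1p linear0r addr0.
move/(congr1 (fmul (cB 7) (gid gF))); rewrite fmulE linear0 cB_sq1 cB_sq2 cB_p //.
Qed.

(** Sq^2 Sq^1 Sq^2 annihilates the bottom class of [QMark], but sends p = Sq^1 to the socle element
    [E 7]. *)
Lemma not_divT_BI : ~ divT [:: true] [:: false].
Proof.
move=> [z zE]; pose o : gF := (1 : 'F_2).
have hz : z (tpure pB o) = tpure pI o := bottom_val (bottomT _) (bottomT _) zE.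
have s2 (V : gmod) (v : V) : gsq2 (gtens V gF) (tpure v o) = tpure (gsq2 V v) o.
  by rewrite gtens_sq2p !linear0r !addr0.
have s1 (V : gmod) (v : V) : gsq1 (gtens V gF) (tpure v o) = tpure (gsq1 V v) o.
  by rewrite gtens_sq1p !linear0r !addr0.
have e : gsq2 QMark (gsq1 QMark (gsq2 QMark pB)) = 0.
  apply: cB_ext; apply: forall8; rewrite ?cB0 ?linear0 //;
    by rewrite ?cB_sq2 ?cB_sq1.
have : z (tpure (gsq2 QMark (gsq1 QMark (gsq2 QMark pB))) o) =
    tpure (gsq2 AugI (gsq1 AugI (gsq2 AugI pI))) o.
  by rewrite -!s2 -!s1 -!s2 ghom_sq2 ghom_sq1 ghom_sq2 hz s2 s1 s2.
rewrite e linear0l linear0 => /esym.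
move/(congr1 (fmul (cI 7) (gid gF))); rewrite fmulE linear0 cI_sq2 cI_sq1 cI_sq2 cI_p //.
Qed.

Lemma divT_desuspend r s s' : divT (nseq r false ++ s) (nseq r false ++ s') -> divT s s'.
Proof.
elim: r => // r IH [z zE]; apply: IH.
have [z' zE'] := desuspend (bottomT _) (bottomT _) (r := z) zE.
by exists z'.
Qed.

(** * Reduced stable retracts *)

(* [g \o f = 1 + N] where [N] increases the radical filtration, because all
   terms of a trace but [h Sq^2 Sq^2 Sq^2 = 0] have values in Sq^1 L + Sq^2 L;
   hence [(g \o f)^8 = 1]. *)
Section Retract.
Variables (L M : gmod) (f : ghom L M) (g : ghom M L).
Hypothesis Lred : reduced L.
Hypothesis gf : null (fun x => g (f x) + x).

Fixpoint radical (n : nat) (x : L) : Prop :=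
  if n is n'.+1 then exists u v, [/\ radical n' u, radical n' v & x = gsq1 L u + gsq2 L v]
  else True.

Lemma word21212 (x : L) : gsq2 L (gsq1 L (gsq2 L (gsq1 L (gsq2 L x)))) = 0.
Proof. by rewrite -(gsq2_sq2 (gsq2 L x)) !gsq2_sq2 gsq1_sq1 !linear0. Qed.
Lemma word12121 (x : L) : gsq1 L (gsq2 L (gsq1 L (gsq2 L (gsq1 L x)))) = 0.
Proof. by rewrite -(gsq2_sq2 x) (gsq2_sq2 (gsq2 L x)) gsq1_sq1. Qed.

(** Alternating words of length 5 act as zero. Each of the following lemmas trades a letter of the
    word for a step in the filtration, until the fifth step is zero. *)
Lemma radical1 x : radical 1 x -> gsq1 L (gsq2 L (gsq1 L (gsq2 L x))) = 0 /\
  gsq2 L (gsq1 L (gsq2 L (gsq1 L x))) = 0.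
Proof.
move=> [u [v [_ _ ->]]]; rewrite !(gsq1D, gsq2D) word21212 word12121 gsq1_sq1.
by rewrite gsq2_sq2 gsq1_sq1 !linear0 !addr0.
Qed.

Lemma radical2 x : radical 2 x ->
  gsq1 L (gsq2 L (gsq1 L x)) = 0 /\ gsq2 L (gsq1 L (gsq2 L x)) = 0.
Proof.
move=> [u [v [/radical1[u1 u2] /radical1[v1 v2] ->]]].
rewrite !gsq1D !gsq2D !gsq1D !gsq2D gsq1_sq1 !gsq2_sq2 !gsq1_sq1 !linear0.
by rewrite ?u1 ?u2 ?v1 ?v2 !addr0.
Qed.

Lemma radical3 x : radical 3 x ->
  [/\ gsq1 L (gsq2 L x) = 0, gsq2 L (gsq1 L x) = 0 & gsq2 L (gsq2 L x) = 0].
Proof.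
move=> [u [v [/radical2[u1 u2] /radical2[v1 v2] ->]]].
rewrite !(gsq1D, gsq2D) !gsq2_sq2 !gsq1_sq1 ?u1 ?u2 ?v1 ?v2 !linear0 !addr0.
by [].
Qed.

Lemma radical5 x : radical 5 x -> x = 0.
Proof.
have r4 y : radical 4 y -> gsq1 L y = 0 /\ gsq2 L y = 0.
  move=> [u [v [/radical3[u1 u2 u3] /radical3[v1 v2 v3] ->]]].
  by rewrite !(gsq1D, gsq2D) gsq1_sq1 u2 v1 v3 !addr0.
by move=> [u [v [/r4[u1 _] /r4[_ v2] ->]]]; rewrite u1 v2 addr0.
Qed.

Let N : ghom L L := gadd (gcomp g f) (gid L).
Let NE x : g (f x) = x + N x.
Proof. by rewrite -[N x]/(g (f x) + x) addrCA char2 addr0. Qed.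

Lemma radical_step n x : radical n x -> radical n.+1 (N x).
Proof.
elim: n x => [x _|n IH x [u [v [hu hv ->]]]].
  have [h [_ hE]] := gf; rewrite -[N x]hE.
  exists (d2 (d2 h) (gsq1 L x) + d2 h (gsq1 L (gsq2 L x)) + h (gsq1 L (gsq2 L (gsq2 L x)))).
  exists (d2 (d2 h) x + d2 h (gsq2 L x) + h (gsq2 L (gsq2 L x))); split=> //.
  rewrite -[trace h x]/(d2 (d2 (d2 h)) x) [LHS]d2E.
  rewrite [d2 (d2 h) (gsq2 L x)]d2E [d2 h (gsq2 L (gsq2 L x))]d2E Lred linear0 addr0.
  rewrite !(gsq1D, gsq2D).
  by rewrite [LHS](AC (2*(2*2)) ((2*4*6)*(1*3*5))).
exists (N u), (N v); split; [exact: IH | exact: IH |].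
by rewrite linearD ghom_sq1 ghom_sq2.
Qed.

Lemma reduced_retract : exists (a : ghom L M) (b : ghom M L), cancel a b.
Proof.
(* The product [M4] [M2] [M1] is the seventh power of [M1]. In characteristic 2 repeated squaring of
   1 + N gives 1 + N^8, and 8 is the first power of 2 that is at least 5. *)
pose M1 := gcomp g f; pose M2 := gcomp M1 M1; pose M4 := gcomp M2 M2.
exists (gcomp f (gcomp M4 (gcomp M2 M1))), g => x.
rewrite -[LHS]/(M4 (M4 x)).
have sq (A : ghom L L) (K : ghom L L) : (forall y, A y = y + K y) ->
    forall y, A (A y) = y + K (K y).
  move=> AE y; rewrite (AE (A y)) (AE y) linearD.
  by rewrite -addrA [K y + (_ + _)]addrA char2 add0r.
have e2 := sq M1 N NE; have e4 := sq M2 (gcomp N N) e2.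
have e8 := sq M4 (gcomp (gcomp N N) (gcomp N N)) e4.
rewrite e8 -[RHS]addr0; congr (_ + _).
have r := radical_step (radical_step (radical_step (radical_step (radical_step (I : radical 0 x))))).
rewrite -[LHS]/(N (N (N (N (N (N (N (N x)))))))) (radical5 r).
by rewrite !linear0.
Qed.
End Retract.

(** * Kernels of maps to F *)

Section KernelRetraction.
Variables (L : gmod) (phi : ghom L gF) (u : L).
Hypotheses (u0 : homog 0 u) (phiu : phi u = 1 :> 'F_2).

Let ker_decomp l : exists k, gker_incl phi k = l + (phi l : 'F_2) *: u.
Proof.
apply: gker_inclE; rewrite linearD linearZ phiu.
by rewrite -[X in _ + X]/((phi l : 'F_2) * 1) mulr1 char2.
Qed.
Let exr := choice ker_decomp.
Let r := projT1 exr.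
Let rE l : gker_incl phi (r l) = l + (phi l : 'F_2) *: u := projT2 exr l.
Let r_lin : linear r.
Proof.
apply: linear_F2 => x y; apply: gker_incl_inj; rewrite [RHS]linearD !rE.
by rewrite linearD scalerDl addrACA.
Qed.
Definition ker_ret : {linear L -> gker phi} := mklin r_lin.
Lemma ker_retE l : gker_incl phi (ker_ret l) = l + (phi l : 'F_2) *: u.
Proof. exact: rE. Qed.
Lemma ker_retK x : ker_ret (gker_incl phi x) = x.
Proof. by apply: gker_incl_inj; rewrite ker_retE gker_inclP scale0r addr0. Qed.
Lemma ker_ret_deg : hdeg 0 ker_ret.
Proof.
move=> n x; apply: gker_incl_inj; rewrite addr0 ghom_pr !ker_retE gprD gprZ.
congr (_ + _); rewrite -u0 gpr_pr u0 ghom_pr.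
rewrite -[gpr gF n _]/(((n == 0)%:R : 'F_2) * phi x).
by case: eqP => _; rewrite ?mul1r // mul0r scale0r scaler0.
Qed.

Variable A : gmod.
Definition ker_tens : ghom (gtens (gker phi) A) (gtens L A) :=
  gtens_hom (gker_incl phi) (gid A).
Lemma ker_tensE k a : ker_tens (tpure k a) = tpure (gker_incl phi k) a.
Proof. exact: tmapE. Qed.

Lemma ker_tensK : cancel ker_tens (tensl A ker_ret).
Proof.
apply: (tens_lin_ext (f := tensl A ker_ret \o ker_tens) (g := idfun)) => x a.
by rewrite -[LHS]/(tensl A ker_ret (ker_tens (tpure x a))) ker_tensE tenslE ker_retK.
Qed.

Lemma ker_tens_decomp z :
  z = ker_tens (tensl A ker_ret z) + tpure u (connecting A phi z).
Proof.
move: z; apply: (tens_lin_ext (f := idfun)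
  (g := (ker_tens \o tensl A ker_ret) \+ (tpr A u \o connecting A phi))) => l a.
rewrite -[RHS]/(ker_tens (tensl A ker_ret (tpure l a)) + tpure u (connecting A phi (tpure l a))).
rewrite tenslE ker_tensE ker_retE connectingE tpureZr tpureDl tpureZl.
by rewrite -addrA char2 addr0.
Qed.

Lemma connecting_ker_tens z : connecting A phi (ker_tens z) = 0.
Proof.
move: z; apply: (tens_lin_ext (f := connecting A phi \o ker_tens) (g := \0)) => k a.
rewrite -[LHS]/(connecting A phi (ker_tens (tpure k a))) ker_tensE connectingE gker_inclP.
exact: scale0r.
Qed.

Lemma ker_tens_exact z : connecting A phi z = 0 -> exists w, ker_tens w = z.
Proof.
move=> e; exists (tensl A ker_ret z).
by rewrite [RHS]ker_tens_decomp e linear0r addr0.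
Qed.

Lemma connecting_surj a : exists z, connecting A phi z = a.
Proof. by exists (tpure u a); rewrite connectingE phiu scale1r. Qed.

Lemma gpr_tpure_u (M : gmod) n (m : M) :
  gpr (gtens M L) n (tpure m u) = tpure (gpr M n m) u.
Proof.
by rewrite -(gswapE u m) -ghom_pr (gpr_tpurel _ _ u0) subr0 gswapE.
Qed.

(* If multiplication by [y] vanishes on the kernel of [phi] then multiplication
   by [y] on [L] differs from a stably zero map by a map that factors through
   [phi]. *)
Lemma split_div (M : gmod) (y : ghom M gF) : null (connecting (gker phi) y) ->
  exists r : ghom M L, forall m, phi (r m) = y m.
Proof.
move=> [h [hd hE]].
pose rho : {linear gtens M L -> gtens M (gker phi)} := tmap idfun ker_ret.
have rhoE m l : rho (tpure m l) = tpure m (ker_ret l) by exact: tmapE.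
pose j : ghom (gtens M (gker phi)) (gtens M L) := gtens_hom (gid M) (gker_incl phi).
have jE m k : j (tpure m k) = tpure m (gker_incl phi k) by exact: tmapE.
have rho_deg : hdeg 0 rho.
  move=> n; apply: (gtens_homog_ext (f := rho \o gpr (gtens M L) n)
    (g := gpr (gtens M (gker phi)) (n + 0) \o rho)) => i i' m l.
  rewrite -[LHS]/(rho (gtens_pr M L n _)).
  rewrite -[RHS]/(gtens_pr M (gker phi) (n + 0) (rho _)) gtens_prE !rhoE ker_ret_deg.
  rewrite gtens_prE !addr0; case: eqP => _; last by rewrite linear0.
  by rewrite rhoE ker_ret_deg addr0.
have kd : hdeg (-6) (h \o rho).
  by move=> n z; rewrite -[LHS]/(h (rho (gpr (gtens M L) n z))) rho_deg addr0 hd.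
pose E' := trace_hom kd.
have E'j z : E' (j z) = connecting (gker phi) y z.
  rewrite -hE -[LHS]/((trace (h \o rho) \o j) z) -trace_compr.
  apply: eq_trace => {}z; rewrite -[LHS]/(h (rho (j z))); congr (h _).
  move: z; apply: (tens_lin_ext (f := rho \o j) (g := idfun)) => m k.
  by rewrite -[LHS]/(rho (j (tpure m k))) jE rhoE ker_retK.
(* On M (x) ker phi the two summands agree, so [R] vanishes there and is determined by its values at
   m (x) u. As Sq^1 u and Sq^2 u lie in ker phi, m |-> R(m (x) u) is a module map. *)
pose R := gadd (connecting L y) (gcomp (gker_incl phi) E').
have RE z : R z = connecting L y z + gker_incl phi (E' z) by [].
have R0 m l : phi l = 0 -> R (tpure m l) = 0.
  move/gker_inclE => [k <-]; rewrite RE -jE E'j jE !connectingE.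
  by rewrite [X in _ + X]linearZ char2.
pose f : {linear M -> L} := R \o tpl M u.
have fE m : f m = R (tpure m u) by [].
have f_pr n m : f (gpr M n m) = gpr L n (f m).
  by rewrite !fE -gpr_tpure_u ghom_pr.
have phis1 : phi (gsq1 L u) = 0 by rewrite ghom_sq1.
have phis2 : phi (gsq2 L u) = 0 by rewrite ghom_sq2.
have f_sq1 m : f (gsq1 M m) = gsq1 L (f m).
  by rewrite !fE -ghom_sq1 gtens_sq1p linearD (R0 m _ phis1) addr0.
have f_sq2 m : f (gsq2 M m) = gsq2 L (f m).
  rewrite !fE -ghom_sq2 gtens_sq2p !linearD (R0 _ _ phis1) (R0 _ _ phis2).
  by rewrite !addr0.
exists (@Ghom M L f f_pr f_sq1 f_sq2) => m.
rewrite -[LHS]/(phi (R (tpure m u))) RE linearD gker_inclP addr0 connectingE linearZ phiu.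
exact: (mulr1 (y m : 'F_2)).
Qed.
End KernelRetraction.

Lemma homog0_of (L : gmod) (phi : ghom L gF) : (exists x, phi x <> 0) ->
  exists u, homog 0 u /\ phi u = 1 :> 'F_2.
Proof.
move=> [x px]; exists (gpr L 0 x); split; first by rewrite /homog gpr_pr eqxx.
rewrite ghom_pr -[LHS]/(1 *: phi x) scale1r.
by have [|] := F2_cases (phi x).
Qed.

(** * Schanuel's lemma and comparison with the models *)

Section Schanuel.
Variables (K1 K2 P1 P2 M : gmod).
Variables (i1 : ghom K1 P1) (p1 : ghom P1 M) (i2 : ghom K2 P2) (p2 : ghom P2 M).
Hypotheses (i1_inj : injective i1) (i2_inj : injective i2).
Hypotheses (z1 : forall x, p1 (i1 x) = 0) (z2 : forall x, p2 (i2 x) = 0).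
Hypotheses (ex1 : forall x, p1 x = 0 -> exists k, i1 k = x).
Hypotheses (ex2 : forall x, p2 x = 0 -> exists k, i2 k = x).
Hypotheses (s1 : forall y, exists x, p1 x = y) (s2 : forall y, exists x, p2 x = y).
Hypotheses (h1 : gproj P1) (h2 : gproj P2).

(** Lift each cover through the other. The composite P1 -> P2 -> P1 plus the identity covers 0,
    hence takes values in K1, so on K1 the difference from the identity factors through P1. *)
Lemma schanuel : sret K1 K2.
Proof.
have [la laE] := gproj_gprojective h1 p1 s2.
have [mu muE] := gproj_gprojective h2 p2 s1.
have [a aE] : exists a : ghom K1 K2, forall x, i2 (a x) = gcomp la i1 x.
  apply: ghom_factor => // x; apply: ex2.
  by rewrite gcompE -[LHS]/((p2 \o la) (i1 x)) laE z1.
have [b bE] : exists b : ghom K2 K1, forall x, i1 (b x) = gcomp mu i2 x.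
  apply: ghom_factor => // x; apply: ex1.
  by rewrite gcompE -[LHS]/((p1 \o mu) (i2 x)) muE z2.
have [d dE] : exists d : ghom P1 K1, forall x, i1 (d x) = gadd (gcomp mu la) (gid _) x.
  apply: ghom_factor => // x; apply: ex1.
  rewrite -[gadd _ _ x]/(mu (la x) + x) linearD -[X in X + _]/((p1 \o mu) (la x)) muE.
  by rewrite -[X in X + _]/((p2 \o la) x) laE char2.
exists a, b; apply: eq_null (null_compr i1 (null_proj_dom d h1)) => x.
apply: i1_inj; rewrite linearD bE gcompE aE -[LHS]/(i1 (d (i1 x))) dE.
by [].
Qed.
End Schanuel.

Section SA1Counit.
Variable X : gmod.
Let C : {linear gtens SA1 X -> X} := connecting X A1_aug.
Let C_pr n z : C (gpr (gtens SA1 X) n z) = gpr (gshift (-1) X) n (C z).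
Proof.
rewrite [gpr (gtens SA1 X) n z]gtens_shiftl_pr.
exact: (ghom_pr (connecting X A1_aug)).
Qed.
Definition SA1_counit : ghom (gtens SA1 X) (gshift (-1) X) :=
  @Ghom (gtens SA1 X) (gshift (-1) X) C C_pr
   (ghom_sq1 (connecting X A1_aug)) (ghom_sq2 (connecting X A1_aug)).

Lemma SA1_counit_incl z : SA1_counit (AugI_tens X z) = 0.
Proof. exact: aug_incl. Qed.

Lemma SA1_counit_surj y : exists x, SA1_counit x = y.
Proof.
exists (tpure A1_one (y : X)); exact: (connecting_aug_one (y : X)).
Qed.

Lemma SA1_counit_exact z : SA1_counit z = 0 -> exists w, AugI_tens X w = z.
Proof.
move=> e; exists (tensl X aug_ret z).
suff -> : z = AugI_tens X (tensl X aug_ret z) + tpure (E 0) (SA1_counit z).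
  have -> : tpure (E 0) (SA1_counit z) = 0 by rewrite e; exact: linear0r.
  rewrite addr0; congr (AugI_tens _ _).
  by rewrite AugI_tensK.
clear e; move: z; apply: (tens_lin_ext (f := idfun) (g := (AugI_tens X \o tensl X aug_ret)
  \+ (tpr X (E 0 : SA1) \o C))) => a x.
rewrite -[RHS]/(AugI_tens X (tensl X aug_ret (tpure a x)) +
  tpure (E 0) (connecting X A1_aug (tpure a x))).
rewrite tenslE AugI_tensE aug_retE connectingE co0_aug.
rewrite (tpureZr (X := SA1)) (tpureDl (X := SA1)) (tpureZl (X := SA1)).
by rewrite -addrA char2 addr0.
Qed.
End SA1Counit.

Lemma sret_Joker : sret (gtens AugI Joker) QMark.
Proof.
apply: (@schanuel _ _ (gtens SA1 Joker) (gshift (-3) A1) (gshift (-1) Joker)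
  (AugI_tens Joker) (SA1_counit Joker) QMark_incl Joker_pi).
- exact: AugI_tens_inj.
- exact: QMark_incl_inj.
- exact: SA1_counit_incl.
- exact: gker_inclP.
- exact: SA1_counit_exact.
- exact: gker_inclE.
- exact: SA1_counit_surj.
- exact: Joker_pi_surj.
- exact: gproj_SA1.
- exact/gproj_shift/gproj_A1.
Qed.

(** The innermost Omega Sigma^{-1} is the one that absorbs J, [sret_Joker] replacing the product by
    [QMark]. *)
Lemma sret_T k (d : bool) :
  sret (gtens (gtpow OmegaF k.+1) (gshift (- k.+1%:Z) (gtpow Joker d)))
       (T (nseq k false ++ [:: d])).
Proof.
apply: sret_trans (sret_OmegaDesusp _ _) _.
elim: k => [|k IH]; last first.
  by apply: sret_tensr; apply: sret_trans (sret_OmegaDesusp _ _) IH.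
apply: sret_trans (sret_tensr AugI (sret_OmegaDesusp0 _)) _.
case: d => /=.
  exact: sret_trans (ret_sret (@gassocVK AugI Joker gF)) (sret_tensl gF sret_Joker).
by exists (gid _), (gid _); apply: eq_null (null0 _ _) => x; rewrite char2.
Qed.

(** * Direct sums and stable equivalences *)

Section SumMaps.
Variables M N : gmod.
Let inl_lin : linear (fun x : M => (x, 0) : gsum M N).
Proof. by move=> a x y; congr pair; rewrite /= scaler0 addr0. Qed.
Let inr_lin : linear (fun y : N => (0, y) : gsum M N).
Proof. by move=> a x y; congr pair; rewrite /= scaler0 addr0. Qed.
Let fst_lin : linear (fun z : gsum M N => z.1).
Proof. by []. Qed.
Let snd_lin : linear (fun z : gsum M N => z.2).
Proof. by []. Qed.
Let inl_pr n x : mklin inl_lin (gpr M n x) = gpr (gsum M N) n (mklin inl_lin x).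
Proof. by congr pair; rewrite linear0. Qed.
Let inl_sq1 x : mklin inl_lin (gsq1 M x) = gsq1 (gsum M N) (mklin inl_lin x).
Proof. by congr pair; rewrite linear0. Qed.
Let inl_sq2 x : mklin inl_lin (gsq2 M x) = gsq2 (gsum M N) (mklin inl_lin x).
Proof. by congr pair; rewrite linear0. Qed.
Let inr_pr n x : mklin inr_lin (gpr N n x) = gpr (gsum M N) n (mklin inr_lin x).
Proof. by congr pair; rewrite linear0. Qed.
Let inr_sq1 x : mklin inr_lin (gsq1 N x) = gsq1 (gsum M N) (mklin inr_lin x).
Proof. by congr pair; rewrite linear0. Qed.
Let inr_sq2 x : mklin inr_lin (gsq2 N x) = gsq2 (gsum M N) (mklin inr_lin x).
Proof. by congr pair; rewrite linear0. Qed.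
Definition ginl : ghom M (gsum M N) := @Ghom M (gsum M N) (mklin inl_lin) inl_pr inl_sq1 inl_sq2.
Definition ginr : ghom N (gsum M N) := @Ghom N (gsum M N) (mklin inr_lin) inr_pr inr_sq1 inr_sq2.
Definition gfst : ghom (gsum M N) M :=
  @Ghom (gsum M N) M (mklin fst_lin) (fun _ _ => erefl) (fun=> erefl) (fun=> erefl).
Definition gsnd : ghom (gsum M N) N :=
  @Ghom (gsum M N) N (mklin snd_lin) (fun _ _ => erefl) (fun=> erefl) (fun=> erefl).
Lemma gsum_decomp z : z = ginl (gfst z) + ginr (gsnd z) :> gsum M N.
Proof. by case: z => a b; congr pair; rewrite /= ?addr0 ?add0r. Qed.
End SumMaps.

Lemma gfree_gprojective P : gfree P -> gprojective P.
Proof.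
move=> [I [d [b [hb hfree]]]] M N p f psurj.
have ex i : exists x, homog (d i) x /\ p x = f (b i).
  have [x px] := psurj (f (b i)); exists (gpr M (d i) x).
  by rewrite /homog gpr_pr eqxx ghom_pr px -ghom_pr hb.
have [c hc] := choice ex.
have [[g gE] _] := hfree M c (fun i => (hc i).1).
exists g => x.
have [_ uniq] := hfree N (f \o b) (fun i => etrans (esym (ghom_pr f _ _)) (congr1 f (hb i))).
apply: (uniq (gcomp p g) f) => i.
by rewrite gcompE gE (hc i).2.
Qed.

Lemma is_red_sret M N : is_red M N -> reduced N /\ sret N M.
Proof.
move=> [Nred [P [_ [e /ghom_inv[e' [eK e'K]]]]]]; split=> //.
apply: (ret_sret (f := gcomp e' (ginr P N)) (g := gcomp (gsnd P N) e)) => x.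
by rewrite !gcompE e'K.
Qed.

Definition null_equiv (M N : gmod) : Prop := exists (f : ghom M N) (g : ghom N M),
  null (fun x => g (f x) + x) /\ null (fun y => f (g y) + y).

Lemma null_equivP M N : null_equiv M N <-> stably_iso M N.
Proof.
split=> -[f [g [h1 h2]]]; exists f, g; first by split; apply/stably_eqP.
by move: h1 h2 => /stably_eqP h1 /stably_eqP h2.
Qed.

Lemma null_equiv_trans M N P : null_equiv M N -> null_equiv N P -> null_equiv M P.
Proof.
move=> [f [g [h1 h2]]] [f' [g' [h1' h2']]]; exists (gcomp f' f), (gcomp g g'); split.
  apply: eq_null (null_add (null_compl g (null_compr f h1')) h1) => x.
  by rewrite !gcompE /= linearD -addrA [X in _ + X]addrA char2 add0r.
apply: eq_null (null_add (null_compl f' (null_compr g' h2)) h2') => x.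
by rewrite !gcompE /= linearD -addrA [X in _ + X]addrA char2 add0r.
Qed.

Lemma null_equiv_sum M N P : null_equiv M N -> null_equiv (gsum M P) (gsum N P).
Proof.
move=> [f [g [h1 h2]]].
pose F (A B : gmod) (k : ghom A B) :=
  gadd (gcomp (ginl B P) (gcomp k (gfst A P))) (gcomp (ginr B P) (gsnd A P)).
have FE A B (k : ghom A B) z : F A B k z = (k z.1, z.2) :> gsum B P.
  by congr pair; rewrite /= ?addr0 ?add0r.
exists (F _ _ f), (F _ _ g); split.
  apply: eq_null (null_compl (ginl M P) (null_compr (gfst M P) h1)) => z.
  by rewrite !FE; case: z => a b; congr pair; rewrite /= char2.
apply: eq_null (null_compl (ginl N P) (null_compr (gfst N P) h2)) => z.
by rewrite !FE; case: z => a b; congr pair; rewrite /= char2.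
Qed.

Lemma is_red_equiv M N : is_red M N -> null_equiv M N.
Proof.
move=> [_ [P [hP [e /ghom_inv[e' [eK e'K]]]]]].
have hP' : gproj P := gprojective_gproj (gfree_gprojective hP).
exists (gcomp (gsnd P N) e), (gcomp e' (ginr P N)); split; last first.
  by apply: eq_null (null0 _ _) => x; rewrite !gcompE e'K /= char2.
apply: eq_null (null_compl (gcomp e' (ginl P N)) (null_compr (gcomp (gfst P N) e) hP')) => x.
rewrite -[LHS]/(e' (ginl P N (gfst P N (e x)))).
rewrite -[RHS]/(e' (ginr P N (gsnd P N (e x))) + x).
have xE : e' (ginl P N (gfst P N (e x))) + e' (ginr P N (gsnd P N (e x))) = x.
  by rewrite -linearD -gsum_decomp eK.
by rewrite -[X in _ = _ + X]xE addrCA char2 addr0.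
Qed.

Section NullKernel.
Variables (K M N P W : gmod).
Variables (i : ghom K M) (f : ghom M N) (j : ghom W P) (p : ghom P N).
Hypotheses (i_inj : injective i) (j_inj : injective j).
Hypotheses (fi : forall x, f (i x) = 0) (pj : forall x, p (j x) = 0).
Hypotheses (f_ex : forall x, f x = 0 -> exists k, i k = x).
Hypotheses (p_ex : forall x, p x = 0 -> exists k, j k = x).
Hypotheses (f_surj : forall y, exists x, f x = y) (p_surj : forall y, exists x, p x = y).
Hypotheses (hP : gproj P) (hf : null f).

(* The pullback of [f] and [p] is both [W (+) M] and [K (+) P]. *)
Lemma null_kernel : null_equiv K (gsum W M).
Proof.
have /stably_zeroP[P' [u [v [hP' fE]]]] := hf.
have [v' v'E] := hP' _ _ p v p_surj.
(* A stably zero map lifts along any surjection; the lift [ft] splits the projection of the pullback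
   to M, and [s] splits the one to P. *)
pose ft := gcomp v' u.
have ftE x : p (ft x) = f x by rewrite fE -[RHS]v'E.
have [s sE0] := gproj_gprojective hP p f_surj.
have sE x : f (s x) = p x by exact: sE0.
have [w wE] : exists w : ghom K W, forall x, j (w x) = gcomp ft i x.
  by apply: ghom_factor => // x; apply: p_ex; rewrite gcompE ftE fi.
pose q := gadd (gcomp j (gfst W M)) (gcomp ft (gsnd W M)).
have qE z : q z = j z.1 + ft z.2 by [].
have pq z : p (q z) = f z.2 by rewrite qE linearD pj add0r ftE.
have [g gE] : exists g : ghom (gsum W M) K, forall z,
    i (g z) = gadd (gsnd W M) (gcomp s q) z.
  apply: ghom_factor => // z; apply: f_ex.
  by rewrite -[gadd _ _ z]/(z.2 + s (q z)) linearD sE pq char2.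
have giE z : i (g z) = z.2 + s (q z) by rewrite gE.
pose a := gadd (gcomp (ginl W M) w) (gcomp (ginr W M) i).
have aE k : a k = (w k, i k) :> gsum W M.
  by congr pair; rewrite /= ?addr0 ?add0r.
have [b bE] : exists b : ghom P W, forall x, j (b x) = gadd (gid P) (gcomp ft s) x.
  apply: ghom_factor => // x; apply: p_ex.
  by rewrite -[gadd _ _ x]/(x + ft (s x)) linearD ftE sE char2.
exists a, g; split.
  apply: eq_null (null0 _ _) => k; apply: i_inj.
  rewrite linear0 linearD giE aE qE wE gcompE /= char2 linear0 addr0 char2.
  by [].
pose c := gadd (gcomp (ginl W M) b) (gcomp (ginr W M) s).
have cE x : c x = (b x, s x) :> gsum W M.
  by congr pair; rewrite /= ?addr0 ?add0r.
(* The composite on W (+) M differs from the identity by a map through [q], hence through the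
   projective P. *)
apply: eq_null (null_compr q (null_proj_dom c hP)) => z.
rewrite aE -[LHS]/(c (q z)) cE -[RHS]/((w (g z) + z.1, i (g z) + z.2) : gsum W M).
congr pair; last by rewrite giE addrC addrA char2 add0r.
apply: j_inj; rewrite bE (linearD j) wE gcompE giE (linearD ft).
by rewrite -[LHS]/(q z + ft (s (q z))) [RHS]addrC addrA qE.
Qed.
End NullKernel.

(** * The splitting criterion *)

Lemma iso_null_equiv (M N : gmod) (f : ghom M N) (g : ghom N M) :
  cancel f g -> cancel g f -> null_equiv M N.
Proof.
by move=> fK gK; exists f, g; split; [apply: eq_null (null0 _ _) => x; rewrite fK char2 |
  apply: eq_null (null0 _ _) => x; rewrite gK char2].
Qed.

Lemma gtens_homl_can (V X Y : gmod) (e : ghom X Y) (i : ghom Y X) : cancel e i ->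
  cancel (gtens_hom e (gid V)) (gtens_hom i (gid V)).
Proof.
move=> eK; apply: (ghom_tens_ext (f := gcomp (gtens_hom i (gid V)) (gtens_hom e (gid V)))
  (g := gid _)) => u v.
by rewrite gcompE [gtens_hom e _ _]tmapE [LHS]tmapE eK.
Qed.

Lemma null_equiv_unit (V A : gmod) : null_equiv (gtens V A) (gtens (gtens V gF) A).
Proof.
pose e := gcomp (gswap gF V) (gunitV V); pose i := gcomp (gunit V) (gswap V gF).
have eK : cancel e i by move=> x; rewrite !gcompE gswapK gunitVK.
have iK : cancel i e by move=> x; rewrite !gcompE gunitK gswapK.
exact: (iso_null_equiv (gtens_homl_can (V := A) eK) (gtens_homl_can (V := A) iK)).
Qed.

(** [null_kernel] applied to the connecting map and to the augmentation A(1) (x) A -> A, whose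
    kernel is stably Omega A. *)
Lemma null_kernel_tens (A L OA : gmod) (phi : ghom L gF) (u : L) :
  phi u = 1 :> 'F_2 -> is_Omega 1 A OA -> null (connecting A phi) ->
  null_equiv (gtens A (gker phi)) (gsum OA (gtens L A)).
Proof.
move=> phiu hOA hf.
have aug1 : A1_aug A1_one = 1 :> 'F_2 := A1_aug_one.
apply: (null_equiv_trans (N := gsum (gtens OmegaF A) (gtens L A))); last first.
  apply: null_equiv_sum; apply: null_equiv_trans (null_equiv_unit _ _) _.
  exact: is_red_equiv hOA.
pose i := gcomp (ker_tens phi A) (gswap A (gker phi)).
apply: (@null_kernel _ _ A (gtens A1 A) _ i (connecting A phi)
  (ker_tens A1_aug A) (connecting A A1_aug)).
- by move=> x y /(can_inj (ker_tensK phiu (A := A)))/(can_inj (@gswapK _ _)).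
- exact: can_inj (ker_tensK aug1 (A := A)).
- by move=> x; apply: connecting_ker_tens.
- exact: connecting_ker_tens.
- move=> x /(ker_tens_exact phiu)[w <-]; exists (gswap (gker phi) A w).
  by rewrite -[LHS]/(ker_tens phi A (gswap _ _ (gswap _ _ w))) gswapK.
- by move=> x /(ker_tens_exact aug1).
- by move=> y; apply: (connecting_surj phiu).
- by move=> y; apply: (connecting_surj aug1).
- exact/gproj_tensl/gproj_A1.
- exact: hf.
Qed.

(** The letter that may involve J comes last, so that [desuspend] can strip the leading copies of
    [AugI]; for k >= 1 the word starts with [AugI], as [null_gsym_kerT] requires. *)
Definition model (k : nat) (d : bool) : seq bool := nseq k false ++ [:: d].

(** [phi] and [yT] match because phi b is a scalar multiple of [yT] by [bottom_hom], and the scalar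
    is 1 since phi is non-zero. *)
Lemma is_OmegaDesusp_retract k (d : bool) (L : gmod) (phi : ghom L gF) :
  is_OmegaDesusp k.+1 (gtpow Joker d) L -> (exists x, phi x <> 0) ->
  exists (a : ghom L (T (model k d))) (b : ghom (T (model k d)) L),
    [/\ cancel a b, forall x, yT (model k d) (a x) = phi x
      & forall x, phi (b x) = yT (model k d) x].
Proof.
move=> /is_red_sret[Lred hL] [x0 phix0].
have [f [g gf]] := sret_trans hL (sret_T k d).
have [a [b ab]] := reduced_retract Lred gf.
have bh := bottom_hom (gcomp phi b) (bottomT (model k d)).
have phib x : phi (b x) = yT (model k d) x.
  rewrite -gcompE bh; have [e|->] := F2_cases (gcomp phi b (uT (model k d))).
    by case: phix0; rewrite -(ab x0) -gcompE bh e mulr0.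
  exact: mulr1.
by exists a, b; split=> // x; rewrite -phib ab.
Qed.

Lemma divT_dropn r s : divT (nseq r false ++ s) s.
Proof.
elim: r => [|r IH]; first exact: divT_refl.
exact: divT_trans (divT_drop false _) IH.
Qed.

Lemma nseq_rcons r s : nseq r false ++ false :: s = nseq r.+1 false ++ s.
Proof. by elim: r => //= r ->. Qed.

(** Surplus copies of [AugI] are dropped, which is multiplication by powers of h_0. If d and e
    differ then k < l, and the one copy kept in reserve allows the passage from [[:: false; d]] to
    [[:: e]]. *)
Lemma divT_model k l (d e : bool) : (k <= l)%N -> ~ (k = l /\ d != e) ->
  divT (model l d) (model k e).
Proof.
move=> kl kld; rewrite /model.
have [<-|de] := eqVneq d e.
  by rewrite -(subnK kl) nseqD -catA; apply: divT_dropn.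
have {kl kld} kl : (k < l)%N.
  by rewrite ltn_neqAle kl andbT; apply/eqP => e'; apply: kld.
rewrite -(subnK kl) nseqD -catA; apply: divT_trans (divT_dropn _ _) _.
rewrite -nseq_rcons; apply: divT_cat.
case: d e de => -[] // _; [exact: divT_cons (divT_drop true [::]) | exact: divT_swap].
Qed.

Lemma model_shape k (e : bool) : (1 <= k)%N -> exists b s, model k e = [:: false, b & s].
Proof. by case: k => // -[|k] _; [exists e, [::] | exists false, (model k e)]. Qed.

Lemma triangle_splits_model k (d e : bool) (Lk Ll : gmod)
    (phik : ghom Lk gF) (phil : ghom Ll gF) l :
  (1 <= k)%N -> (k <= l)%N ->
  is_OmegaDesusp k.+1 (gtpow Joker e) Lk -> (exists x, phik x <> 0) ->
  is_OmegaDesusp l.+1 (gtpow Joker d) Ll -> (exists x, phil x <> 0) ->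
  null (connecting (gker phik) phil) <-> ~ (k = l /\ d != e).
Proof.
move=> k1 kl hLk phik0 hLl phil0.
have [a [b [ab ya phib]]] := is_OmegaDesusp_retract hLk phik0.
have [a' [b' [_ ya' phib']]] := is_OmegaDesusp_retract hLl phil0.
split=> [hn [kl_eq de]|kld].
  have hy : null (connecting (gker phik) (yT (model l d))).
    apply: eq_null (null_compr (gtens_hom b' (gid _)) hn) => z.
    by rewrite (connecting_comp phib').
  have [u [u0 phiu]] := homog0_of phik0.
  have [r rE] := split_div u0 phiu hy.
  have : divT (model l d) (model k e).
    by exists (gcomp a r) => x; rewrite gcompE ya rE.
  (* For k = l both words have the same number of leading copies of [AugI]; stripping them leaves
     single letters. *)
  rewrite -kl_eq /model => /divT_desuspend.
  case: d e de {hLk hLl a b ab ya phib a' b' ya' phib' hy r rE} => -[] // _.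
    exact: not_divT_BI.
  exact: not_divT_IB.
have [c [s sE]] := model_shape e k1.
have hz := divT_model kl kld.
have [al alE] : exists al : ghom (gker phik) (gker (yT (model k e))),
    forall x, gker_incl _ (al x) = gcomp a (gker_incl phik) x.
  by apply: gker_factor => x; rewrite gcompE ya gker_inclP.
have [be beE] : exists be : ghom (gker (yT (model k e))) (gker phik),
    forall x, gker_incl _ (be x) = gcomp b (gker_incl (yT (model k e))) x.
  by apply: gker_factor => x; rewrite gcompE phib gker_inclP.
have be_al x : be (al x) = x.
  by apply: gker_incl_inj; rewrite beE gcompE alE gcompE ab.
have hn : null (connecting (gker (yT (model k e))) (yT (model l d))).
  by move: hz; rewrite sE; apply: null_connectingT.
apply: eq_null (null_compl be (null_compr (gtens_hom a' al) hn)).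
apply: (ghom_tens_ext (f := gcomp be (gcomp (connecting _ (yT (model l d))) (gtens_hom a' al)))) => m x.
rewrite -[LHS]/(be (connecting _ (yT (model l d)) (gtens_hom a' al (tpure m x)))).
by rewrite [gtens_hom a' _ _]tmapE !connectingE ya' [LHS]linearZ be_al.
Qed.

Local Close Scope ring_scope.

Theorem theorem12p3 (k l : nat) (delta eps : 'I_2)
    (k_ge1 : 1 <= k) (k_le_l : k <= l)
    (Lk : gmod) (Lk_def : is_OmegaDesusp k.+1 (gtpow Joker eps) Lk)
    (phik : ghom Lk gF) (phik_neq0 : exists x, phik x <> 0%R)
    (Ll : gmod) (Ll_def : is_OmegaDesusp l.+1 (gtpow Joker delta) Ll)
    (phil : ghom Ll gF) (phil_neq0 : exists x, phil x <> 0%R)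
    (OmegaAk : gmod) (OmegaAk_def : is_Omega 1 (gker phik) OmegaAk) :
  let Ak := gker phik in
  let Al := gker phil in
  (triangle_splits Ak phil <-> ~ (k = l /\ delta + eps = 1 %[mod 2])) /\
  (triangle_splits Ak phil ->
     stably_iso (gtens Ak Al) (gsum OmegaAk (gtens Ll Ak))).
Proof.
move=> Ak Al; rewrite /triangle_splits stably_zeroP; split; last first.
  have [u [_ phiu]] := homog0_of phil_neq0.
  by move=> hf; apply/null_equivP; apply: null_kernel_tens phiu OmegaAk_def hf.
(* Over {0, 1} the congruence says that the two exponents differ, which is the form in which the
   criterion is proved. *)
pose bit (i : 'I_2) : bool := odd i.
have bitE (i : 'I_2) : bit i = i :> nat by case: i => -[|[|]].
have -> : delta + eps = 1 %[mod 2] <-> bit delta != bit eps.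
  by rewrite -(bitE delta) -(bitE eps); case: (bit _) (bit _) => -[].
by apply: triangle_splits_model; rewrite ?bitE.
Qed.
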